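(* Let $d\geqslant 1$, let $P_1,P_0\in\mathbb{C}^{d\times d}$ with $P_1^{\star}=P_1$ invertible and $P_0^{\star}=-P_0$, and let $\mathcal{H}\colon[0,\infty)\to\mathbb{C}^{d\times d}$ be measurable, Hermitian almost everywhere, bounded, and such that for every bounded $K\subset[0,\infty)$ there are $m,M>0$ with $m|\zeta|^2\leqslant\zeta^{\star}\mathcal{H}(\xi)\zeta\leqslant M|\zeta|^2$ for all $\zeta\in\mathbb{C}^d$ and almost every $\xi\in K$. Let $A$ be the operator in $L^2_{\mathcal{H}}(0,\infty)$ given by $Ax=P_1(\mathcal{H}x)'+P_0\mathcal{H}x$ with $D(A)=\{x\in L^2_{\mathcal{H}}(0,\infty):(\mathcal{H}x)'\in L^2_{\mathcal{H}}(0,\infty),\ (\mathcal{H}x)(0)=0\}$. Let $S\in\mathbb{C}^{d\times d}$ be unitary with $P_1=S^{\star}\Delta S$, where $\Delta=\operatorname{diag}(\Lambda,-\Theta)$, $\Lambda=\operatorname{diag}(\lambda_1,\dots,\lambda_{n_+})$, $\Theta=\operatorname{diag}(\theta_1,\dots,\theta_{n_-})$, all $\lambda_k,\theta_j>0$, $n_++n_-=d$. Let $\mathcal{G}_1=\mathbb{C}^{n_+}$ with scalar product $\langle\cdot,\Lambda\,\cdot\rangle$ and $\mathcal{G}_2=\mathbb{C}^{n_-}$ with scalar product $\langle\cdot,\Theta\,\cdot\rangle$. Let $H\colon D(H)\subseteq L^2_{\mathcal{H}}(0,\infty)\to L^2_{\mathcal{H}}(0,\infty)$ be a linear operator with $D(A)\subseteq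 D(H)\subseteq\{x\in L^2_{\mathcal{H}}(0,\infty):(\mathcal{H}x)'\in L^2_{\mathcal{H}}(0,\infty)\}$ and $-Hx=P_1(\mathcal{H}x)'+P_0\mathcal{H}x$ for $x\in D(H)$. Then $H$ generates a $C_0$-semigroup of contractions if and only if there is a (linear) contraction $T\colon\mathcal{G}_2\to\mathcal{G}_1$ such that $$D(H)=\bigl\{x\in L^2_{\mathcal{H}}(0,\infty):(\mathcal{H}x)'\in L^2_{\mathcal{H}}(0,\infty)\text{ and }T\operatorname{pr}_-(S\mathcal{H}x(0))=\operatorname{pr}_+(S\mathcal{H}x(0))\bigr\}.$$
   Context: All functions are $\mathbb{C}^d$-valued. $L^2_{\mathcal{H}}(0,\infty)=\{x\in L^2_{\mathrm{loc}}[0,\infty): \int_0^\infty x(\xi)^{\star}\mathcal{H}(\xi)x(\xi)\,d\xi<\infty\}$ is a Hilbert space with scalar product $\langle x,y\rangle=\int_0^\infty x(\xi)^{\star}\mathcal{H}(\xi)y(\xi)\,d\xi$. The derivative $(\mathcal{H}x)'$ is taken in the sense of distributions; if $(\mathcal{H}x)'\in L^2_{\mathcal{H}}(0,\infty)$, then $\mathcal{H}x$ is continuous on $[0,\infty)$ and point evaluation at $0$ makes sense. $\operatorname{pr}_+\colon\mathbb{C}^d\to\mathbb{C}^{n_+}$ and $\operatorname{pr}_-\colon\mathbb{C}^d\to\mathbb{C}^{n_-}$ are the projections onto the first $n_+$ and the last $n_-$ coordinates, respectively; $\mathbb{C}^0:=\{0\}$. A contraction is a linear map of norm at most $1$. 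*)

(* Defs.v *)
From HB Require Import structures.
From mathcomp Require Import all_boot all_order all_algebra.
From mathcomp Require Import all_classical all_reals all_analysis measurable_realfun.
From mathcomp Require Import complex lra ring.

Set Implicit Arguments.
Unset Strict Implicit.
Unset Printing Implicit Defensive.

Import Order.TTheory GRing.Theory Num.Theory.
Import numFieldNormedType.Exports.
Import complex.

Local Open Scope classical_set_scope.
Local Open Scope ring_scope.
Local Open Scope complex_scope.
Local Open Scope sesquilinear_scope.
Local Open Scope quotient_scope.

(* The library attaches the norm topology to abstract numClosedFieldTypes only;
   these instances make it available on R[i]. *)
HB.instance Definition _ (R : realType) :=
  PseudoPointedMetric.copy R[i] (R[i] : numClosedFieldType).
HB.instance Definition _ (R : realType) := NormedModule.copy R[i] R[i]^o.

Section SesquilinearForm.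
Context {R : rcfType}.
Local Notation C := R[i].

Definition sform d (W : 'M[C]_d) (x y : 'cV[C]_d) : C := (x ^t* *m W *m y) 0 0.

Definition qform d (W : 'M[C]_d) (x : 'cV[C]_d) : R := Re (sform W x x).

Lemma ReD (u v : C) : Re (u + v) = Re u + Re v.
Proof. by case: u; case: v. Qed.

Lemma ImD (u v : C) : Im (u + v) = Im u + Im v.
Proof. by case: u; case: v. Qed.

Lemma sformDl d (W : 'M[C]_d) x y z :
  sform W (x + y) z = sform W x z + sform W y z.
Proof. by rewrite /sform linearD/= map_mxD !mulmxDl mxE. Qed.

Lemma sformDr d (W : 'M[C]_d) x y z :
  sform W x (y + z) = sform W x y + sform W x z.
Proof. by rewrite /sform mulmxDr mxE. Qed.

Lemma sformZl d (W : 'M[C]_d) a x z :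
  sform W (a *: x) z = a^* * sform W x z.
Proof. by rewrite /sform linearZ/= map_mxZ -!scalemxAl mxE. Qed.

Lemma sformZr d (W : 'M[C]_d) a x z :
  sform W x (a *: z) = a * sform W x z.
Proof. by rewrite /sform -!scalemxAr mxE. Qed.

Lemma sform_conj d (W : 'M[C]_d) x y : W ^t* = W ->
  sform W y x = (sform W x y)^*.
Proof.
move=> WH; have -> : (sform W x y)^* = ((x ^t* *m W *m y) ^t*) 0 0.
  by rewrite [RHS]mxE [_^T 0 0]mxE.
by rewrite trmx_mul map_mxM trmx_mul map_mxM WH mulmxA trmxCK.
Qed.

Lemma qformZ d (W : 'M[C]_d) a x :
  qform W (a *: x) = (Re a ^+ 2 + Im a ^+ 2) * qform W x.
Proof.
rewrite /qform sformZl sformZr mulrA; case: a => a b; case: (sform _ _ _) => u v.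
by rewrite /=; ring.
Qed.

Lemma qformrealD d (W : 'M[C]_d) (s : R) x y : W ^t* = W ->
  qform W (s%:C *: x + y) =
  s ^+ 2 * qform W x + s * (qform W (x + y) - qform W x - qform W y) + qform W y.
Proof.
move=> WH; rewrite /qform !(sformDl, sformDr, sformZl, sformZr).
rewrite (sform_conj y x WH).
case: (sform W x x) => a a'; case: (sform W y y) => b b'.
by case: (sform W y x) => c c' /=; ring.
Qed.

Lemma qformD_le d (W : 'M[C]_d) x y : W ^t* = W ->
  (forall z, 0 <= qform W z) ->
  qform W (x + y) <= 2 * qform W x + 2 * qform W y.
Proof.
move=> WH W0; have := W0 ((-1)%:C *: x + y).
by rewrite qformrealD// sqrrN expr1n; lra.
Qed.

End SesquilinearForm.

Section ComplexIntegral.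
Context {R : realType}.
Local Notation C := R[i].
Local Notation mu := (@lebesgue_measure R).
Implicit Types (D : set R) (f g : R -> C).

Lemma ae_mono (P Q : R -> Prop) : (\forall t \ae mu, P t) ->
  (forall t, P t -> Q t) -> \forall t \ae mu, Q t.
Proof. by move=> aP PQ; exact: (@filterS _ _ (ae_filter_ringOfSetsType mu) _ _ PQ). Qed.

Definition cmeasurable D f :=
  measurable_fun D (fun t => Re (f t)) /\ measurable_fun D (fun t => Im (f t)).

Definition cint D f : C :=
  (\int[mu]_(t in D) Re (f t)) +i* (\int[mu]_(t in D) Im (f t)).

Definition mxmeasurable m n D (F : R -> 'M[C]_(m, n)) :=
  forall i j, cmeasurable D (fun t => F t i j).

Definition vint d D (F : R -> 'cV[C]_d) : 'cV[C]_d :=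
  \col_i cint D (fun t => F t i 0).

Lemma cmeasurableD D f g : cmeasurable D f -> cmeasurable D g ->
  cmeasurable D (fun t => f t + g t).
Proof.
move=> [f1 f2] [g1 g2]; split.
  by under eq_fun do rewrite ReD; exact: measurable_funD.
by under eq_fun do rewrite ImD; exact: measurable_funD.
Qed.

Lemma cmeasurableM D f g : cmeasurable D f -> cmeasurable D g ->
  cmeasurable D (fun t => f t * g t).
Proof.
move=> [f1 f2] [g1 g2]; split.
  rewrite (_ : (fun _ => _) =
    (fun t => Re (f t) * Re (g t) - Im (f t) * Im (g t))); last first.
    by apply/funext => t; case: (f t); case: (g t).
  by apply: measurable_funB; exact: measurable_funM.
rewrite (_ : (fun _ => _) =
  (fun t => Re (f t) * Im (g t) + Im (f t) * Re (g t))); last first.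
  by apply/funext => t; case: (f t); case: (g t).
by apply: measurable_funD; exact: measurable_funM.
Qed.

Lemma cmeasurable_conj D f : cmeasurable D f -> cmeasurable D (fun t => (f t)^*).
Proof.
move=> [f1 f2]; split.
  rewrite (_ : (fun _ => _) = (fun t => Re (f t)))//.
  by apply/funext => t; case: (f t).
rewrite (_ : (fun _ => _) = (fun t => - Im (f t))).
  exact: measurableT_comp.
by apply/funext => t; case: (f t).
Qed.

Lemma cmeasurable_cst D (c : C) : cmeasurable D (fun=> c).
Proof. by split; exact: measurable_cst. Qed.

Lemma cmeasurable_sum D n (F : 'I_n -> R -> C) :
  (forall i, cmeasurable D (F i)) -> cmeasurable D (fun t => \sum_i F i t).
Proof.
move=> mF; elim: (index_enum _) => [|i s IH].
  by under eq_fun do rewrite big_nil; exact: cmeasurable_cst.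
by under eq_fun do rewrite big_cons; exact: cmeasurableD.
Qed.

Lemma cmeasurable_sform d D (W : R -> 'M[C]_d) (x y : R -> 'cV[C]_d) :
  mxmeasurable D W -> mxmeasurable D x -> mxmeasurable D y ->
  cmeasurable D (fun t => sform (W t) (x t) (y t)).
Proof.
move=> mW mx my; under eq_fun do rewrite /sform mxE.
apply: cmeasurable_sum => i; apply: cmeasurableM => //.
under eq_fun do rewrite mxE; apply: cmeasurable_sum => j.
apply: cmeasurableM => //; under eq_fun do rewrite !mxE.
exact: cmeasurable_conj.
Qed.

Lemma mxmeasurable_linear d D (a : C) (x y : R -> 'cV[C]_d) :
  mxmeasurable D x -> mxmeasurable D y ->
  mxmeasurable D (fun t => a *: x t + y t).
Proof.
move=> mx my i j; under eq_fun do rewrite !mxE.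
by apply: cmeasurableD => //; apply: cmeasurableM => //; exact: cmeasurable_cst.
Qed.

End ComplexIntegral.

Section WeightedNorm.
Context {R : realType} (d : nat).
Local Notation C := R[i].
Local Notation mu := (@lebesgue_measure R).
Context (D : set R) (W : R -> 'M[C]_d) (mD : measurable D)
  (mW : mxmeasurable D W)
  (W_ge0 : \forall t \ae mu, D t ->
    (W t) ^t* = W t /\ forall z, 0 <= qform (W t) z).
Implicit Types x y : R -> 'cV[C]_d.

Let q x t := qform (W t) (x t).
Let Q x := \int[mu]_(t in D) q x t.
Let L2 x := mxmeasurable D x /\ (\int[mu]_(t in D) (q x t)%:E < +oo)%E.

Lemma measurable_q x : mxmeasurable D x -> measurable_fun D (EFin \o q x).
Proof.
by move=> mx; apply/measurable_EFinP; exact: (cmeasurable_sform mW mx mx).1.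
Qed.

Lemma q_abs x : \forall t \ae mu, D t -> `|(q x t)%:E|%E = (q x t)%:E.
Proof.
apply: (ae_mono W_ge0) => t + Dt => /(_ Dt)[_ W0].
by rewrite gee0_abs// lee_fin; exact: W0.
Qed.

Lemma int_q_abs x : mxmeasurable D x ->
  (\int[mu]_(t in D) `|(q x t)%:E| = \int[mu]_(t in D) (q x t)%:E)%E.
Proof.
move=> mx; apply: ae_eq_integral => //; last exact: q_abs.
- by apply: measurableT_comp => //; exact: measurable_q.
- exact: measurable_q.
Qed.

Lemma L2_integrable x : L2 x -> mu.-integrable D (EFin \o q x).
Proof.
move=> [mx fx]; apply/integrableP; split; first exact: measurable_q.
by rewrite int_q_abs.
Qed.

Lemma L2_linear a x y : L2 x -> L2 y -> L2 (fun t => a *: x t + y t).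
Proof.
move=> Lx Ly; have mxy := mxmeasurable_linear a Lx.1 Ly.1; split => //.
pose c := 2 * (Re a ^+ 2 + Im a ^+ 2).
have iG : mu.-integrable D (fun t => c%:E * (q x t)%:E + 2%:E * (q y t)%:E)%E.
  by apply: integrableD => //; apply: integrableZl => //; exact: L2_integrable.
have /integrableP[mG fG] := iG.
apply: le_lt_trans fG.
rewrite -int_q_abs//; apply: ae_ge0_le_integral => //.
- by apply: measurableT_comp => //; exact: measurable_q.
- exact: measurableT_comp.
- apply: (ae_mono W_ge0) => t + Dt => /(_ Dt)[WH W0].
  have q0 z : 0 <= q z t by exact: W0.
  have c0 : 0 <= c by rewrite /c mulr_ge0// addr_ge0// sqr_ge0.
  rewrite -!EFinM -EFinD !abse_EFin lee_fin ger0_norm// ger0_norm; last first.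
    by rewrite addr_ge0// mulr_ge0.
  by rewrite /q (le_trans (qformD_le _ _ WH W0))// qformZ mulrA.
Qed.

Lemma Q_ae_eq x y : mxmeasurable D x -> mxmeasurable D y ->
  (\forall t \ae mu, D t -> x t = y t) -> Q x = Q y.
Proof.
move=> mx my xy; congr fine; apply: ae_eq_integral => //.
- exact: measurable_q.
- exact: measurable_q.
- by apply: (ae_mono xy) => t + Dt => /(_ Dt) xyt; rewrite /q xyt.
Qed.

Lemma Q_ge0 x : mxmeasurable D x -> 0 <= Q x.
Proof. by move=> mx; apply: fine_ge0; rewrite -int_q_abs// integral_ge0. Qed.

Lemma QZ (a : C) x : L2 x -> Q (fun t => a *: x t) = (Re a ^+ 2 + Im a ^+ 2) * Q x.
Proof.
move=> Lx; rewrite -RintegralZl//; last exact: L2_integrable.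
by apply: eq_Rintegral => t _; rewrite /q qformZ.
Qed.

Lemma quad_disc (u v b : R) : 0 <= u -> 0 <= v ->
  (forall s, 0 <= s ^+ 2 * u ^+ 2 + s * b + v ^+ 2) -> b <= 2 * u * v.
Proof.
move=> u0 v0 H; have [uE|un0] := eqVneq u 0.
  rewrite uE mulr0 mul0r leNgt; apply/negP => b0.
  by have := H (- (v ^+ 2 + 1) / b); rewrite uE mulfVK ?gt_eqF//; lra.
have u2 : 0 < 2 * u ^+ 2 by rewrite mulr_gt0// exprn_gt0// lt0r un0.
have [b0|b0] := ltP b 0; first by rewrite (le_trans (ltW b0))// !mulr_ge0.
rewrite -ler_sqr ?nnegrE ?mulr_ge0//.
have := H (- b / (2 * u ^+ 2)).
rewrite -(pmulr_rge0 _ u2).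
have -> : 2 * u ^+ 2 * ((- b / (2 * u ^+ 2)) ^+ 2 * u ^+ 2 +
    - b / (2 * u ^+ 2) * b + v ^+ 2) = 2 * u ^+ 2 * v ^+ 2 - b ^+ 2 / 2.
  by field.
by rewrite !exprMn; lra.
Qed.

Let iZ (s : R) (f : R -> R) : mu.-integrable D (EFin \o f) ->
  mu.-integrable D (EFin \o (fun t => s * f t)).
Proof. exact: integrableZl. Qed.

Let iD (f g : R -> R) : mu.-integrable D (EFin \o f) ->
  mu.-integrable D (EFin \o g) -> mu.-integrable D (EFin \o (fun t => f t + g t)).
Proof. exact: integrableD. Qed.

Let iB (f g : R -> R) : mu.-integrable D (EFin \o f) ->
  mu.-integrable D (EFin \o g) -> mu.-integrable D (EFin \o (fun t => f t - g t)).
Proof. exact: integrableB. Qed.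

Lemma QrealD (s : R) x y : L2 x -> L2 y ->
  Q (fun t => s%:C *: x t + y t) =
  s ^+ 2 * Q x + s * (Q (fun t => x t + y t) - Q x - Q y) + Q y.
Proof.
move=> Lx Ly.
have Lxy : L2 (fun t => x t + y t).
  by have := L2_linear 1 Lx Ly; under eq_fun do rewrite scale1r.
have [ix iy ixy] :=
  And3 (L2_integrable Lx) (L2_integrable Ly) (L2_integrable Lxy).
pose r t := s ^+ 2 * q x t +
  s * (q (fun t => x t + y t) t - q x t - q y t) + q y t.
have i1 : mu.-integrable D (EFin \o (fun t => s ^+ 2 * q x t)).
  exact: iZ.
have i2 : mu.-integrable D (EFin \o (fun t => q (fun t => x t + y t) t - q x t)).
  exact: iB.
have i3 : mu.-integrable D
    (EFin \o (fun t => q (fun t => x t + y t) t - q x t - q y t)).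
  exact: iB.
have i4 : mu.-integrable D
    (EFin \o (fun t => s * (q (fun t => x t + y t) t - q x t - q y t))).
  exact: iZ.
have i5 : mu.-integrable D (EFin \o (fun t => s ^+ 2 * q x t +
    s * (q (fun t => x t + y t) t - q x t - q y t))).
  exact: iD.
have -> : Q (fun t => s%:C *: x t + y t) = \int[mu]_(t in D) r t.
  congr fine; apply: ae_eq_integral => //.
  - exact: (measurable_q (L2_linear s%:C Lx Ly).1).
  - exact: (measurable_int _ (iD i5 iy)).
  - by apply: (ae_mono W_ge0) => t + Dt => /(_ Dt)[WH _]; rewrite /q qformrealD.
rewrite RintegralD// RintegralD// RintegralZl// RintegralZl//.
by rewrite RintegralB// RintegralB.
Qed.

Lemma Q_triangle x y : L2 x -> L2 y ->
  Num.sqrt (Q (fun t => x t + y t)) <= Num.sqrt (Q x) + Num.sqrt (Q y).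
Proof.
move=> Lx Ly; have Qx0 := Q_ge0 Lx.1; have Qy0 := Q_ge0 Ly.1.
have := @quad_disc (Num.sqrt (Q x)) (Num.sqrt (Q y))
  (Q (fun t => x t + y t) - Q x - Q y) (sqrtr_ge0 _) (sqrtr_ge0 _).
rewrite !sqr_sqrtr// => disc.
rewrite -[leRHS]ger0_norm ?addr_ge0 ?sqrtr_ge0// -sqrtr_sqr ler_wsqrtr//.
rewrite sqrrD !sqr_sqrtr// -mulr_natl.
have {disc} : Q (fun t => x t + y t) - Q x - Q y
    <= 2 * Num.sqrt (Q x) * Num.sqrt (Q y).
  apply: disc => s; rewrite -QrealD// Q_ge0//.
  exact: mxmeasurable_linear Lx.1 Ly.1.
by lra.
Qed.

Lemma Q_eq0 x : L2 x -> Q x = 0 -> \forall t \ae mu, D t -> q x t = 0.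
Proof.
move=> Lx Qx0; have /integrableP[mq fq] := L2_integrable Lx.
have /ae_eq_integral_abs : (\int[mu]_(t in D) `|(EFin \o q x) t| = 0)%E.
  rewrite int_q_abs ?Lx.1//; last exact: Lx.1.
  rewrite -[LHS]fineK; first by rewrite -/(Rintegral _ _ _) -/(Q x) Qx0.
  by apply: integrable_fin_num => //; exact: L2_integrable.
move=> h0; have h := h0 mD mq; apply: (ae_mono h) => t + Dt => /(_ Dt) /= [].
exact.
Qed.

End WeightedNorm.

Section EnergySpace.
Context (R : realType) (d : nat).
Local Notation C := R[i].
Local Notation mu := (@lebesgue_measure R).
Local Notation halfline := (`[0%R, +oo[%classic : set R).

(* Functions on [0, +oo[ are total functions on R; their values on ]-oo, 0[ are
   never used. *)
Definition L2loc (x : R -> 'cV[C]_d) : Prop :=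
  mxmeasurable halfline x /\
  forall b : R, (\int[mu]_(t in `[0%R, b]) (Re ((x t ^t* *m x t) 0 0))%:E < +oo)%E.

Record energy_density := EnergyDensity {
  density :> R -> 'M[C]_d ;
  density_measurable : mxmeasurable halfline density ;
  density_hermitian : \forall t \ae mu, 0 <= t -> (density t) ^t* = density t ;
  density_bounded : exists M : R,
    forall t, 0 <= t -> forall i j, `|density t i j| <= M%:C ;
  density_coercive : forall K : set R, bounded_set K -> K `<=` halfline ->
    exists m M : R, [/\ 0 < m, 0 < M & \forall t \ae mu, K t ->
      forall z : 'cV[C]_d,
        m%:C * (z ^t* *m z) 0 0 <= (z ^t* *m density t *m z) 0 0
          <= M%:C * (z ^t* *m z) 0 0]
}.

Context (h : energy_density).

Definition L2H_pred (x : R -> 'cV[C]_d) : Prop :=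
  L2loc x /\
  (\int[mu]_(t in halfline) (Re ((x t ^t* *m h t *m x t) 0 0))%:E < +oo)%E.

Lemma sform1 (x y : 'cV[C]_d) : sform 1%:M x y = (x ^t* *m y) 0 0.
Proof. by rewrite /sform mulmx1. Qed.

Lemma qform1_ge0 (z : 'cV[C]_d) : 0 <= qform 1%:M z.
Proof.
rewrite /qform sform1 mxE; elim/big_ind: _ => //.
- by move=> a b a0 b0; rewrite ReD addr_ge0.
- move=> i _; rewrite !mxE; case: (z i 0) => a b /=.
  by rewrite mulNr opprK addr_ge0// -expr2 sqr_ge0.
Qed.

Lemma qform1_eq0 (z : 'cV[C]_d) : qform 1%:M z = 0 -> z = 0.
Proof.
rewrite /qform sform1 mxE => z0; apply/matrixP => i j; rewrite ord1 mxE {j}.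
have Re_sum (F : 'I_d -> C) : Re (\sum_i F i) = \sum_i Re (F i).
  by elim/big_rec2: _ => // k a b _ <-; rewrite ReD.
have F0 k : 0 <= Re ((z ^t*) 0 k * z k 0).
  rewrite !mxE; case: (z k 0) => a b /=.
  by rewrite mulNr opprK addr_ge0// -expr2 sqr_ge0.
move: z0; rewrite Re_sum => /eqP; rewrite psumr_eq0// => /allP /(_ i).
rewrite mem_index_enum => /(_ isT) /=; rewrite !mxE.
case: (z i 0) => a b /=; rewrite mulNr opprK -!expr2 paddr_eq0 ?sqr_ge0//.
by rewrite !sqrf_eq0 => /andP[/eqP -> /eqP ->].
Qed.

Lemma density_coerciveN (n : nat) : exists m : R, 0 < m /\
  \forall t \ae mu, 0 <= t -> t <= n%:R -> forall z : 'cV[C]_d,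
  m * qform 1%:M z <= qform (h t) z.
Proof.
have bK : bounded_set (`[0, n%:R]%classic : set R).
  by apply: compact_bounded; exact: segment_compact.
have sK : (`[0, n%:R]%classic : set R) `<=` halfline.
  by move=> t /=; rewrite !in_itv/= andbT => /andP[].
have [m [M [m0 M0 mM]]] := density_coercive h bK sK.
exists m; split => //; apply: (ae_mono mM) => t H t0 tn z.
have /H/(_ z)/andP[+ _] : `[0, n%:R]%classic t by rewrite /= in_itv/= t0.
rewrite -sform1 -/(sform (h t) z z) lecE => /andP[_]; rewrite /qform.
by case: (sform 1%:M z z) => a b /=; rewrite mul0r subr0.
Qed.

Lemma density_psd : \forall t \ae mu, halfline t ->
  (h t) ^t* = h t /\ forall z, 0 <= qform (h t) z.
Proof.
have : \forall t \ae mu, forall n : nat, 0 <= t -> t <= n%:R ->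
    forall z : 'cV[C]_d, 0 <= qform (h t) z.
  apply: ae_foralln => n; have [m [m0 hm]] := density_coerciveN n.
  apply: (ae_mono hm) => t H t0 tn z.
  by rewrite (le_trans _ (H t0 tn z))// mulr_ge0 ?qform1_ge0// ltW.
move=> H1; have H2 := density_hermitian h.
have F := ae_filter_ringOfSetsType mu.
apply: (ae_mono (@filterI _ _ F _ _ H1 H2)) => t [H3 H4].
rewrite /= in_itv/= andbT => t0; split; first exact: H4.
exact: (H3 (Num.truncn t).+1 t0 (ltW (truncnS_gt t))).
Qed.

Lemma mxmeasurable_cst1 (A : set R) : mxmeasurable A (fun=> 1%:M : 'M[C]_d).
Proof. by move=> i j; exact: cmeasurable_cst. Qed.

Lemma one_psd (A : set R) : \forall t \ae mu, A t ->
  (1%:M : 'M[C]_d) ^t* = 1%:M /\ forall z : 'cV[C]_d, 0 <= qform 1%:M z.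
Proof.
by apply: aeW => t _; split; [rewrite trmx1 map_mx1|exact: qform1_ge0].
Qed.

Lemma measurable_halfline : measurable halfline.
Proof. exact: measurable_itv. Qed.

Lemma L2H_linear a x y : L2H_pred x -> L2H_pred y ->
  L2H_pred (fun t => a *: x t + y t).
Proof.
move=> [[mx lx] fx] [[my ly] fy].
have [mxy fxy] := L2_linear measurable_halfline (density_measurable h)
  density_psd a (conj mx fx) (conj my fy).
split; [split; [exact: mxy|move=> b]|exact: fxy].
have sub : `[0%R, b] `<=` halfline.
  by move=> t /=; rewrite !in_itv/= andbT => /andP[].
have mS (z : R -> 'cV[C]_d) : mxmeasurable halfline z -> mxmeasurable `[0%R, b] z.
  move=> mz i j; have [m1 m2] := mz i j.
  by split; [exact: measurable_funS m1|exact: measurable_funS m2].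
have e (z : R -> 'cV[C]_d) :
    (\int[mu]_(t in `[0%R, b]) (Re ((z t ^t* *m z t) 0 0))%:E =
     \int[mu]_(t in `[0%R, b]) (qform 1%:M (z t))%:E)%E.
  by apply: eq_integral => t _; rewrite /qform sform1.
rewrite e; have := @L2_linear _ d `[0%R, b]%classic (fun=> 1%:M) (measurable_itv _)
  (@mxmeasurable_cst1 _) (@one_psd _) a x y (conj (mS _ mx) _) (conj (mS _ my) _).
by rewrite -!e => /(_ (lx b) (ly b))[].
Qed.

Lemma L2H_pred0 : L2H_pred 0.
Proof.
have i0 (A : set R) : (\int[mu]_(t in A) (0 : \bar R) < +oo)%E.
  by rewrite integral0.
change (L2H_pred (fun=> 0 : 'cV[C]_d)); split; [split; [move=> i j; split|move=> b]|].
- exact: measurable_cst.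
- exact: measurable_cst.
- by rewrite mulmx0 mxE; exact: i0.
- by under eq_integral do rewrite mulmx0 mxE /=; exact: i0.
Qed.

Definition L2H_mem : {pred R -> 'cV[C]_d} := fun x => `[< L2H_pred x >].

Lemma L2H_submod_closed : submod_closed L2H_mem.
Proof.
split; first exact/asboolP/L2H_pred0.
by move=> a x y /asboolP Lx /asboolP Ly; apply/asboolP; exact: L2H_linear.
Qed.

HB.instance Definition _ :=
  GRing.isSubmodClosed.Build C (R -> 'cV[C]_d) L2H_mem L2H_submod_closed.

Record L2H_fun := L2HFun { L2H_val :> R -> 'cV[C]_d ; _ : L2H_val \in L2H_mem }.
HB.instance Definition _ := [isSub for L2H_val].
HB.instance Definition _ := [Choice of L2H_fun by <:].
HB.instance Definition _ := [SubChoice_isSubLmodule of L2H_fun by <:].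

Definition L2H_null : {pred L2H_fun} :=
  fun x => `[< \forall t \ae mu, 0 <= t -> x t = 0 >].

Lemma L2H_null_closed : zmod_closed L2H_null.
Proof.
split; first by apply/asboolP/aeW.
move=> x y /asboolP x0 /asboolP y0; apply/asboolP.
have F := ae_filter_ringOfSetsType mu.
apply: (ae_mono (@filterI _ _ F _ _ x0 y0)) => t [H1 H2] t0.
by rewrite [LHS](_ : _ = x t - y t)// H1// H2// subr0.
Qed.

HB.instance Definition _ :=
  GRing.isZmodClosed.Build L2H_fun L2H_null L2H_null_closed.

(* the quotient of L2H_fun by almost everywhere equality on [0, +oo[ *)
Definition L2H : Type := Quotient.quot L2H_null.
HB.instance Definition _ := Choice.on L2H.
HB.instance Definition _ := GRing.Zmodule.on L2H.
HB.instance Definition _ := EqQuotient.on L2H.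

Definition L2H_rep (x : L2H) : R -> 'cV[C]_d := repr x.

Lemma L2H_eqP (f g : L2H_fun) :
  reflect (\forall t \ae mu, 0 <= t -> f t = g t) (\pi_L2H f == \pi_L2H g).
Proof.
rewrite -Quotient.idealrBE; apply: (iffP (asboolP _)) => fg;
  apply: (ae_mono fg) => t + t0 => /(_ t0) /=.
- by rewrite [LHS](_ : _ = f t - g t)// => /eqP; rewrite subr_eq0 => /eqP.
- by move=> fgt; rewrite [LHS](_ : _ = f t - g t)// fgt subrr.
Qed.

Lemma L2H_rep_pi (f : L2H_fun) : \forall t \ae mu, 0 <= t ->
  L2H_rep (\pi_L2H f) t = f t.
Proof. by apply/L2H_eqP; rewrite reprK. Qed.

Definition L2H_scale (a : C) (x : L2H) : L2H := \pi_L2H (a *: (repr x : L2H_fun)).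

Lemma L2H_pi_scale a (f : L2H_fun) : L2H_scale a (\pi_L2H f) = \pi_L2H (a *: f).
Proof.
apply/eqP/L2H_eqP; apply: (ae_mono (L2H_rep_pi f)) => t + t0 => /(_ t0) ft.
by rewrite [LHS](_ : _ = a *: L2H_rep (\pi_L2H f) t)// ft.
Qed.

Lemma L2H_piD (f g : L2H_fun) : \pi_L2H f + \pi_L2H g = \pi_L2H (f + g).
Proof. exact/esym/(raddfD (\pi_(Quotient.quot L2H_null))). Qed.

Lemma L2H_scaleA a b x : L2H_scale a (L2H_scale b x) = L2H_scale (a * b) x.
Proof. by elim/quotW: x => f; rewrite (L2H_pi_scale b f) !L2H_pi_scale scalerA. Qed.

Lemma L2H_scale1 x : L2H_scale 1 x = x.
Proof. by elim/quotW: x => f; rewrite L2H_pi_scale scale1r. Qed.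

Lemma L2H_scaleDr a x y : L2H_scale a (x + y) = L2H_scale a x + L2H_scale a y.
Proof.
elim/quotW: x => f; elim/quotW: y => g.
by rewrite L2H_piD (L2H_pi_scale a f) (L2H_pi_scale a g) L2H_pi_scale
  L2H_piD scalerDr.
Qed.

Lemma L2H_scaleDl x a b : L2H_scale (a + b) x = L2H_scale a x + L2H_scale b x.
Proof. by elim/quotW: x => f; rewrite !(L2H_pi_scale _ f) L2H_piD scalerDl. Qed.

HB.instance Definition _ := GRing.Zmodule_isLmodule.Build C L2H
  L2H_scaleA L2H_scale1 L2H_scaleDr L2H_scaleDl.

Definition L2H_dot (x y : L2H) : C :=
  cint halfline (fun t => (L2H_rep x t ^t* *m h t *m L2H_rep y t) 0 0).

Definition L2H_norm (x : L2H) : C := (Num.sqrt (Re (L2H_dot x x)))%:C.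

Let Q (f : R -> 'cV[C]_d) := (\int[mu]_(t in halfline) qform (h t) (f t))%R.

Lemma L2H_funP (f : L2H_fun) : L2H_pred f.
Proof. by case: f => f /= /asboolP. Qed.

Lemma L2H_fun_L2 (f : L2H_fun) : mxmeasurable halfline f /\
  (\int[mu]_(t in halfline) (qform (h t) (f t))%:E < +oo)%E.
Proof. by have [[mf _] ff] := L2H_funP f. Qed.

Lemma halfline_ae (P : R -> Prop) : (\forall t \ae mu, 0 <= t -> P t) ->
  \forall t \ae mu, halfline t -> P t.
Proof. by move=> aP; apply: (ae_mono aP) => t; rewrite /= in_itv/= andbT. Qed.

Lemma L2H_norm_pi (f : L2H_fun) : L2H_norm (\pi_L2H f) = (Num.sqrt (Q f))%:C.
Proof.
congr (Num.sqrt _)%:C; apply: (Q_ae_eq measurable_halfline (density_measurable h)).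
- exact: (L2H_fun_L2 _).1.
- exact: (L2H_fun_L2 _).1.
- exact/halfline_ae/L2H_rep_pi.
Qed.

Lemma ler_L2H_normD (x y : L2H) : L2H_norm (x + y) <= L2H_norm x + L2H_norm y.
Proof.
elim/quotW: x => f; elim/quotW: y => g.
rewrite L2H_piD (L2H_norm_pi f) (L2H_norm_pi g) L2H_norm_pi -rmorphD lecR.
exact: (Q_triangle measurable_halfline (density_measurable h) density_psd
  (L2H_fun_L2 f) (L2H_fun_L2 g)).
Qed.

Lemma L2H_normZ (a : C) (x : L2H) : L2H_norm (a *: x) = `|a| * L2H_norm x.
Proof.
elim/quotW: x => f; rewrite [a *: _](L2H_pi_scale a f) (L2H_norm_pi f).
rewrite (L2H_norm_pi (a *: f)) normc_def -rmorphM; congr (_%:C).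
rewrite -sqrtrM ?addr_ge0 ?sqr_ge0//; congr Num.sqrt.
exact: (QZ measurable_halfline (density_measurable h) density_psd a
  (L2H_fun_L2 f)).
Qed.

Lemma L2H_norm0_eq0 (x : L2H) : L2H_norm x = 0 -> x = 0.
Proof.
elim/quotW: x => f; rewrite (L2H_norm_pi f) => /complexI/eqP.
have Lf := L2H_fun_L2 f.
rewrite sqrtr_eq0 => Q0; have {}Q0 : Q f = 0.
  apply/eqP; rewrite eq_le Q0/=.
  exact: (Q_ge0 measurable_halfline (density_measurable h) density_psd Lf.1).
have q0 := Q_eq0 measurable_halfline (density_measurable h) density_psd Lf Q0.
have zf : \forall t \ae mu, forall n : nat, 0 <= t -> t <= n%:R -> f t = 0.
  apply: ae_foralln => n; have [m [m0 hm]] := density_coerciveN n.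
  have F := ae_filter_ringOfSetsType mu.
  apply: (ae_mono (@filterI _ _ F _ _ q0 hm)) => t [ft0 H] t0 tn.
  apply: qform1_eq0; apply/eqP; rewrite eq_le qform1_ge0 andbT.
  have := H t0 tn (f t); rewrite ft0 ?pmulr_rle0//.
  by rewrite /= in_itv/= t0.
rewrite [RHS](_ : _ = \pi_L2H (0 : L2H_fun)); last first.
  by rewrite -[LHS](raddf0 (\pi_(Quotient.quot L2H_null))).
apply/eqP/L2H_eqP; apply: (ae_mono zf) => t H t0.
exact: (H (Num.truncn t).+1 t0 (ltW (truncnS_gt t))).
Qed.

HB.instance Definition _ := Lmodule_isNormed.Build C L2H
  ler_L2H_normD L2H_normZ L2H_norm0_eq0.

Lemma L2H_normE (x : L2H) : `|x| = (Num.sqrt (Re (L2H_dot x x)))%:C.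
Proof. by []. Qed.

End EnergySpace.

Section PortHamiltonian.
Context (R : realType) (d : nat).
Local Notation C := R[i].
Local Notation mu := (@lebesgue_measure R).
Local Notation halfline := (`[0%R, +oo[%classic : set R).

Definition test_function (phi : R -> R) : Prop :=
  let supp := closure [set t | phi t != 0] in
  [/\ forall n t, derivable (derive1n n phi) t 1,
      compact supp & supp `<=` `]0, +oo[%classic].

(* v is the derivative of u in the sense of distributions on ]0, +oo[, for
   locally integrable u and v *)
Definition distr_derivative (u v : R -> 'cV[C]_d) : Prop :=
  forall phi, test_function phi ->
    vint halfline (fun t => (derive1 phi t)%:C *: u t) =
    - vint halfline (fun t => (phi t)%:C *: v t).

(* The value at 0 of the continuous representative of u on [0, +oo[; it is
   unique if it exists, and the junk value 0 is returned otherwise. *)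
Definition value0 (u : R -> 'cV[C]_d) : 'cV[C]_d :=
  xget 0 [set z | exists v : R -> 'cV[C]_d,
    [/\ {within halfline, continuous v},
        \forall t \ae mu, 0 <= t -> u t = v t & v 0 = z]].

Context (h : energy_density R d).

Definition Hx (x : L2H h) : R -> 'cV[C]_d := fun t => h t *m L2H_rep x t.

Definition Hx_derivative (x g : L2H h) : Prop :=
  distr_derivative (Hx x) (L2H_rep g).

Definition max_dom : set (L2H h) := [set x | exists g, Hx_derivative x g].

(* y = P1 (Hx)' + P0 Hx with (Hx)' and y in the energy space *)
Definition pH_graph (P1 P0 : 'M[C]_d) (x y : L2H h) : Prop :=
  exists2 g, Hx_derivative x g & \forall t \ae mu, 0 <= t ->
    L2H_rep y t = P1 *m L2H_rep g t + P0 *m Hx x t.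

End PortHamiltonian.
Arguments max_dom {R d} h _.

(* The values of an operator outside its domain are irrelevant. *)
Record operator (K : nzRingType) (V : lmodType K) := Operator {
  dom : set V ;
  op_fun :> V -> V ;
  dom0 : dom 0 ;
  dom_linear : forall a x y, dom x -> dom y -> dom (a *: x + y) ;
  op_linear : forall a x y, dom x -> dom y ->
    op_fun (a *: x + y) = a *: op_fun x + op_fun y
}.

Section Semigroup.
Context (R : realType) (V : normedModType R[i]).

Record C0_semigroup (T : R -> V -> V) : Prop := {
  C0_linear : forall t, 0 <= t -> linear (T t) ;
  C0_bounded : forall t, 0 <= t -> continuous (T t) ;
  C0_id : forall x, T 0 x = x ;
  C0_comp : forall s t, 0 <= s -> 0 <= t -> forall x, T (s + t) x = T s (T t x) ;
  C0_cvg : forall x, T t x @[t --> 0^'+] --> x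
}.

Definition contractive (T : R -> V -> V) : Prop :=
  forall t, 0 <= t -> forall x, `|T t x| <= `|x|.

Definition is_generator (A : operator V) (T : R -> V -> V) : Prop :=
  forall x y, (dom A x /\ A x = y) <->
    (t^-1)%:C *: (T t x - x) @[t --> 0^'+] --> y.

Definition generates_contraction_semigroup (A : operator V) : Prop :=
  exists T, [/\ C0_semigroup T, contractive T & is_generator A T].

End Semigroup.

Section Boundary.
Context (R : realType).
Local Notation C := R[i].

Definition rdiag n (lam : 'rV[R]_n) : 'M[C]_n :=
  diag_mx (map_mx (fun r => r%:C) lam).

(* the norm given by the scalar product <., diag(lam) .> *)
Definition wnorm n (lam : 'rV[R]_n) (z : 'cV[C]_n) : R :=
  Num.sqrt (Re ((z ^t* *m rdiag lam *m z) 0 0)).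

Definition wcontraction n m (theta : 'rV[R]_m) (lam : 'rV[R]_n)
    (T : 'cV[C]_m -> 'cV[C]_n) : Prop :=
  forall z, wnorm lam (T z) <= wnorm theta z.

End Boundary.

(* Main.v *)
(* Put u = Hx and M x = P1 u' + P0 u.  Green's identity reads
   <M x, y> + <x, M y> = - u(0)^* P1 v(0), so that -M is dissipative exactly on
   the boundary values u(0) with |pr_+ S u(0)|_Lambda <= |pr_- S u(0)|_Theta.

   Testing with compactly supported fields shows that the
   adjoint of M, restricted to boundary values in V, is -M restricted to the
   boundary values in (P1 V)^perp.  If V is the graph of a contraction T, then
   (P1 V)^perp consists of the c with pr_- S c = Theta^-1 T^* Lambda pr_+ S c;
   hence -M is closed, the ranges of l + M have trivial orthogonal complement,
   and -M generates: the resolvents J = (1 - t H)^-1 are contractions and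
   J_(2^-k)^(2^k t) converges to the semigroup.

   If H generates, the boundary values of its domain form the graph of a partial
   contraction, which extends to a contraction T.  The operator with boundary
   condition T is a dissipative extension of H, so it equals H, since a generator
   of contractions has no proper dissipative extension.

   The derivative u' lies in the energy space, but it is not clear that P1 u' and
   P1^-1 u' do, as the density H is not bounded from below at infinity.  This
   follows from A being an operator into the energy space: multiplying f by a
   rapidly oscillating sign e makes the primitive of e f (corrected by small
   constants) so small that it is the energy variable of an element of D(A), hence
   P1 (e f), and with it P1 f, belongs to the energy space.  By Cayley-Hamilton
   the same holds for P1^-1. *)
Require Import Defs.
From mathcomp Require Import all_boot all_order all_algebra.
From mathcomp Require Import all_classical all_reals all_analysis.
From mathcomp Require Import complex.
From mathcomp Require Import measurable_realfun lra ring zify.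
Import Order.TTheory GRing.Theory Num.Theory.
Import numFieldNormedType.Exports.
Local Open Scope classical_set_scope.
Local Open Scope ring_scope.
Local Open Scope complex_scope.
Local Open Scope sesquilinear_scope.
Import complex.
Set Implicit Arguments.
Unset Strict Implicit.
Unset Printing Implicit Defensive.

(** * Absolutely continuous functions *)

Section RealIntegrals.
Context {R : realType}.
Local Notation mu := (@lebesgue_measure R).
Local Notation halfline := (`[0%R, +oo[%classic : set R).
Implicit Types (f g : R -> R) (D : set R) (s t r b c : R).

(** The lack of a lower bound on the density at infinity shapes the whole proof. An energy variable
    [u = Hx] is square integrable without weight, because a bounded nonnegative [H] satisfies
    [H^2 <= c H], whereas [u'] is only known to lie in the weighted space. Green's identity survives
    since each of its integrands pairs an element of the energy space with an energy variable, and
    the boundary term at infinity vanishes because [u^* P1 v] is integrable together with its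
    derivative.

    Hilbert space arguments use the real part of the scalar product alone: dissipativity,
    contractivity and the projection argument involve nothing else. Weak derivatives are traded at
    once for pairs [(f, g)] with [f t = f 0] plus the integral of [g] over [[0, t]].

    Euler steps on dyadic grids are compared by halving the step, which costs an error of second
    order on the domain of [H^2]; no integral of a vector valued orbit is ever formed. *)

Definition intble D f := mu.-integrable D (EFin \o f).

Lemma intbleD D f g : measurable D -> intble D f -> intble D g ->
  intble D (fun t => f t + g t).
Proof. by move=> mD; exact: integrableD. Qed.

Lemma intbleZ D (c : R) f : measurable D -> intble D f -> intble D (fun t => c * f t).
Proof. by move=> mD; exact: integrableZl. Qed.

Lemma intbleB D f g : measurable D -> intble D f -> intble D g ->
  intble D (fun t => f t - g t).
Proof. by move=> mD; exact: integrableB. Qed.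

Lemma intble_measurable D f : intble D f -> measurable_fun D f.
Proof. by move=> /(measurable_int mu) /measurable_EFinP. Qed.

Lemma intble_norm D f : measurable D -> intble D f -> intble D (fun t => `|f t|).
Proof. by move=> mD fi; exact: (integrable_norm fi). Qed.

Lemma intble_ae_le D f g : measurable D -> measurable_fun D f -> intble D g ->
  (\forall t \ae mu, D t -> `|f t| <= g t) -> intble D f.
Proof.
move=> mD mf /integrableP[mg ig] fg; apply/integrableP; split; first exact/measurable_EFinP.
apply: le_lt_trans ig; apply: ae_ge0_le_integral => //.
- by apply: measurableT_comp => //; exact/measurable_EFinP.
- exact: measurableT_comp.
- apply: (ae_mono fg) => t + Dt => /(_ Dt) h /=.
  by rewrite lee_fin (le_trans h)// ler_norm.
Qed.

Lemma intbleS D D' f : measurable D -> measurable D' -> D' `<=` D ->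
  intble D f -> intble D' f.
Proof. by move=> mD mD' DD'; exact: integrableS. Qed.

Lemma intbleM D f g C : measurable D -> measurable_fun D f -> intble D g ->
  (forall t, D t -> `|f t| <= C) -> intble D (fun t => f t * g t).
Proof.
move=> mD mf ig fC; apply: (@intble_ae_le _ _ (fun t => C * `|g t|)) => //.
- by apply: measurable_funM => //; exact: intble_measurable.
- by apply: intbleZ => //; exact: intble_norm.
- by apply: aeW => t Dt; rewrite normrM ler_wpM2r// fC.
Qed.

Lemma eq_ae_Rintegral D f g : measurable D -> measurable_fun D f -> measurable_fun D g ->
  (\forall t \ae mu, D t -> f t = g t) ->
  \int[mu]_(t in D) f t = \int[mu]_(t in D) g t.
Proof.
move=> mD mf mg fg; congr fine; apply: ae_eq_integral => //; try exact/measurable_EFinP.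
by apply: (ae_mono fg) => t + Dt => /(_ Dt) ->.
Qed.

Definition locint g := forall b : R, intble `[0, b] g.

Local Notation I s t g := (\int[mu]_(x in `[s, t]) g x).

Lemma locint_itv g s t : locint g -> 0 <= s -> intble `[s, t] g.
Proof.
by move=> gl s0; apply: intbleS (gl t) => //; apply: subset_itvr; rewrite bnd_simp.
Qed.

Lemma locint_measurable g : locint g -> measurable_fun halfline g.
Proof.
move=> gl; have -> : halfline = \bigcup_n `[0, n%:R]%classic.
  apply/seteqP; split => [t /=|t [n _] /=]; rewrite !in_itv /= ?andbT.
    by move=> t0; exists (Num.truncn t).+1 => //=; rewrite in_itv/= t0 ltW// truncnS_gt.
  by move=> /andP[].
by apply/measurable_fun_bigcup => // n; exact: intble_measurable (gl _).
Qed.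

Lemma intble_locint g : intble halfline g -> locint g.
Proof.
by move=> gi b; apply: intbleS gi => //; apply: subset_itvl.
Qed.

Lemma I_split g s r t : locint g -> 0 <= s -> s <= r -> r <= t ->
  I s t g = I s r g + I r t g.
Proof.
move=> gl s0 sr rt; have := @Rintegral_itvB R g (BLeft s) (BRight t) r.
rewrite -/(intble _ g) => /(_ (locint_itv _ gl s0)).
rewrite !bnd_simp => /(_ sr rt); rewrite Rintegral_itv_obnd_cbnd.
  by move=> /eqP; rewrite subr_eq addrC => /eqP.
apply: intbleS (locint_itv t gl (le_trans s0 sr)) => //.
by apply: subset_itvr; rewrite bnd_simp.
Qed.

Lemma I_point g s : I s s g = 0.
Proof. by rewrite set_itv1 Rintegral_set1. Qed.

(** Absolute continuity of the integral, applied to [g] cut off outside [[0, b]]; one [d] serves all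
    short subintervals. *)
Lemma abs_continuity g (b e : R) : locint g -> 0 < e -> exists2 d, 0 < d &
  forall s t, 0 <= s -> s <= t -> t <= b -> t - s < d -> I s t (fun x => `|g x|) < e.
Proof.
move=> gl e0; pose gb := g \_ `[0, b].
have gbi : intble setT gb.
  have := gl b; rewrite /intble integrable_mkcond//.
  by apply: eq_integrable => //= x _; rewrite /gb !patchE /=; case: ifP.
have [d [d0 dP]] := integral_normr_continuous gbi e0.
exists d => // s t s0 st tb tsd.
have -> : I s t (fun x => `|g x|) = I s t (fun x => `|gb x|).
  apply: eq_Rintegral => x; rewrite inE /= in_itv /= => /andP[sx xt].
  by rewrite /gb patchE mem_set//= in_itv/= (le_trans s0 sx) (le_trans xt tb).
have std : (mu `[s, t]%classic < d%:E)%E.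
  by rewrite lebesgue_measure_itv /= lte_fin; case: ifP => _; rewrite lte_fin.
exact: dP std.
Qed.

(** Reduces a property of [[0, t]] to increments over intervals shorter than [d], along the
    equidistant partition into [n] pieces with [t / n < d]. Both the product rule and the choice of
    oscillating signs rest on it. *)
Lemma partition_ind (P : R -> Prop) (t d : R) : 0 < d -> 0 <= t -> P 0 ->
  (forall r r', 0 <= r -> r <= r' -> r' <= t -> r' - r < d -> P r -> P r') -> P t.
Proof.
move=> d0 t0 P0 PS; pose n := (Num.truncn (t / d)).+1.
have n0 : 0 < n%:R :> R by rewrite ltr0n.
have s0 : 0 <= t / n%:R by rewrite divr_ge0// ltW.
have sd : t / n%:R < d by rewrite ltr_pdivrMr// mulrC -ltr_pdivrMr// truncnS_gt.
have nt : n%:R * (t / n%:R) = t by rewrite mulrC divfK// gt_eqF.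
have : forall k, (k <= n)%N -> P (k%:R * (t / n%:R)).
  elim=> [|k IH] kn; first by rewrite mul0r.
  apply: (PS (k%:R * (t / n%:R))).
  - by rewrite mulr_ge0.
  - by rewrite ler_wpM2r// ler_nat.
  - by rewrite -[leRHS]nt ler_wpM2r// ler_nat.
  - by rewrite -(natr1 k) mulrDl mul1r addrC addKr.
  - exact/IH/ltnW.
by move=> /(_ n (leqnn n)); rewrite nt.
Qed.

(** Absolute continuity on [[0, +oo[] as an integral representation, with the derivative carried
    along as a function; values at negative arguments are left free. *)
Definition AC f g := locint g /\ forall t, 0 <= t -> f t = f 0 + I 0 t g.

Lemma AC_increment f g s t : AC f g -> 0 <= s -> s <= t -> f t - f s = I s t g.
Proof.
move=> [gl fg] s0 st; rewrite (fg t (le_trans s0 st)) (fg s s0).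
by rewrite (I_split gl (lexx 0) s0 st); ring.
Qed.

Lemma AC_increment_le f g s t : AC f g -> 0 <= s -> s <= t ->
  `|f t - f s| <= I s t (fun x => `|g x|).
Proof.
move=> fg s0 st; rewrite (AC_increment fg s0 st).
by apply: le_normr_Rintegral => //; exact: locint_itv fg.1 s0.
Qed.

Lemma I_norm_mono g s r r' t : locint g -> 0 <= s -> s <= r -> r <= r' -> r' <= t ->
  I r r' (fun x => `|g x|) <= I s t (fun x => `|g x|).
Proof.
move=> gl s0 sr rr' rt.
have gn : locint (fun x => `|g x|) by move=> b; apply: intble_norm => //.
rewrite (I_split gn s0 sr (le_trans rr' rt)) (I_split gn (le_trans s0 sr) rr' rt).
have := @Rintegral_ge0 _ _ _ mu `[s, r]%classic (fun x => `|g x|) (fun x _ => normr_ge0 _).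
have := @Rintegral_ge0 _ _ _ mu `[r', t]%classic (fun x => `|g x|) (fun x _ => normr_ge0 _).
lra.
Qed.

Lemma AC_bounded f g b t : AC f g -> 0 <= t -> t <= b ->
  `|f t| <= `|f 0| + I 0 b (fun x => `|g x|).
Proof.
move=> fg t0 tb; have := AC_increment_le fg (lexx 0) t0.
have := I_norm_mono fg.1 (lexx 0) (lexx 0) t0 tb.
have := ler_normD (f 0) (f t - f 0); rewrite addrC subrK; lra.
Qed.

Lemma AC_measurable f g : AC f g -> measurable_fun halfline f.
Proof.
move=> fg; have -> : halfline = \bigcup_n `[0, n%:R]%classic.
  apply/seteqP; split => [t /=|t [n _] /=]; rewrite !in_itv /= ?andbT.
    by move=> t0; exists (Num.truncn t).+1 => //=; rewrite in_itv/= t0 ltW// truncnS_gt.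
  by move=> /andP[].
apply/measurable_fun_bigcup => // n.
have H : measurable_fun (`[0, n%:R]%classic : set R) (fun t => f 0 + I 0 t g).
  apply: measurable_funD => //; apply: subspace_continuous_measurable_fun => //.
  by apply: parameterized_integral_continuous => //; exact: fg.1.
apply: eq_measurable_fun H => t; rewrite inE /= in_itv /= => /andP[t0 _].
by rewrite -(fg.2 t t0).
Qed.

Lemma AC_measurableS f g s t : AC f g -> 0 <= s -> measurable_fun `[s, t] f.
Proof.
move=> fg s0; apply: measurable_funS (AC_measurable fg) => //.
by move=> x /=; rewrite !in_itv /= andbT => /andP[sx _]; exact: le_trans sx.
Qed.

Lemma locintD f g : locint f -> locint g -> locint (fun t => f t + g t).
Proof. by move=> fl gl b; exact: intbleD. Qed.

Lemma locintZ c f : locint f -> locint (fun t => c * f t).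
Proof. by move=> fl b; exact: intbleZ. Qed.

Lemma locintM f f' g : AC f f' -> locint g -> locint (fun t => f t * g t).
Proof.
move=> ff' gl b; apply: (@intbleM _ _ _ (`|f 0| + I 0 b (fun x => `|f' x|))) => //.
- exact: AC_measurableS ff' (lexx 0).
- by move=> t /=; rewrite in_itv /= => /andP[t0 tb]; exact: AC_bounded ff' t0 tb.
Qed.

Lemma locintMr f f' g : AC f f' -> locint g -> locint (fun t => g t * f t).
Proof.
move=> ff' gl; rewrite (_ : (fun t => _) = fun t => f t * g t); first exact: locintM ff' gl.
by apply/funext => t; rewrite mulrC.
Qed.

Lemma ACD f f' g g' : AC f f' -> AC g g' ->
  AC (fun t => f t + g t) (fun t => f' t + g' t).
Proof.
move=> ff' gg'; split; first exact: locintD ff'.1 gg'.1.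
move=> t t0; rewrite (ff'.2 t t0) (gg'.2 t t0) RintegralD//; first by lra.
- exact: ff'.1.
- exact: gg'.1.
Qed.

Lemma ACZ c f f' : AC f f' -> AC (fun t => c * f t) (fun t => c * f' t).
Proof.
move=> ff'; split; first exact: locintZ ff'.1.
by move=> t t0; rewrite (ff'.2 t t0) RintegralZl//; [rewrite mulrDr|exact: ff'.1].
Qed.

Lemma AC_cst c : AC (fun=> c) (fun=> 0).
Proof.
split; first by move=> b; apply: integrable0.
by move=> t t0; rewrite Rintegral_cst// mul0r addr0.
Qed.

Lemma ACcB c f f' : AC f f' -> AC (fun t => c - f t) (fun t => 0 + (-1) * f' t).
Proof.
move=> ff'; have := ACD (AC_cst c) (ACZ (-1) ff').
by congr AC; apply/funext => t; rewrite mulN1r.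
Qed.

Lemma locint_cst c : locint (fun=> c).
Proof.
move=> b; apply: continuous_compact_integrable; first exact: segment_compact.
by apply: continuous_subspaceT => x; exact: cvg_cst.
Qed.

Lemma AC_id : AC id (fun=> 1).
Proof.
split; first exact: locint_cst.
move=> t t0; rewrite Rintegral_cst// add0r mul1r -[LHS]/(fine t%:E); congr fine.
have E : mu `[0, t]%classic = t%:E.
  rewrite lebesgue_measure_itv/= lte_fin; move: t0; rewrite le_eqVlt => /predU1P[<-|t0].
    by rewrite ltxx.
  by rewrite t0 -EFinD subr0.
by rewrite -E.
Qed.

Let sum_prod_le_sqr (a b x y : R) : 0 <= x -> 0 <= y -> a <= y * x -> b <= x * y ->
  a + b <= (x + y) ^+ 2.
Proof. by move=> x0 y0; have := mulr_ge0 x0 y0; nra. Qed.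

(* With m' = |f'| + |g'|, the defect of the product rule is an additive function
   of the interval bounded by the square of the integral of m'. *)
Lemma ACM f f' g g' : AC f f' -> AC g g' ->
  AC (fun t => f t * g t) (fun t => f' t * g t + f t * g' t).
Proof.
move=> ff' gg'.
have l1 : locint (fun t => f' t * g t).
  exact: locintMr gg' ff'.1.
have l2 : locint (fun t => f t * g' t) by exact: locintM ff' gg'.1.
have l3 := locintD l1 l2; split=> // t t0.
pose m' x := `|f' x| + `|g' x|.
have lf' : locint (fun x => `|f' x|) by move=> b; apply: intble_norm => //; exact: ff'.1.
have lg' : locint (fun x => `|g' x|) by move=> b; apply: intble_norm => //; exact: gg'.1.
have lm : locint m' by exact: locintD.
have IE s r : 0 <= s -> I s r m' = I s r (fun x => `|f' x|) + I s r (fun x => `|g' x|).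
  by move=> s0; rewrite RintegralD//; exact: locint_itv.
pose E s r := f r * g r - f s * g s - I s r (fun t => f' t * g t + f t * g' t).
have Ele s r : 0 <= s -> s <= r -> `|E s r| <= I s r m' ^+ 2.
  move=> s0 sr.
  (* The increment of the product is the integral of [g r * f' + f s * g']: anchoring the two
     factors at opposite ends leaves only increments over parts of [[s, r]]. *)
  have e1 : E s r = I s r (fun x => (g r - g x) * f' x) + I s r (fun x => (f s - f x) * g' x).
    have i1 : intble `[s, r] (fun x => (g r - g x) * f' x).
      rewrite (_ : (fun x => _) = fun x => g r * f' x - f' x * g x); last first.
        by apply/funext => x; ring.
      apply: intbleB => //; last exact: locint_itv l1 s0.
      by apply: intbleZ => //; exact: locint_itv ff'.1 s0.
    have i2 : intble `[s, r] (fun x => (f s - f x) * g' x).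
      rewrite (_ : (fun x => _) = fun x => f s * g' x - f x * g' x); last first.
        by apply/funext => x; ring.
      apply: intbleB => //; last exact: locint_itv l2 s0.
      by apply: intbleZ => //; exact: locint_itv gg'.1 s0.
    rewrite -RintegralD// /E.
    have -> : f r * g r - f s * g s = I s r (fun x => g r * f' x + f s * g' x).
      rewrite RintegralD ?RintegralZl//; first last.
      - by apply: intbleZ => //; exact: locint_itv gg'.1 s0.
      - by apply: intbleZ => //; exact: locint_itv ff'.1 s0.
      - exact: locint_itv ff'.1 s0.
      - exact: locint_itv gg'.1 s0.
      by rewrite -(AC_increment ff' s0 sr) -(AC_increment gg' s0 sr); ring.
    rewrite -RintegralB//.
    - by apply: eq_Rintegral => x _; ring.
    - apply: intbleD => //; apply: intbleZ => //; first exact: locint_itv ff'.1 s0.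
      exact: locint_itv gg'.1 s0.
    - exact: locint_itv l3 s0.
  have F0 : 0 <= I s r (fun x => `|f' x|) by exact: Rintegral_ge0.
  have G0 : 0 <= I s r (fun x => `|g' x|) by exact: Rintegral_ge0.
  have aux (a a' b' : R -> R) (c : R) : AC a a' -> locint b' ->
      (forall x, s <= x -> x <= r -> `|a x| <= c) ->
      `|I s r (fun x => a x * b' x)| <= c * I s r (fun x => `|b' x|).
    move=> aa' b'l ac; have i := locint_itv r (locintM aa' b'l) s0.
    have ib : intble `[s, r] (fun x => `|b' x|).
      by apply: intble_norm => //; exact: locint_itv.
    apply: le_trans (le_normr_Rintegral _ i) _ => //.
    rewrite -RintegralZl//; apply: le_Rintegral => //.
    - exact: intble_norm.
    - exact: intbleZ.
    - by move=> x /=; rewrite in_itv/= => /andP[sx xr]; rewrite normrM ler_wpM2r// ac.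
  have h1 : `|I s r (fun x => (g r - g x) * f' x)| <=
      I s r (fun x => `|g' x|) * I s r (fun x => `|f' x|).
    apply: (aux _ (fun x => 0 + (-1) * g' x)) => //; last first.
    - move=> x sx xr; apply: le_trans (AC_increment_le gg' (le_trans s0 sx) xr) _.
      exact: I_norm_mono gg'.1 s0 sx xr (lexx r).
    - exact: ff'.1.
    - exact: ACcB.
  have h2 : `|I s r (fun x => (f s - f x) * g' x)| <=
      I s r (fun x => `|f' x|) * I s r (fun x => `|g' x|).
    apply: (aux _ (fun x => 0 + (-1) * f' x)) => //; last first.
    - move=> x sx xr; rewrite distrC; apply: le_trans (AC_increment_le ff' s0 sx) _.
      exact: I_norm_mono ff'.1 s0 (lexx s) sx xr.
    - exact: gg'.1.
    - exact: ACcB.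
  by rewrite e1 IE// (le_trans (ler_normD _ _))// sum_prod_le_sqr.
have C0 : 0 <= I 0 t m' by apply: Rintegral_ge0 => x _; exact: addr_ge0.
suff : `|E 0 t| <= 0.
  by rewrite normr_le0 /E => /eqP h; move: h; lra.
apply/ler_addgt0Pl => e e0; rewrite addr0.
(* If every piece has an integral of [m'] below [e / (I 0 t m' + 1)], the squares sum to at most
   [e]; the [+ 1] covers a vanishing integral. *)
have c1 : 0 < I 0 t m' + 1 by rewrite ltr_wpDl.
have [d d0 dP] := @abs_continuity m' t (e / (I 0 t m' + 1)) lm (divr_gt0 e0 c1).
have : `|E 0 t| <= e / (I 0 t m' + 1) * I 0 t m'.
  apply: (@partition_ind (fun u => `|E 0 u| <= e / (I 0 t m' + 1) * I 0 u m') _ _ d0 t0) => [|r r' r0 rr' rt rd IH].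
    by rewrite /E !I_point !subrr normr0 mulr0.
  have m0 : 0 <= I r r' m' by apply: Rintegral_ge0 => x _; exact: addr_ge0.
  have -> : E 0 r' = E 0 r + E r r'.
    by rewrite /E (I_split l3 (lexx 0) r0 rr'); ring.
  rewrite (I_split lm (lexx 0) r0 rr') mulrDr (le_trans (ler_normD _ _))// lerD//.
  apply: le_trans (Ele _ _ r0 rr') _; rewrite expr2 ler_wpM2r//.
  have := dP r r' r0 rr' rt rd; under eq_Rintegral do rewrite ger0_norm ?addr_ge0//.
  exact: ltW.
by move/le_trans; apply; rewrite mulrAC ler_pdivrMr// ler_wpM2l ?(ltW e0)// lerDl.
Qed.

End RealIntegrals.
Notation halfline := (`[0%R, +oo[%classic).

(** * Smooth test functions *)

Section Smooth.
Context {R : realType}.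
Local Notation mu := (@lebesgue_measure R).
Implicit Types (f g : R -> R) (x t a b c : R).

(** [Cn n] asks for [n + 1] derivatives, so [Cn 0] is differentiability. Recursing on the derivative
    gives each calculus rule by a single induction. *)
Fixpoint Cn n f : Prop :=
  (forall x, derivable f x 1) /\ if n is n'.+1 then Cn n' f^`()%classic else True.

Lemma CnW n f : Cn n.+1 f -> Cn n f.
Proof.
elim: n f => [|n IH] f [df Cf]; split=> //.
exact: IH.
Qed.

Lemma Cn_derivable1n n f : Cn n f -> forall x, derivable (derive1n n f) x 1.
Proof. by elim: n f => [|n IH] f [df Cf] x; [exact: df|rewrite derive1Sn; exact: IH]. Qed.

Lemma CnD n f g : Cn n f -> Cn n g -> Cn n (fun x => f x + g x).
Proof.
elim: n f g => [|n IH] f g [df Cf] [dg Cg].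
  by split; [move=> x; exact: derivableD|].
split=> [x|]; first exact: derivableD.
have -> : (fun x => f x + g x)^`()%classic = fun x => f^`()%classic x + g^`()%classic x.
  by apply/funext => x; rewrite !derive1E; apply: deriveD.
exact: IH.
Qed.

Lemma CnZ n c f : Cn n f -> Cn n (fun x => c * f x).
Proof.
elim: n f => [|n IH] f [df Cf].
  by split; [move=> x; exact: derivableZ|].
split=> [x|]; first exact: derivableZ.
have -> : (fun x => c * f x)^`()%classic = fun x => c * f^`()%classic x.
  by apply/funext => x; rewrite derive1Ml.
exact: IH.
Qed.

Lemma CnM n f g : Cn n f -> Cn n g -> Cn n (fun x => f x * g x).
Proof.
elim: n f g => [|n IH] f g; first by move=> [df _] [dg _]; split; [move=> x; exact: derivableM|].
move=> Cf Cg; have [df Cf'] := Cf; have [dg Cg'] := Cg.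
split=> [x|]; first exact: derivableM.
have -> : (fun x => f x * g x)^`()%classic =
    fun x => f x * g^`()%classic x + g x * f^`()%classic x.
  by apply/funext => x; rewrite !derive1E; exact: deriveM.
by apply: CnD; apply: IH => //; exact: CnW.
Qed.

Lemma derive_affine f a b x : derivable f (a * x + b) 1 ->
  is_derive x 1 (fun x => f (a * x + b)) (f^`()%classic (a * x + b) * a).
Proof.
move=> df; apply: (@is_derive1_comp _ f (fun x => a * x + b)).
  by rewrite derive1E; exact: DeriveDef.
have -> : (fun x => a * x + b) = (a \*: id) + cst b by [].
by apply: is_derive_eq; rewrite addr0; exact: mulr1.
Qed.

Lemma Cn_affine n f a b : Cn n f -> Cn n (fun x => f (a * x + b)).
Proof.
elim: n f => [|n IH] f [df Cf].
  by split=> // x; have [] := derive_affine (df (a * x + b)).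
split=> [x|]; first by have [] := derive_affine (df (a * x + b)).
have -> : (fun x => f (a * x + b))^`()%classic = fun x => a * f^`()%classic (a * x + b).
  apply/funext => x; rewrite derive1E.
  by have [_ ->] := derive_affine (df (a * x + b)); rewrite mulrC.
exact/CnZ/IH.
Qed.

(** The functions [p(1/t) exp(-1/t)], extended by 0, form a family closed under differentiation: [p]
    becomes [X^2 (p - p')]. Smoothness then needs only one derivative. *)
Definition exp_poly_inv (p : {poly R}) t :=
  if 0 < t then p.[t^-1] * expR (- t^-1) else 0.

(** From [|p(x)| <= A x^n] and [exp x >= x^(n+2) / (n+2)!]. The two spare powers become the factor
    [t^2] at [t = 1/x], which makes [exp_poly_inv p] flat at 0. *)
Lemma poly_expRN_bound (p : {poly R}) : exists2 C, 0 < C & forall x, 1 <= x ->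
  `|p.[x]| * expR (- x) <= C / x ^+ 2.
Proof.
have [A [n [A0 pA]]] : exists A n, 0 < A /\ forall x, 1 <= x -> `|p.[x]| <= A * x ^+ n.
  elim/poly_ind: p => [|p c [A [n [A0 pA]]]].
    by exists 1, 0%N; split=> // x x1; rewrite horner0 normr0 mul1r expr0.
  exists (A + `|c|), n.+1; split=> [|x x1]; first exact: ltr_wpDr.
  have x0 : 0 <= x by rewrite (le_trans _ x1).
  rewrite hornerMXaddC (le_trans (ler_normD _ _))// mulrDl lerD//.
    by rewrite normrM exprSr mulrA (ger0_norm x0) ler_wpM2r// pA.
  by rewrite ler_peMr// exprn_ege1.
exists (A * (n.+2)`!%:R) => [|x x1]; first by rewrite mulr_gt0// ltr0n fact_gt0.
have x0 : 0 < x by rewrite (lt_le_trans _ x1).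
have F0 : 0 < (n.+2)`!%:R :> R by rewrite ltr0n fact_gt0.
have h1 : x ^+ n.+2 / (n.+2)`!%:R <= expR x.
  by apply: le_trans (expR_ge1Dxn n.+1 (ltW x0)); rewrite lerDr.
rewrite expRN ler_pdivlMr ?exprn_gt0// mulrAC ler_pdivrMr ?expR_gt0//.
move: h1; rewrite ler_pdivrMr// => h1.
have := ler_wpM2r (ltW (exprn_gt0 2 x0)) (pA x x1).
rewrite -mulrA -exprD addn2 => h2; apply: le_trans h2 _.
by rewrite -!mulrA ler_wpM2l ?(ltW A0)// mulrC.
Qed.

Lemma exp_poly_inv_flat p : exists2 C, 0 < C & forall t, `|t| <= 1 ->
  `|exp_poly_inv p t| <= C * t ^+ 2.
Proof.
have [C C0 HC] := poly_expRN_bound p; exists C => // t t1.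
rewrite /exp_poly_inv; case: ifPn => [t0|_]; last by rewrite normr0 mulr_ge0 ?sqr_ge0// ltW.
have tN1 : 1 <= t^-1 by rewrite invf_ge1// (le_trans _ t1)// ler_norm.
rewrite normrM (ger0_norm (expR_ge0 _)); have := HC _ tN1.
by rewrite exprVn invrK.
Qed.

Lemma is_derive_flat f C : 0 < C -> (forall t, `|t| <= 1 -> `|f t| <= C * t ^+ 2) ->
  is_derive (0 : R) 1 f 0.
Proof.
move=> C0 fC; have f0 : f 0 = 0.
  by apply/eqP; rewrite -normr_le0; have := fC 0; rewrite normr0 expr0n mulr0; apply.
have c : h^-1 *: ((f \o shift 0) (h *: 1) - f 0) @[h --> 0^'] --> 0.
  apply/cvgr0Pnorm_lt => e e0; rewrite near_withinE nearE.
  exists (Num.min 1 (e / C)) => /=; first by rewrite lt_min ltr01 divr_gt0.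
  move=> h /=; rewrite sub0r normrN lt_min => /andP[h1 he] h0.
  rewrite f0 subr0 addr0 [h *: 1]mulr1 normrZ normfV.
  have hn : 0 < `|h| by rewrite normr_gt0.
  rewrite mulrC ltr_pdivrMr//; apply: le_lt_trans (fC h (ltW h1)) _.
  rewrite -(real_normK (num_real h)) expr2 mulrA ltr_pM2r//.
  by rewrite mulrC -ltr_pdivlMr.
by apply: DeriveDef; [apply/cvg_ex; exists 0|exact: cvg_lim c].
Qed.

Lemma is_derive_exp_poly_inv p t :
  is_derive t 1 (exp_poly_inv p) (exp_poly_inv ('X^2 * (p - p^`())) t).
Proof.
have [t0|t0|->] := ltgtP t 0.
- have near0 : {near t, cst 0 =1 exp_poly_inv p}.
    have : \forall s \near t, s < 0 by exact: lt_nbhsl.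
    by apply: filterS => s s0; rewrite /exp_poly_inv ltNge (ltW s0).
  have -> : exp_poly_inv ('X^2 * (p - p^`())) t = 0 by rewrite /exp_poly_inv ltNge (ltW t0).
  apply: DeriveDef; first exact: near_eq_derivable near0 (derivable_cst _ _ _).
  by rewrite -(near_eq_derive _ near0) derive_cst.
- pose q s := p.[s^-1] * expR (- s^-1).
  have near0 : {near t, q =1 exp_poly_inv p}.
    have : \forall s \near t, 0 < s by exact: lt_nbhsr.
    by apply: filterS => s s0; rewrite /exp_poly_inv s0.
  have tN0 : t != 0 by rewrite gt_eqF.
  have dV : is_derive t 1 (fun s : R => s^-1) (- t ^- 2 *: 1).
    exact: (@is_deriveV R id t 1 1 tN0 (is_derive_id _ _)).
  have dp : is_derive t 1 (fun s => p.[s^-1]) (p^`().[t^-1] * (- t ^- 2 *: 1)).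
    apply: (@is_derive1_comp _ (horner p) (fun s => s^-1) t _ _ _ dV).
  have de : is_derive t 1 (fun s => expR (- s^-1)) (expR (- t^-1) * - (- t ^- 2 *: 1)).
    apply: (@is_derive1_comp _ expR (fun s => - s^-1)).
  have [dq1 dq2] := is_deriveM dp de.
  apply: DeriveDef; first exact: near_eq_derivable near0 dq1.
  rewrite -(near_eq_derive _ near0) [LHS]dq2 /exp_poly_inv t0.
  rewrite !hornerE /= -exprVn; move: (t^-1) => y.
  rewrite [p.[y] *: _]mulrC [expR (- y) *: _]mulrC [(- y ^+ 2)%:A]mulr1; ring.
- have -> : exp_poly_inv ('X^2 * (p - p^`())) 0 = 0 by rewrite /exp_poly_inv ltxx.
  have [C C0 HC] := exp_poly_inv_flat p; exact: is_derive_flat C0 HC.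
Qed.

Lemma Cn_exp_poly_inv n p : Cn n (exp_poly_inv p).
Proof.
elim: n p => [|n IH] p.
  by split=> // x; have [] := is_derive_exp_poly_inv p x.
split=> [x|]; first by have [] := is_derive_exp_poly_inv p x.
have -> : (exp_poly_inv p)^`()%classic = exp_poly_inv ('X^2 * (p - p^`())).
  by apply/funext => x; rewrite derive1E; have [_ ->] := is_derive_exp_poly_inv p x.
exact: IH.
Qed.

Definition bump t := exp_poly_inv 1 t * exp_poly_inv 1 (1 - t).

Lemma exp_poly_inv1_itv t : 0 <= exp_poly_inv 1 t <= 1.
Proof.
rewrite /exp_poly_inv; case: ifPn => t0; last by rewrite lexx ler01.
by rewrite hornerE mul1r expR_ge0 expR_le1 oppr_le0 invr_ge0 ltW.
Qed.

Lemma bump_ge0 t : 0 <= bump t.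
Proof.
by have /andP[h _] := exp_poly_inv1_itv t; have /andP[h' _] := exp_poly_inv1_itv (1 - t);
  exact: mulr_ge0.
Qed.

Lemma bump_le1 t : bump t <= 1.
Proof.
have /andP[h1 h2] := exp_poly_inv1_itv t; have /andP[h3 h4] := exp_poly_inv1_itv (1 - t).
exact: mulr_ile1.
Qed.

Lemma bump_out t : t <= 0 \/ 1 <= t -> bump t = 0.
Proof.
rewrite /bump /exp_poly_inv => -[t0|t1]; first by rewrite ltNge t0 mul0r.
by rewrite [0 < 1 - t]ltNge subr_le0 t1 mulr0.
Qed.

Lemma bump_gt t : 4^-1 <= t -> t <= 1 - 4^-1 -> expR (- 4) ^+ 2 <= bump t.
Proof.
move=> t1 t2; have h s : 4^-1 <= s -> expR (- 4) <= exp_poly_inv 1 s.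
  move=> s1; have s0 : 0 < s by apply: lt_le_trans s1; rewrite invr_gt0.
  rewrite /exp_poly_inv s0 hornerE mul1r ler_expR lerN2 -[leRHS]invrK lef_pV2//.
  by rewrite posrE invr_gt0.
by rewrite expr2 ler_pM ?expR_ge0// h//; move: t2; lra.
Qed.

Lemma Cn_bump n : Cn n bump.
Proof.
apply: CnM; first exact: Cn_exp_poly_inv.
have := @Cn_affine n (exp_poly_inv 1) (-1) 1 (Cn_exp_poly_inv n 1).
by congr Cn; apply/funext => t; rewrite mulN1r addrC.
Qed.

Lemma bump_continuous : continuous bump.
Proof.
by move=> x; apply/differentiable_continuous/derivable1_diffP; exact: (Cn_bump 0).1.
Qed.

(** Starting the integral at -1 rather than 0 makes [t = 0] an interior point for the fundamental
    theorem of calculus. The height [step 1] of the plateau is not normalised; it is divided out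
    where needed. *)
Definition step t := \int[mu]_(s in `[-1, t]) bump s.

Let bump_intble a b : intble `[a, b] bump.
Proof.
apply: continuous_compact_integrable; first exact: segment_compact.
exact: continuous_subspaceT bump_continuous.
Qed.

Lemma step_le0 t : t <= 0 -> step t = 0.
Proof.
move=> t0; rewrite /step (@eq_Rintegral _ _ _ mu _ (fun=> 0)); first by rewrite Rintegral_cst// mul0r.
by move=> s; rewrite inE/= in_itv/= => /andP[_ st]; rewrite bump_out//; left; exact: le_trans t0.
Qed.

Lemma step_ge1 t : 1 <= t -> step t = step 1.
Proof.
move=> t1; apply/eqP; rewrite -subr_eq0 /step; apply/eqP.
have := @Rintegral_itvB R bump (BLeft (-1)) (BRight t) 1 (bump_intble _ _).
have n11 : -1 <= 1 :> R by lra.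
rewrite !bnd_simp => -> //.
rewrite (@eq_Rintegral _ _ _ mu _ (fun=> 0)); first by rewrite Rintegral_cst// mul0r.
by move=> s; rewrite inE/= in_itv/= => /andP[st _]; rewrite bump_out//; right; exact: ltW.
Qed.

Lemma is_derive_step t : is_derive t 1 step (bump t).
Proof.
have [t0|t0] := ltP t 0.
  have near0 : {near t, cst 0 =1 step}.
    have : \forall s \near t, s < 0 by exact: lt_nbhsl.
    by apply: filterS => s s0; rewrite step_le0// ltW.
  rewrite bump_out; last by left; exact: ltW.
  apply: DeriveDef; first exact: near_eq_derivable near0 (derivable_cst _ _ _).
  by rewrite -(near_eq_derive _ near0) derive_cst.
have [||||d1 d2] := @continuous_FTC1_closed R bump (-1) t (t + 1).
- by rewrite ltrDl.
- exact: bump_intble.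
- by apply: lt_le_trans t0; rewrite oppr_lt0.
- exact: bump_continuous.
- by apply: DeriveDef; [exact: d1|rewrite -derive1E].
Qed.

Lemma step1_gt0 : 0 < step 1.
Proof.
have h : \int[mu]_(s in `[4^-1, 1 - 4^-1]) (expR (- 4) ^+ 2) <= step 1.
  rewrite /step; apply: le_trans (_ : \int[mu]_(s in `[4^-1, 1 - 4^-1]) bump s <= _).
    apply: le_Rintegral => //.
    - apply: continuous_compact_integrable; first exact: segment_compact.
      by apply: continuous_subspaceT => x; exact: cvg_cst.
    - exact: bump_intble.
    - by move=> s /=; rewrite in_itv/= => /andP[]; exact: bump_gt.
  have sub : `[4^-1, 1 - 4^-1]%classic `<=` (`[-1, 1]%classic : set R).
    move=> x /=; rewrite !in_itv/= => /andP[h1 h2]; lra.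
  apply: fine_le; try exact: integrable_fin_num (bump_intble _ _).
  apply: ge0_subset_integral => //.
  - exact: measurable_int (bump_intble _ _).
  - by move=> x _; rewrite lee_fin bump_ge0.
apply: lt_le_trans h; rewrite Rintegral_cst// mulr_gt0 ?exprn_gt0 ?expR_gt0//.
suff : 0 < fine (mu `[4^-1, 1 - 4^-1]%classic) by [].
by rewrite lebesgue_measure_itv/= lte_fin ifT -?EFinB/=; lra.
Qed.

Lemma derive_step : step^`()%classic = bump.
Proof. by apply/funext => t; rewrite derive1E; have [_ ->] := is_derive_step t. Qed.

Lemma Cn_step n : Cn n step.
Proof.
case: n => [|n]; split=> //; try by move=> t; have [] := is_derive_step t.
by rewrite derive_step; exact: Cn_bump.
Qed.

(* Equal to step 1 between a + e and b, and to 0 outside of [a, b + e]. *)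
Definition trapeze a b e t := step (e^-1 * t + - (e^-1 * a)) + (-1) * step (e^-1 * t + - (e^-1 * b)).

Lemma derive_trapeze a b e t : (trapeze a b e)^`()%classic t =
  e^-1 * bump (e^-1 * (t - a)) - e^-1 * bump (e^-1 * (t - b)).
Proof.
have dS c : is_derive t 1 (fun t => step (e^-1 * t + - (e^-1 * c))) (e^-1 * bump (e^-1 * (t - c))).
  have [h1 h2] := @derive_affine step e^-1 (- (e^-1 * c)) t ((Cn_step 0).1 _).
  by apply: DeriveDef => //; rewrite h2 derive_step mulrC mulrBr.
rewrite derive1E.
have [_ ->] := is_deriveD (dS a) (is_deriveZ (-1) (dS b)).
by rewrite scaleN1r.
Qed.

Lemma trapeze_test a b e : 0 < e -> 0 < a -> a <= b -> test_function (trapeze a b e).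
Proof.
move=> e0 a0 ab.
have sub : closure [set t | trapeze a b e t != 0] `<=` `[a, b + e]%classic.
  have -> : `[a, b + e]%classic = closure `[a, b + e]%classic.
    by apply/closure_id; exact: itv_closed.
  apply: closureS => t /=; apply: contraNT.
  rewrite in_itv/= negb_and -!ltNge => /orP[ta|tb]; rewrite /trapeze -!mulrBr.
    rewrite !step_le0 ?mulr0 ?addr0// pmulr_rle0 ?invr_gt0// subr_le0 ltW//.
    exact: lt_le_trans ab.
  rewrite ![step (e^-1 * (t - _))]step_ge1 ?mulN1r ?subrr//.
    by rewrite mulrC ler_pdivlMr//; move: tb ab; lra.
  by rewrite mulrC ler_pdivlMr//; move: tb ab; lra.
split.
- move=> n t; apply: Cn_derivable1n.
  by apply: CnD; [|apply: CnZ]; apply: Cn_affine; exact: Cn_step.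
- apply: subclosed_compact sub; first exact: closed_closure.
  exact: segment_compact.
- by move=> t /sub /=; rewrite !in_itv/= andbT => /andP[+ _]; exact: lt_le_trans.
Qed.

End Smooth.

(** * Distributional derivatives *)

Section Distributions.
Context {R : realType}.
Local Notation mu := (@lebesgue_measure R).
Implicit Types (f g u w phi : R -> R) (x t a b c e s : R).
Local Notation I s t g := (\int[mu]_(x in `[s, t]) g x).

Lemma Cn_AC f : Cn 1 f -> AC f f^`()%classic.
Proof.
move=> [df [ddf _]].
have cf g : (forall x, derivable g x 1) -> continuous g.
  by move=> dg x; exact/differentiable_continuous/derivable1_diffP.
have i b : intble `[0, b] f^`()%classic.
  apply: continuous_compact_integrable; first exact: segment_compact.
  by apply: continuous_subspaceT; exact: cf.
split=> // t; rewrite le_eqVlt => /predU1P[<-|t0]; first by rewrite I_point addr0.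
have cdf := cf _ ddf; have {}cf := cf _ df.
have dfoo : derivable_oo_LRcontinuous f 0 t.
  split; [by move=> x _; exact: df|exact: cvg_at_right_filter (cf 0)|].
  exact: cvg_at_left_filter (cf t).
rewrite /Rintegral (@continuous_FTC2 _ f^`()%classic f 0 t t0 (continuous_subspaceT cdf) dfoo) /=.
  by rewrite [RHS]addrC subrK.
by [].
Qed.

Lemma Rintegral_halfline g b : (forall t, b < t -> g t = 0) ->
  \int[mu]_(t in halfline) g t = I 0 b g.
Proof.
move=> g0; have -> : `[0, b]%classic = halfline `&` [set t | t <= b].
  apply/seteqP; split => t /=; rewrite !in_itv/= andbT; first by move=> /andP[].
  by move=> [-> ->].
rewrite Rintegral_mkcondr; apply: eq_Rintegral => t _; rewrite patchE.
by case: ifPn => //; rewrite notin_setE/= => /negP; rewrite -ltNge => /g0.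
Qed.

Lemma test_support phi : test_function phi -> exists2 b, 0 < b &
  forall t, t <= 0 \/ b < t -> phi t = 0 /\ phi^`()%classic t = 0.
Proof.
move=> [dphi cphi sphi]; set K := closure _ in cphi sphi.
have Kopen : open (~` K) by rewrite openC; exact: closed_closure.
have K0 t : ~ K t -> phi t = 0 /\ phi^`()%classic t = 0.
  move=> Kt; have near0 : {near t, cst 0 =1 phi}.
    have : \forall s \near t, (~` K) s by exact: open_nbhs_nbhs.
    apply: filterS => s Ks; apply/esym/eqP; apply: contra_notT Ks => p0.
    exact: subset_closure.
  split; first exact/esym/(nbhs_singleton near0).
  by rewrite derive1E -(near_eq_derive _ near0) derive_cst.
have [M [_ MP]] := compact_bounded cphi.
exists (`|M| + 1); first by rewrite ltr_wpDl.
move=> t tb; apply: K0 => Kt; case: tb => [t0|].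
  by have := sphi t Kt; rewrite /= in_itv/= andbT ltNge t0.
have MM : M < `|M| + 1 by rewrite (le_lt_trans (ler_norm _))// ltrDl.
by have := le_trans (ler_norm t) (MP _ MM t Kt); rewrite leNgt => /negP.
Qed.

Lemma test_by_parts phi u g : test_function phi -> AC u g ->
  \int[mu]_(t in halfline) (phi^`()%classic t * u t) =
  - \int[mu]_(t in halfline) (phi t * g t).
Proof.
move=> tphi ug; have [b b0 bP] := test_support tphi; have [dphi _ _] := tphi.
have ACphi : AC phi phi^`()%classic.
  by apply: Cn_AC; split; [exact: (dphi 0)|split=> //; exact: (dphi 1)].
rewrite !(@Rintegral_halfline _ b); last first.
- by move=> t bt; have [|_ ->] := bP t; [right|rewrite mul0r].
- by move=> t bt; have [|-> _] := bP t; [right|rewrite mul0r].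
(* [phi] is known to vanish only strictly beyond [b], so the product rule is integrated up to
   [b + 1]. *)
have AP := ACM ACphi ug; have := AP.2 (b + 1) (ltW (ltr_wpDr ler01 b0)).
have -> : I 0 (b + 1) (fun t => phi^`()%classic t * u t + phi t * g t) =
  I 0 b (fun t => phi^`()%classic t * u t + phi t * g t).
  have Z t : b < t -> phi^`()%classic t * u t + phi t * g t = 0.
    by move=> bt; have [|-> ->] := bP t; [right|rewrite !mul0r addr0].
  rewrite -(Rintegral_halfline Z) -(@Rintegral_halfline _ (b + 1))// => t bt.
  by apply: Z; apply: lt_trans bt; rewrite ltrDl.
have [|-> _] := bP (b + 1); first by right; rewrite ltrDl.
have [|-> _] := bP 0; first by left.
rewrite !mul0r add0r RintegralD//.
- by move=> /esym/eqP; rewrite addr_eq0 => /eqP.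
- exact: (locintMr ug ACphi.1 b).
- exact: (locintM ACphi ug.1 b).
Qed.

Lemma near0P (P : R -> Prop) : (\forall r \near 0^'+, P r) -> exists2 d, 0 < d &
  forall r, 0 < r -> r < d -> P r.
Proof.
rewrite nearE => -[d /= d0 dP]; exists d => // t t0 td; apply: dP => //=.
by rewrite sub0r normrN ger0_norm// ltW.
Qed.

(** One-sided because the kernels used for testing live on [[a, a + r]]. *)
Definition right_lebesgue_pt w a := forall e, 0 < e -> exists2 d, 0 < d &
  forall r, 0 < r -> r < d -> I a (a + r) (fun t => `|w t - w a|) <= e * r.

Lemma ae_right_lebesgue_pt w : locint w -> \forall a \ae mu, 0 < a -> right_lebesgue_pt w a.
Proof.
move=> wl; pose v := w \_ halfline.
have mv : measurable_fun setT v.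
  by apply/(measurable_restrictT _ _).1 => //; exact: locint_measurable.
have vl : locally_integrable setT v.
  split=> //; first exact: openT.
  move=> K _ cK; have [M [_ MP]] := compact_bounded cK.
  pose b : R := `|M| + 1.
  have Kb : K `<=` `[- b, b].
    move=> x Kx /=; rewrite in_itv/= -ler_norml; apply: MP Kx.
    by rewrite (le_lt_trans (ler_norm _))// ltrDl.
  have ib : mu.-integrable (`[- b, b]%classic : set R) ((EFin \o w) \_ halfline).
    apply/integrable_restrict => //; apply: integrableS (wl b) => //.
      exact: measurableI.
    by move=> x /= []; rewrite !in_itv/= andbT => /andP[_ ->] ->.
  have /integrableP[_] : intble (`[- b, b]%classic : set R) v.
    by move: ib; apply: eq_integrable => //= x _; rewrite /v !patchE /=; case: ifP.
  apply: le_lt_trans; apply: ge0_subset_integral => //.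
  - exact: compact_measurable.
  - by apply/measurable_EFinP; apply: measurableT_comp => //; apply: measurable_funTS mv.
apply: (ae_mono (lebesgue_differentiation vl)) => a la a0 e e0.
have va x : 0 <= x -> v x = w x by move=> x0; rewrite /v patchE mem_set//= in_itv/= x0.
(* The average is taken over the open ball of radius [2 r], which contains the closed interval
   [[a, a + r]]; its measure [4 r] explains [e / 4]. *)
have e4 : (0 < (e / 4)%:E)%E by rewrite lte_fin divr_gt0.
have /near0P[d d0 dP] : \forall r \near 0^'+, (davg v a r < (e / 4)%:E)%E.
  apply: (la [set y : \bar R | (y < (e / 4)%:E)%E]).
  by apply: open_nbhs_nbhs; split => //; exact: open_ereal_lt_ereal.
exists (d / 2) => [|r r0 rd]; first exact: divr_gt0.
have r20 : 0 < 2 * r by lra.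
have r2d : 2 * r < d by lra.
have := dP (2 * r) r20 r2d; rewrite /davg /iavg.
have mb : mu (ball a (2 * r)) = (4 * r)%:E.
  by rewrite lebesgue_measure_ball ?(ltW r20)//; congr EFin; ring.
rewrite mb inver gt_eqF ?mulr_gt0// lte_pdivrMl ?mulr_gt0// -EFinM => h.
have sub : `[a, a + r]%classic `<=` (ball a (2 * r) : set R).
  move=> x /=; rewrite in_itv/= -ball_normE /= => /andP[x1 x2].
  by rewrite ltr_norml; lra.
have li : locint (fun t => `|w t - w a|).
  move=> c; apply: intble_norm => //; apply: intbleB => //.
  exact: locint_cst.
have -> : e * r = 4 * r * (e / 4) by field.
rewrite -lee_fin /Rintegral fineK; last first.
  by apply: integrable_fin_num => //; exact: locint_itv li (ltW a0).
apply: le_trans (ltW h).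
rewrite (@eq_integral _ _ _ mu _ (fun t => `|(v t - v a)%:E|%E)); last first.
  move=> t; rewrite inE/= in_itv/= => /andP[ta _].
  by rewrite !va ?(ltW a0)// (le_trans (ltW a0)).
apply: ge0_subset_integral => //; first exact: measurable_ball.
apply: measurableT_comp => //; apply/measurable_EFinP; apply: measurable_funB => //.
exact: measurable_funTS.
Qed.

(** An approximate identity at [a], of mass [step 1] and supported on [[a, a + r]]; the derivative
    of [trapeze a b r] is the kernel at [a] minus the kernel at [b]. *)
Definition kernel a r t := r^-1 * bump (r^-1 * (t - a)).

Lemma AC_step a r : AC (fun t => step (r^-1 * t + - (r^-1 * a))) (kernel a r).
Proof.
have := Cn_AC (@Cn_affine R 1 step r^-1 (- (r^-1 * a)) (Cn_step 1)).
congr AC; apply/funext => t; rewrite derive1E.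
have [_ ->] := @derive_affine R step r^-1 (- (r^-1 * a)) t ((Cn_step 0).1 _).
by rewrite derive_step mulrC /kernel mulrBr.
Qed.

Lemma kernel_out a r t : 0 < r -> t <= a \/ a + r <= t -> kernel a r t = 0.
Proof.
move=> r0 H; rewrite /kernel bump_out ?mulr0//; case: H => H; [left|right].
  by rewrite pmulr_rle0 ?invr_gt0// subr_le0.
by rewrite mulrC ler_pdivlMr// mul1r lerBrDl.
Qed.

Lemma AC_kernel a r : exists k', AC (kernel a r) k'.
Proof.
exists (fun t => r^-1 * ((fun t => bump (r^-1 * t + - (r^-1 * a)))^`()%classic t)).
have := ACZ r^-1 (Cn_AC (@Cn_affine R 1 bump r^-1 (- (r^-1 * a)) (Cn_bump 1))).
by congr AC; apply/funext => t; rewrite /kernel mulrBr.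
Qed.

Lemma ae_exists (P : R -> Prop) a b : a < b -> (\forall t \ae mu, P t) ->
  exists t, [/\ a < t, t < b & P t].
Proof.
move=> ab [N [mN N0 PN]]; apply: contrapT => /forallNP H.
have : (mu `]a, b[%classic <= mu N)%E.
  apply: le_measure; rewrite ?inE// => t /=; rewrite in_itv/= => /andP[t1 t2].
  by apply: PN => /= Pt; apply: (H t).
by rewrite N0 lebesgue_measure_itv/= lte_fin ab -EFinB lee_fin subr_le0 leNgt ab.
Qed.

Lemma ae_neq a : \forall t \ae mu, t != a.
Proof.
exists [set a]; split=> //; first exact: lebesgue_measure_set1.
by move=> t /= /negP; rewrite negbK => /eqP.
Qed.

(** Testing with [trapeze a b r] equates the kernel averages of [w] at [a] and [b]. At Lebesgue
    points these tend to [step 1 * w a] and [step 1 * w b] as [r] decreases to 0, so [w] takes a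
    single value at all its Lebesgue points. *)
Lemma du_bois_reymond w : locint w ->
  (forall phi, test_function phi ->
     \int[mu]_(t in halfline) (phi^`()%classic t * w t) = 0) ->
  exists c, \forall t \ae mu, 0 <= t -> w t = c.
Proof.
move=> wl w0; have lpt := ae_right_lebesgue_pt wl.
have K0 := @step1_gt0 R.
have avg a : 0 < a -> right_lebesgue_pt w a -> forall e, 0 < e -> exists2 d, 0 < d &
    forall r, 0 < r -> r < d ->
    `|\int[mu]_(t in halfline) (r^-1 * bump (r^-1 * (t - a)) * w t) - step 1 * w a| <= e.
  move=> a0 la e e0; have [d d0 dP] := la e e0; exists d => // r r0 rd.
  have [k' kAC] := AC_kernel a r.
  have kl := locintM kAC wl.
  have a0' := ltW a0; have ar : a <= a + r by rewrite lerDl ltW.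
  rewrite (@Rintegral_halfline _ (a + r)); last first.
    by move=> t ta; rewrite -/(kernel a r t) kernel_out ?mul0r//; right; exact: ltW.
  rewrite (I_split kl (lexx 0) a0' ar) (@eq_Rintegral _ _ _ mu `[0, a]%classic (fun=> 0)); last first.
    move=> t; rewrite inE/= in_itv/= => /andP[_ ta].
    by rewrite -/(kernel a r t) kernel_out ?mul0r//; left.
  rewrite Rintegral_cst// mul0r add0r.
  have -> : step 1 * w a = I a (a + r) (fun t => kernel a r t * w a).
    rewrite RintegralZr//; last exact: locint_itv (AC_step a r).1 a0'.
    rewrite -(AC_increment (AC_step a r) a0' ar) subrr (step_le0 (lexx 0)) subr0.
    by rewrite mulrDr addrAC subrr add0r mulVf// gt_eqF.
  have ik := locint_itv (a + r) (AC_step a r).1 a0'.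
  have ikw : intble `[a, a + r] (fun t => kernel a r t * w a).
    rewrite (_ : (fun t => _) = fun t => w a * kernel a r t); first exact: intbleZ.
    by apply/funext => t; rewrite mulrC.
  rewrite -RintegralB//; last first.
  - exact: locint_itv kl a0'.
  have li : locint (fun t => w t - w a).
    by move=> c; apply: intbleB => //; exact: locint_cst.
  rewrite (@eq_Rintegral _ _ _ mu _ (fun t => kernel a r t * (w t - w a))); last first.
    by move=> t _; rewrite mulrBr.
  have i2 := locint_itv (a + r) (locintM kAC li) a0'.
  apply: le_trans (le_normr_Rintegral _ i2) _ => //.
  have i3 := intble_norm (measurable_itv _) (locint_itv (a + r) li a0').
  apply: (@le_trans _ _ (I a (a + r) (fun t => r^-1 * `|w t - w a|))).
    apply: le_Rintegral => //; first exact: intble_norm.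
      exact: intbleZ.
    have r0' : 0 <= r^-1 by rewrite invr_ge0 ltW.
    move=> t _; rewrite normrM ler_wpM2r// /kernel ger0_norm ?(mulr_ge0 r0' (bump_ge0 _))//.
    by rewrite ler_piMr// bump_le1.
  by rewrite RintegralZl// mulrC ler_pdivrMr// dP.
have cst a b : 0 < a -> a <= b -> right_lebesgue_pt w a -> right_lebesgue_pt w b -> w a = w b.
  move=> a0 ab la lb; apply/eqP; rewrite -subr_eq0 -normr_le0; apply/ler_addgt0Pl => e e0.
  rewrite addr0.
  have e2 : 0 < e * step 1 / 2 by rewrite divr_gt0// mulr_gt0.
  have [d1 d10 h1] := avg a a0 la _ e2.
  have [d2 d20 h2] := avg b (lt_le_trans a0 ab) lb _ e2.
  pose r := Num.min d1 d2 / 2.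
  have m0 : 0 < Num.min d1 d2 by rewrite lt_min d10.
  have r0 : 0 < r by rewrite divr_gt0.
  have rd1 : r < d1 by rewrite /r; have := ge_min d1 d1 d2; rewrite lexx/=; lra.
  have rd2 : r < d2 by rewrite /r; have := ge_min d2 d1 d2; rewrite lexx orbT/=; lra.
  have := w0 _ (trapeze_test r0 a0 ab).
  have [ka kaAC] := AC_kernel a r; have [kb kbAC] := AC_kernel b r.
  have b0 := lt_le_trans a0 ab; pose c := b + r.
  have out x t : x <= b -> c < t -> kernel x r t * w t = 0.
    by move=> xb ct; rewrite kernel_out ?mul0r//; right; rewrite (le_trans _ (ltW ct))// lerD2r.
  rewrite (@Rintegral_halfline _ c); last first.
    move=> t ct; rewrite derive_trapeze mulrBl -!/(kernel _ r t) !out//.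
    by rewrite subrr.
  have h1' := h1 r r0 rd1; have h2' := h2 r r0 rd2.
  rewrite (@Rintegral_halfline _ c) in h1'; last by move=> t; exact: out.
  rewrite (@Rintegral_halfline _ c) in h2'; last by move=> t; exact: out.
  rewrite (@eq_Rintegral _ _ _ mu _ (fun t => kernel a r t * w t - kernel b r t * w t)); last first.
    by move=> t _; rewrite derive_trapeze mulrBl.
  rewrite RintegralB//; first last.
  - exact: (locintM kbAC wl c).
  - exact: (locintM kaAC wl c).
  move: h1' h2'; set A := Rintegral _ _ _; set B := Rintegral _ _ _ => h1' h2' /eqP.
  rewrite subr_eq0 => /eqP AB; rewrite -/A AB in h1'.
  have : `|step 1 * (w a - w b)| <= e * step 1.
    have -> : step 1 * (w a - w b) = (B - step 1 * w b) - (B - step 1 * w a) by ring.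
    apply: le_trans (ler_normB _ _) _; move: h1' h2'; lra.
  by rewrite normrM (gtr0_norm K0) mulrC ler_pM2r.
have [a0 [a00 _ la0]] := ae_exists ltr01 lpt.
exists (w a0); have F := ae_filter_ringOfSetsType mu.
apply: (ae_mono (@filterI _ _ F _ _ lpt (ae_neq 0))) => t [lt tN0] t0.
have {}t0 : 0 < t by rewrite lt0r tN0.
have [ta|/ltW ta] := leP t a0; first exact: cst t0 ta (lt t0) (la0 a00).
by apply/esym; exact: cst a00 ta (la0 a00) (lt t0).
Qed.

Lemma test_locint phi u : test_function phi -> locint u ->
  intble halfline (fun t => phi^`()%classic t * u t) /\ intble halfline (fun t => phi t * u t).
Proof.
move=> tphi ul; have [b b0 bP] := test_support tphi; have [dphi _ _] := tphi.
have ext f : locint f -> (forall t, b < t -> f t = 0) -> intble halfline f.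
  move=> fl f0; have mf := locint_measurable fl.
  apply/integrableP; split; first exact/measurable_EFinP.
  have /integrableP[_] := fl b; apply: le_lt_trans.
  have hE : halfline = `[0, b]%classic `|` `]b, +oo[%classic :> set R.
    apply/seteqP; split => t /=; rewrite !in_itv/= !andbT.
      by move=> ->/=; case: (leP t b); [left|right].
    move=> [/andP[]//|bt]; exact: le_trans (ltW b0) (ltW bt).
  rewrite [X in integral _ X _]hE ge0_integral_setU//=.
  - rewrite [X in (_ + X)%E]integral0_eq ?adde0// => t /=; rewrite in_itv/= andbT => bt.
    by rewrite f0// normr0.
  - by rewrite -hE; apply/measurable_EFinP; apply: measurableT_comp.
  - apply/disj_setPS => t /= []; rewrite !in_itv/= andbT => /andP[_ tb].
    by rewrite ltNge tb.
have ACphi : AC phi phi^`()%classic.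
  by apply: Cn_AC; split; [exact: (dphi 0)|split=> //; exact: (dphi 1)].
have ACphi' : AC phi^`()%classic (phi^`()^`())%classic.
  by apply: Cn_AC; split; [exact: (dphi 1)|split=> //; exact: (dphi 2)].
split; apply: ext.
- exact: locintM ACphi' ul.
- by move=> t bt; have [|_ ->] := bP t; [right|rewrite mul0r].
- exact: locintM ACphi ul.
- by move=> t bt; have [|-> _] := bP t; [right|rewrite mul0r].
Qed.

Lemma AC_prim g : locint g -> AC (fun t => I 0 t g) g.
Proof. by move=> gl; split=> // t t0; rewrite I_point add0r. Qed.

Lemma AC_locint f g : AC f g -> locint f.
Proof.
move=> fg; rewrite (_ : f = fun t => f t * 1); first exact: locintM fg (locint_cst 1).
by apply/funext => t; rewrite mulr1.
Qed.

(** Subtracting the primitive of [g] leaves a function with zero distributional derivative, hence a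
    constant almost everywhere. *)
Lemma distr_AC u g : locint u -> locint g ->
  (forall phi, test_function phi -> \int[mu]_(t in halfline) (phi^`()%classic t * u t) =
     - \int[mu]_(t in halfline) (phi t * g t)) ->
  exists2 U, AC U g & \forall t \ae mu, 0 <= t -> u t = U t.
Proof.
move=> ul gl ug; have G := AC_prim gl.
have Gl := AC_locint G.
have [||c cP] := @du_bois_reymond (fun t => u t - I 0 t g).
- by move=> b; exact: intbleB.
- move=> phi tphi.
  rewrite (@eq_Rintegral _ _ _ mu _
    (fun t => phi^`()%classic t * u t - phi^`()%classic t * I 0 t g)); last first.
    by move=> t _; rewrite mulrBr.
  rewrite RintegralB//; first last.
  + exact: (test_locint tphi Gl).1.
  + exact: (test_locint tphi ul).1.
  by rewrite ug// (test_by_parts tphi G) subrr.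
exists (fun t => c + I 0 t g).
  have := ACD (AC_cst c) G; congr AC; apply/funext => t; exact: add0r.
by apply: (ae_mono cP) => t + t0 => /(_ t0) <-; rewrite subrK.
Qed.

(** At a right Lebesgue point [a] the integral of [h - h a] over [[a, a + r]] equals [- h a * r],
    yet it is at most [e * r] in modulus. *)
Lemma AC_zero_derivative h : locint h -> (forall t, 0 <= t -> I 0 t h = 0) ->
  \forall t \ae mu, 0 <= t -> h t = 0.
Proof.
move=> hl h0; have F := ae_filter_ringOfSetsType mu.
apply: (ae_mono (@filterI _ _ F _ _ (ae_right_lebesgue_pt hl) (ae_neq 0))) => a [la aN0] a0.
have {}a0 : 0 < a by rewrite lt0r aN0.
apply/eqP; rewrite -normr_le0; apply/ler_addgt0Pl => e e0; rewrite addr0.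
have [d d0 dP] := la a0 e e0; have d2 : 0 < d / 2 by rewrite divr_gt0.
have ad : a <= a + d / 2 by rewrite lerDl ltW.
have dd : d / 2 < d by lra.
have hd := dP (d / 2) d2 dd; rewrite -(ler_pM2r d2); apply: le_trans hd.
have la' : locint (fun t => h t - h a).
  by move=> b; apply: intbleB => //; exact: locint_cst.
apply: (le_trans _ (le_normr_Rintegral _ (locint_itv _ la' (ltW a0)))) => //.
rewrite RintegralB//; first last.
- exact: locint_itv (locint_cst _) (ltW a0).
- exact: locint_itv hl (ltW a0).
have -> : I a (a + d / 2) h = 0.
  have := I_split hl (lexx 0) (ltW a0) ad; rewrite (h0 a (ltW a0)).
  by rewrite (h0 _ (le_trans (ltW a0) ad)) add0r => <-.
have -> : I a (a + d / 2) (fun=> h a) = h a * (d / 2).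
  have := AC_increment (ACZ (h a) AC_id) (ltW a0) ad.
  rewrite -mulrBr addrAC subrr add0r => ->.
  by apply: eq_Rintegral => t _; rewrite mulr1.
by rewrite sub0r normrN normrM (gtr0_norm d2).
Qed.

(** Points where [U] and [V] agree lie arbitrarily close to the right of every [a], so continuity
    gives equality everywhere; the difference of the derivatives then has a vanishing primitive. *)
Lemma AC_derivative_unique U V g k : AC U g -> AC V k ->
  (\forall t \ae mu, 0 <= t -> U t = V t) ->
  (forall t, 0 <= t -> U t = V t) /\ \forall t \ae mu, 0 <= t -> g t = k t.
Proof.
move=> Ug Vk UV; have W := ACD Ug (ACZ (-1) Vk).
have Wz : forall a, 0 <= a -> U a + -1 * V a = 0.
  move=> a a0; apply/eqP; rewrite -normr_le0; apply/ler_addgt0Pl => e e0; rewrite addr0.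
  have [d d0 dP] := abs_continuity (a + 1) W.1 e0.
  have ad : a < a + Num.min d 1 by rewrite ltrDl lt_min d0 ltr01.
  have [t [at_ td tP]] := ae_exists ad UV.
  have t0 : 0 <= t by exact: le_trans (ltW at_).
  have := AC_increment_le W a0 (ltW at_).
  rewrite tP// (mulN1r (V t)) subrr sub0r normrN => /le_trans; apply; apply: ltW; apply: dP => //.
  - exact: ltW.
  - by have := ge_min 1 d 1; rewrite lexx orbT; move: td; lra.
  - by have := ge_min d d 1; rewrite lexx; move: td; lra.
split=> [t t0|]; first by move/eqP: (Wz t t0); rewrite mulN1r subr_eq0 => /eqP.
have : forall t, 0 <= t -> I 0 t (fun t => g t + -1 * k t) = 0.
  by move=> t t0; have := W.2 t t0; rewrite !Wz// add0r => /esym.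
move=> /(AC_zero_derivative W.1) H; apply: (ae_mono H) => t + t0 => /(_ t0)/eqP.
by rewrite mulN1r subr_eq0 => /eqP.
Qed.

Lemma integral_to_infinity f g e : 0 < e -> AC f g -> intble halfline g -> exists2 N, 0 <= N &
  forall t, N <= t -> `|f t - (f 0 + \int[mu]_(s in halfline) g s)| <= e.
Proof.
move=> e0 fg gi; have gn := intble_norm (measurable_itv _) gi.
have gl := intble_locint gn.
have cv : (\int[mu]_(s in `[0%R, n%:R]) `|g s|%:E)%E @[n --> \oo] -->
    (\int[mu]_(s in halfline) `|g s|%:E)%E.
  have -> : halfline = \bigcup_n `[0, n%:R]%classic :> set R.
    apply/seteqP; split => [t /=|t [n _] /=]; rewrite !in_itv /= ?andbT.
      by move=> t0; exists (Num.truncn t).+1 => //=; rewrite in_itv/= t0 ltW// truncnS_gt.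
    by move=> /andP[].
  apply: ge0_nondecreasing_set_cvg_integral => //.
  - move=> m n mn; apply/subsetPset/subset_itvl; by rewrite bnd_simp ler_nat.
  - by move=> n; apply/measurable_EFinP; exact: intble_measurable (gl n%:R).
have [n nP] : exists n : nat, \int[mu]_(s in halfline) `|g s| - I 0 n%:R (fun s => `|g s|) <= e.
  have fin : (\int[mu]_(s in halfline) `|g s|%:E)%E \is a fin_num by exact: integrable_fin_num.
  move: cv; rewrite -(fineK fin) => /fine_cvgP[_ /cvgrPdist_le/(_ e e0)[n _ nP]].
  by exists n; apply: le_trans (ler_norm _) (nP n (leqnn n)).
exists n%:R => // t nt; have t0 : 0 <= t by exact: le_trans nt.
have := @Rintegral_itvB R g (BLeft 0) +oo%O t gi; rewrite !bnd_simp => /(_ t0 isT) E1.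
have := @Rintegral_itvB R _ (BLeft 0) +oo%O t gn; rewrite !bnd_simp => /(_ t0 isT) E2.
rewrite (fg.2 t t0) opprD addrACA subrr add0r -opprB normrN E1.
apply: le_trans (le_normr_Rintegral _ _) _ => //.
  by apply: intbleS gi => //; apply: subset_itvr; rewrite bnd_simp.
rewrite -E2; apply: le_trans nP; rewrite lerD2l lerN2.
by rewrite (I_split gl (lexx 0) (ler0n _ n) nt) lerDl; exact: Rintegral_ge0.
Qed.

(* The limit of f at infinity exists, and vanishes as f is integrable. *)
Lemma AC_integrable_vanish f g : AC f g -> intble halfline g -> intble halfline f ->
  \int[mu]_(s in halfline) g s = - f 0.
Proof.
move=> fg gi fi; apply/eqP; rewrite -addr_eq0 addrC -normr_le0; set L := f 0 + _.
rewrite leNgt; apply/negP => L0.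
have L20 : 0 < `|L| / 2 by rewrite divr_gt0.
have [N N0 NP] := integral_to_infinity L20 fg gi; rewrite -/L in NP.
have fn := intble_norm (measurable_itv _) fi; have fl := intble_locint fn.
set K := \int[mu]_(s in halfline) `|f s|.
have KP t : 0 <= t -> I 0 t (fun s => `|f s|) <= K.
  move=> t0; have := @Rintegral_itvB R _ (BLeft 0) +oo%O t fn; rewrite !bnd_simp => /(_ t0 isT) E2.
  by rewrite -subr_ge0 E2; exact: Rintegral_ge0.
have K0 : 0 <= K by exact: Rintegral_ge0.
(* Beyond [N] one has [|f| >= |L| / 2]; a window of length [k] there contributes [K + 1], more than
   the total integral [K]. *)
pose k := (K + 1) / (`|L| / 2); have k0 : 0 <= k by rewrite divr_ge0 ?addr_ge0// ltW.
have NNk : N <= N + k by rewrite lerDl.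
have := KP (N + k) (addr_ge0 N0 k0); rewrite (I_split fl (lexx 0) N0 NNk).
have : 0 <= I 0 N (fun s => `|f s|) by exact: Rintegral_ge0.
have : I N (N + k) (fun=> `|L| / 2) <= I N (N + k) (fun s => `|f s|).
  apply: le_Rintegral => //.
  - exact: locint_itv (locint_cst _) N0.
  - exact: locint_itv fl N0.
  - move=> t /=; rewrite in_itv/= => /andP[Nt _]; have := NP t Nt.
    by have := ler_normD (L - f t) (f t); rewrite subrK (distrC L); lra.
have -> : I N (N + k) (fun=> `|L| / 2) = `|L| / 2 * k.
  have := AC_increment (ACZ (`|L| / 2) AC_id) N0 NNk.
  rewrite -mulrBr addrAC subrr add0r => ->.
  by apply: eq_Rintegral => t _; rewrite mulr1.
have -> : `|L| / 2 * k = K + 1 by rewrite mulrC divfK// gt_eqF.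
lra.
Qed.

End Distributions.

(** * Complex and vector valued absolutely continuous functions *)

Section ComplexAC.
Context {R : realType}.
Local Notation C := R[i].
Local Notation mu := (@lebesgue_measure R).

Lemma ReM (a b : C) : Re (a * b) = Re a * Re b - Im a * Im b.
Proof. by case: a; case: b. Qed.

Lemma ImM (a b : C) : Im (a * b) = Re a * Im b + Im a * Re b.
Proof. by case: a; case: b. Qed.

Lemma ReN (a : C) : Re (- a) = - Re a. Proof. by case: a. Qed.
Lemma ImN (a : C) : Im (- a) = - Im a. Proof. by case: a. Qed.
Lemma Re_conj (a : C) : Re (a^*) = Re a. Proof. by case: a. Qed.
Lemma Im_conj (a : C) : Im (a^*) = - Im a. Proof. by case: a. Qed.
Lemma Re_real (a : R) : Re (a%:C) = a. Proof. by []. Qed.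
Lemma Im_real (a : R) : Im (a%:C) = 0. Proof. by []. Qed.

Definition cplxE := (@ReD R, @ImD R, ReM, ImM, ReN, ImN, Re_conj, Im_conj, Re_real, Im_real).

Lemma eq_AC (f f' g g' : R -> R) : AC f g -> f =1 f' -> g =1 g' -> AC f' g'.
Proof. by move=> fg /funext <- /funext <-. Qed.

Definition clocint (f : R -> C) := locint (fun t => Re (f t)) /\ locint (fun t => Im (f t)).

Definition cAC (f g : R -> C) :=
  AC (fun t => Re (f t)) (fun t => Re (g t)) /\ AC (fun t => Im (f t)) (fun t => Im (g t)).

Lemma eq_cAC (f f' g g' : R -> C) : cAC f g -> f =1 f' -> g =1 g' -> cAC f' g'.
Proof. by move=> fg /funext <- /funext <-. Qed.

Lemma cAC_cst (c : C) : cAC (fun=> c) (fun=> 0).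
Proof. by split; exact: AC_cst. Qed.

Lemma cACD (f f' g g' : R -> C) : cAC f f' -> cAC g g' ->
  cAC (fun t => f t + g t) (fun t => f' t + g' t).
Proof.
move=> [f1 f2] [g1 g2]; split.
  by apply: (eq_AC (ACD f1 g1)) => t; rewrite ReD.
by apply: (eq_AC (ACD f2 g2)) => t; rewrite ImD.
Qed.

Lemma cACM (f f' g g' : R -> C) : cAC f f' -> cAC g g' ->
  cAC (fun t => f t * g t) (fun t => f' t * g t + f t * g' t).
Proof.
move=> [f1 f2] [g1 g2]; split.
  by apply: (eq_AC (ACD (ACM f1 g1) (ACZ (-1) (ACM f2 g2)))) => t; rewrite !cplxE; ring.
by apply: (eq_AC (ACD (ACM f1 g2) (ACM f2 g1))) => t; rewrite !cplxE; ring.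
Qed.

Lemma cAC_conj (f f' : R -> C) : cAC f f' -> cAC (fun t => (f t)^*) (fun t => (f' t)^*).
Proof.
move=> [f1 f2]; split; first by apply: (eq_AC f1) => t; rewrite Re_conj.
by apply: (eq_AC (ACZ (-1) f2)) => t; rewrite Im_conj mulN1r.
Qed.

Lemma cAC_sum n (F G : 'I_n -> R -> C) : (forall i, cAC (F i) (G i)) ->
  cAC (fun t => \sum_i F i t) (fun t => \sum_i G i t).
Proof.
move=> FG; elim: (index_enum _) => [|i s IH].
  by apply: (eq_cAC (cAC_cst 0)) => t; rewrite big_nil.
by apply: (eq_cAC (cACD (FG i) IH)) => t; rewrite big_cons.
Qed.

Definition vAC d (u g : R -> 'cV[C]_d) := forall i, cAC (fun t => u t i 0) (fun t => g t i 0).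

Definition vlocint d (g : R -> 'cV[C]_d) := forall i, clocint (fun t => g t i 0).

Lemma vAC_linear d (a : C) (u g v k : R -> 'cV[C]_d) : vAC u g -> vAC v k ->
  vAC (fun t => a *: u t + v t) (fun t => a *: g t + k t).
Proof.
move=> ug vk i; apply: (eq_cAC (cACD (cACM (cAC_cst a) (ug i)) (vk i))) => t; rewrite !mxE//.
by rewrite mul0r add0r.
Qed.

Lemma vAC_mulmx d (A : 'M[C]_d) (u g : R -> 'cV[C]_d) : vAC u g ->
  vAC (fun t => A *m u t) (fun t => A *m g t).
Proof.
move=> ug i; apply: (eq_cAC (cAC_sum (fun j => cACM (cAC_cst (A i j)) (ug j)))) => t.
  by rewrite mxE.
by rewrite mxE; apply: eq_bigr => j _; rewrite mul0r add0r.
Qed.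

Lemma vAC_scale d (f f' : R -> R) (c : 'cV[C]_d) : AC f f' ->
  vAC (fun t => (f t)%:C *: c) (fun t => (f' t)%:C *: c).
Proof.
move=> ff i; have fC : cAC (fun t => (f t)%:C) (fun t => (f' t)%:C).
  by split => //=; exact: AC_cst.
by apply: (eq_cAC (cACM fC (cAC_cst (c i 0)))) => t; rewrite mxE// mulr0 addr0.
Qed.

Lemma vAC_sform d (W : 'M[C]_d) (u g v k : R -> 'cV[C]_d) : vAC u g -> vAC v k ->
  cAC (fun t => sform W (u t) (v t)) (fun t => sform W (g t) (v t) + sform W (u t) (k t)).
Proof.
move=> ug vk.
have E (x y : 'cV[C]_d) : sform W x y = \sum_j (\sum_i (x i 0)^* * W i j) * y j 0.
  rewrite /sform mxE; apply: eq_bigr => j _; rewrite mxE; congr (_ * _).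
  by apply: eq_bigr => i _; rewrite !mxE.
have H1 j := cAC_sum (fun i => cACM (cAC_conj (ug i)) (cAC_cst (W i j))).
apply: (eq_cAC (cAC_sum (fun j => cACM (H1 j) (vk j)))) => t; rewrite !E// -big_split.
apply: eq_bigr => j _ /=; congr (_ * _ + _).
by apply: eq_bigr => i _; rewrite mulr0 addr0.
Qed.

Lemma vAC_measurable d (u g : R -> 'cV[C]_d) : vAC u g -> mxmeasurable halfline u.
Proof.
move=> ug i j; rewrite ord1; have [u1 u2] := ug i.
by split; [exact: AC_measurable u1|exact: AC_measurable u2].
Qed.

Lemma vAC_derivative_unique d (U V g k : R -> 'cV[C]_d) : vAC U g -> vAC V k ->
  (\forall t \ae mu, 0 <= t -> U t = V t) ->
  (forall t, 0 <= t -> U t = V t) /\ \forall t \ae mu, 0 <= t -> g t = k t.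
Proof.
move=> Ug Vk UV; have F := ae_filter_ringOfSetsType mu.
have H i : (forall t, 0 <= t -> U t i 0 = V t i 0) /\
    \forall t \ae mu, 0 <= t -> g t i 0 = k t i 0.
  have [u1 u2] := Ug i; have [v1 v2] := Vk i.
  have e1 : \forall t \ae mu, 0 <= t -> Re (U t i 0) = Re (V t i 0).
    by apply: (ae_mono UV) => t + t0 => /(_ t0) ->.
  have e2 : \forall t \ae mu, 0 <= t -> Im (U t i 0) = Im (V t i 0).
    by apply: (ae_mono UV) => t + t0 => /(_ t0) ->.
  have [h1 h2] := AC_derivative_unique u1 v1 e1; have [h3 h4] := AC_derivative_unique u2 v2 e2.
  split=> [t t0|]; first by apply/eqP; rewrite eq_complex h1// h3// !eqxx.
  apply: (ae_mono (@filterI _ _ F _ _ h2 h4)) => t [k1 k2] t0.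
  by apply/eqP; rewrite eq_complex k1// k2// !eqxx.
split=> [t t0|]; first by apply/matrixP => i j; rewrite ord1; exact: (H i).1.
have H2 : \forall t \ae mu, forall i : 'I_d, 0 <= t -> g t i 0 = k t i 0.
  by apply: filter_forall => i; exact: (H i).2.
by apply: (ae_mono H2) => t h t0; apply/matrixP => i j; rewrite ord1 h.
Qed.

Lemma vint_scaleE d phi (w : R -> 'cV[C]_d) i :
  (vint halfline (fun t => (phi t)%:C *: w t)) i 0 =
    (\int[mu]_(t in halfline) (phi t * Re (w t i 0))) +i*
    (\int[mu]_(t in halfline) (phi t * Im (w t i 0))).
Proof.
rewrite mxE /cint; congr (_ +i* _).
  by apply: eq_Rintegral => t _; rewrite mxE !cplxE mul0r subr0.
by apply: eq_Rintegral => t _; rewrite mxE !cplxE mul0r addr0.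
Qed.

(** Test functions are real, so the real and imaginary parts of each coordinate satisfy separate
    scalar identities. *)
Lemma distr_derivative_vAC d (u g : R -> 'cV[C]_d) : vlocint u -> vlocint g ->
  distr_derivative u g -> exists2 U, vAC U g & \forall t \ae mu, 0 <= t -> u t = U t.
Proof.
move=> ul gl ug.
have H i : exists U : R -> C, cAC U (fun t => g t i 0) /\
    \forall t \ae mu, 0 <= t -> u t i 0 = U t.
  have ugi phi : test_function phi -> _ := fun tphi =>
    let: e := (congr1 (fun M : 'cV[C]_d => M i 0) (ug phi tphi)) in e.
  have [|||U1 U1AC U1P] := @distr_AC R (fun t => Re (u t i 0)) (fun t => Re (g t i 0)).
  - exact: (ul i).1.
  - exact: (gl i).1.
  - by move=> phi /ugi; rewrite [in RHS]mxE !vint_scaleE => -[].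
  have [|||U2 U2AC U2P] := @distr_AC R (fun t => Im (u t i 0)) (fun t => Im (g t i 0)).
  - exact: (ul i).2.
  - exact: (gl i).2.
  - by move=> phi /ugi; rewrite [in RHS]mxE !vint_scaleE => -[].
  exists (fun t => U1 t +i* U2 t); split; first by split.
  have F := ae_filter_ringOfSetsType mu.
  apply: (ae_mono (@filterI _ _ F _ _ U1P U2P)) => t [h1 h2] t0.
  by apply/eqP; rewrite eq_complex /= h1// h2// !eqxx.
have [U UP] := choice H.
exists (fun t => \col_i U i t).
  by move=> i; apply: (eq_cAC (UP i).1) => t //; rewrite mxE.
have H2 : \forall t \ae mu, forall i : 'I_d, 0 <= t -> u t i 0 = U i t.
  by apply: filter_forall => i; exact: (UP i).2.
by apply: (ae_mono H2) => t k t0; apply/matrixP => i j; rewrite ord1 mxE k.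
Qed.

Lemma vAC_distr_derivative d (u g U k : R -> 'cV[C]_d) :
  mxmeasurable halfline u -> mxmeasurable halfline g ->
  vAC U k -> (\forall t \ae mu, 0 <= t -> u t = U t) ->
  (\forall t \ae mu, 0 <= t -> g t = k t) -> distr_derivative u g.
Proof.
move=> mu_ mg Uk uU gk phi tphi; apply/matrixP => i j; rewrite ord1 {j} [RHS]mxE.
have [dphi _ _] := tphi.
have mphi n : measurable_fun (halfline : set R) (derive1n n phi).
  apply: measurable_funTS; apply: continuous_measurable_fun => x.
  exact/differentiable_continuous/derivable1_diffP.
have [U1 U2] := Uk i; have [u1 u2] := mu_ i 0; have [g1 g2] := mg i 0.
have mU := vAC_measurable Uk.
have [m1 m2] := mU i 0.
have aeh (P : R -> Prop) : (\forall t \ae mu, 0 <= t -> P t) -> \forall t \ae mu, halfline t -> P t.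
  by move=> H; apply: (ae_mono H) => t; rewrite /= in_itv/= andbT.
have key (a a' b b' : R -> R) : measurable_fun (halfline : set R) a -> measurable_fun (halfline : set R) b ->
    AC a' b' -> (\forall t \ae mu, 0 <= t -> a t = a' t) ->
    (\forall t \ae mu, 0 <= t -> b t = b' t) ->
    \int[mu]_(t in halfline) (phi^`()%classic t * a t) =
    - \int[mu]_(t in halfline) (phi t * b t).
  move=> ma mb a'b' aa bb.
  rewrite (@eq_ae_Rintegral _ _ _ (fun t => phi^`()%classic t * a' t))//; first last.
  - by apply: aeh; apply: (ae_mono aa) => t + t0 => /(_ t0) ->.
  - by apply: measurable_funM; [exact: (mphi 1)|exact: AC_measurable a'b'].
  - by apply: measurable_funM; [exact: (mphi 1)|].
  rewrite (test_by_parts tphi a'b'); congr (- _).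
  apply: eq_ae_Rintegral => //.
  - by apply: measurable_funM; [exact: (mphi 0)|exact: locint_measurable a'b'.1].
  - by apply: measurable_funM; [exact: (mphi 0)|].
  - by apply: aeh; apply: (ae_mono bb) => t + t0 => /(_ t0) ->.
rewrite !mxE /cint /=; apply/eqP; rewrite eq_complex /=; apply/andP; split; apply/eqP.
  rewrite (@eq_Rintegral _ _ _ mu _ (fun t => phi^`()%classic t * Re (u t i 0))); last first.
    by move=> t _; rewrite mxE !cplxE mul0r subr0.
  rewrite [X in - X](@eq_Rintegral _ _ _ mu _ (fun t => phi t * Re (g t i 0))); last first.
    by move=> t _; rewrite mxE !cplxE mul0r subr0.
  apply: key u1 g1 U1 _ _.
    by apply: (ae_mono uU) => t + t0 => /(_ t0) ->.
  by apply: (ae_mono gk) => t + t0 => /(_ t0) ->.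
rewrite (@eq_Rintegral _ _ _ mu _ (fun t => phi^`()%classic t * Im (u t i 0))); last first.
  by move=> t _; rewrite mxE !cplxE mul0r addr0.
rewrite [X in - X](@eq_Rintegral _ _ _ mu _ (fun t => phi t * Im (g t i 0))); last first.
  by move=> t _; rewrite mxE !cplxE mul0r addr0.
apply: key u2 g2 U2 _ _.
  by apply: (ae_mono uU) => t + t0 => /(_ t0) ->.
by apply: (ae_mono gk) => t + t0 => /(_ t0) ->.
Qed.

End ComplexAC.

(** * Continuous representatives and the value at 0 *)

Section BoundaryValue.
Context {R : realType}.
Local Notation C := R[i].
Local Notation mu := (@lebesgue_measure R).

Lemma normc_le_ReIm (z : C) (e : R) : `|Re z| < e / 2 -> `|Im z| < e / 2 -> `|z| < e%:C.
Proof.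
move=> h1 h2; have e0 : 0 < e by have := normr_ge0 (Re z); lra.
rewrite normc_def ltcR -ltr_sqr ?nnegrE ?sqrtr_ge0 ?(ltW e0)//.
rewrite sqr_sqrtr ?addr_ge0 ?sqr_ge0// -(real_normK (num_real (Re z))).
rewrite -(real_normK (num_real (Im z))).
by move: (normr_ge0 (Re z)) (normr_ge0 (Im z)) h1 h2; nra.
Qed.

Lemma normcB_lt (z w : C) (e : R) : `|Re z - Re w| < e / 2 -> `|Im z - Im w| < e / 2 ->
  `|z - w| < e%:C.
Proof. by move=> h1 h2; apply: normc_le_ReIm; rewrite !cplxE. Qed.

Lemma AC_continuous (f g : R -> R) (x e : R) : AC f g -> 0 <= x -> 0 < e ->
  \forall t \near within halfline (nbhs x), `|f x - f t| < e.
Proof.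
move=> fg x0 e0; have [d d0 dP] := abs_continuity (x + 1) fg.1 e0.
rewrite near_withinE nearE; exists (Num.min d 1) => /=; first by rewrite lt_min d0 ltr01.
move=> t /=; rewrite in_itv/= andbT lt_min => /andP[td t1] t0.
have [xt|/ltW tx] := leP x t.
  rewrite distrC (le_lt_trans (AC_increment_le fg x0 xt))// dP//.
    by move: t1; rewrite ltr_norml; lra.
  by move: td; rewrite ltr_norml; lra.
rewrite (le_lt_trans (AC_increment_le fg t0 tx))// dP//; first by rewrite lerDl.
by move: td; rewrite ltr_norml; lra.
Qed.

Lemma vAC_continuous d (u g : R -> 'cV[C]_d) : vAC u g -> {within halfline, continuous u}.
Proof.
move=> ug; apply/subspace_continuousP => x; rewrite /= in_itv/= andbT => x0 B [P PN sB].
suff : \forall t \near within halfline (nbhs x), forall ij : 'I_d * 'I_1, P ij.1 ij.2 (u t ij.1 ij.2).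
  by apply: filterS => t H; apply: sB => i j; exact: (H (i, j)).
apply: filter_forall => -[i j]; rewrite /= ord1.
have /nbhs_ballP[e e0 eP] := PN i 0.
have [u1 u2] := ug i.
(* A positive radius in [R[i]] is a real number and is replaced by its real part. *)
move: e e0 eP => [e e'] /=; rewrite ltcE/= => /andP[/eqP -> e0] eP.
have e2 : 0 < e / 2 by rewrite divr_gt0.
apply: (@filterS2 _ _ _ _ _ _ _ (AC_continuous u1 x0 e2) (AC_continuous u2 x0 e2)) => t h1 h2.
apply: eP; rewrite -ball_normE /=; exact: normcB_lt h1 h2.
Qed.

(** [value0] selects some continuous representative, and any two agree at 0: otherwise a coordinate
    would separate them on a whole interval [[0, r[], which contains a point where both equal
    [u]. *)
Lemma vAC_value0 d (u U g : R -> 'cV[C]_d) : vAC U g ->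
  (\forall t \ae mu, 0 <= t -> u t = U t) -> value0 u = U 0.
Proof.
move=> Ug uU; rewrite /value0; case: xgetP => [z _ [v [vc uv <-]]|]; last first.
  by move=> /(_ (U 0)) []; exists U; split=> //; exact: vAC_continuous Ug.
have vU : \forall t \ae mu, 0 <= t -> v t = U t.
  have F := ae_filter_ringOfSetsType mu.
  by apply: (ae_mono (@filterI _ _ F _ _ uU uv)) => t [h1 h2] t0; rewrite -h1// h2.
have h0 : halfline (0 : R) by rewrite /= in_itv/= lexx.
have vc0 := (subspace_continuousP _ _).1 vc 0 h0.
have Uc0 := (subspace_continuousP _ _).1 (vAC_continuous Ug) 0 h0.
apply: contrapT => vU0.
have [i vUi] : exists i, v 0 i 0 <> U 0 i 0.
  apply: contrapT => /forallNP H; apply: vU0; apply/matrixP => i j; rewrite ord1.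
  by apply: contrapT => /(H i).
pose e := `|v 0 i 0 - U 0 i 0|; have e0 : 0 < e by rewrite normr_gt0 subr_eq0; apply/eqP.
have nb (w : R -> 'cV[C]_d) : w @ within halfline (nbhs (0 : R)) --> w 0 ->
    \forall t \near within halfline (nbhs (0 : R)), `|w 0 i 0 - w t i 0| < e / 2.
  move=> wc; apply: (wc [set M : 'cV[C]_d | `|w 0 i 0 - M i 0| < e / 2]).
  exists (fun i j => ball (w 0 i j) (e / 2)).
    by move=> k l; apply: nbhsx_ballx; rewrite divr_gt0.
  by move=> M /(_ i 0); rewrite -ball_normE.
have := filterI (nb v vc0) (nb U Uc0).
move=> -[r /= r0 rP].
have [t [t0 td tP]] := ae_exists r0 vU.
have := rP t; rewrite /= sub0r normrN (gtr0_norm t0) in_itv/= andbT => /(_ td (ltW t0)) [h1 h2].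
rewrite (tP (ltW t0)) in h1; have h3 := ler_distD (U t i 0) (v 0 i 0) (U 0 i 0).
rewrite (distrC (U t i 0)) in h3.
by have := le_lt_trans h3 (ltrD h1 h2); rewrite -splitr ltxx.
Qed.

End BoundaryValue.

(** * Contraction semigroups on Hilbert spaces *)

Lemma half_powP (R : realType) (e : R) : 0 < e -> exists N, forall n, (N <= n)%N -> 2^-1 ^+ n < e.
Proof.
move=> e0; have := @cvg_geometric R 1 2^-1.
rewrite ger0_norm ?invr_ge0// invf_lt1// ltr1n => /(_ isT)/cvgrPdist_lt/(_ e e0).
move=> [N _ HN]; exists N => n /HN /=.
by rewrite sub0r normrN mul1r ger0_norm// exprn_ge0// invr_ge0.
Qed.

Lemma nbhs_right0_dltP (R : realType) (P : R -> Prop) :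
  (\forall t \near 0^'+, P t) <-> exists2 d, 0 < d & forall t, 0 < t -> t < d -> P t.
Proof.
rewrite nearE; split.
  move=> [d /= d0 dP]; exists d => // t t0 td; apply: dP => //=.
  by rewrite sub0r normrN ger0_norm// ltW.
move=> [d d0 dP]; exists d => //= t /=; rewrite sub0r normrN => td t0.
by apply: dP => //; rewrite (le_lt_trans _ td)// ler_norm.
Qed.

(** * Linear operators defined on a subspace *)

Section OperatorTheory.
Context (K : nzRingType) (V : lmodType K) (H : operator V).

Lemma dom_scale (a : K) x : dom H x -> dom H (a *: x).
Proof. by move=> Dx; rewrite -[_ *: x]addr0; apply: dom_linear => //; exact: dom0. Qed.

Lemma dom_sub x y : dom H x -> dom H y -> dom H (x - y).
Proof. by move=> Dx Dy; rewrite addrC -scaleN1r; exact: dom_linear. Qed.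

Lemma op_zero : H 0 = 0.
Proof.
have := op_linear (-1) (dom0 H) (dom0 H).
by rewrite scaler0 addr0 scaleN1r addNr.
Qed.

Lemma op_scale (a : K) x : dom H x -> H (a *: x) = a *: H x.
Proof.
by move=> Dx; rewrite -[in LHS](addr0 (_ *: x)) op_linear ?op_zero ?addr0//; exact: dom0.
Qed.

Lemma op_sub x y : dom H x -> dom H y -> H (x - y) = H x - H y.
Proof.
by move=> Dx Dy; rewrite addrC -scaleN1r op_linear// scaleN1r addrC.
Qed.

End OperatorTheory.

(** * Geometry of the real inner product *)

Section InnerProduct.
Context (R : realType) (V : normedModType R[i]) (dot : V -> V -> R).
Context (dotC : forall x y, dot x y = dot y x)
  (dotDl : forall x y z, dot (x + y) z = dot x z + dot y z)
  (dotZl : forall (s : R) x y, dot (s%:C *: x) y = s * dot x y)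
  (dot_ge0 : forall x, 0 <= dot x x)
  (dot_norm : forall x, `|x| = (Num.sqrt (dot x x))%:C).

(** The norm of [V] has values in [R[i]]; [nr] is the same norm with real values, so that real
    arithmetic applies. *)
Definition nr x := Num.sqrt (dot x x).

Lemma dotDr x y z : dot x (y + z) = dot x y + dot x z.
Proof. by rewrite dotC dotDl !(dotC x). Qed.

Lemma dotZr s x y : dot x (s%:C *: y) = s * dot x y.
Proof. by rewrite dotC dotZl dotC. Qed.

Lemma dotNl x y : dot (- x) y = - dot x y.
Proof. by have := dotZl (-1) x y; rewrite rmorphN scaleN1r mulN1r. Qed.

Lemma dotNr x y : dot x (- y) = - dot x y.
Proof. by rewrite dotC dotNl dotC. Qed.

Lemma dotBl x y z : dot (x - y) z = dot x z - dot y z.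
Proof. by rewrite dotDl dotNl. Qed.

Lemma dot0l x : dot 0 x = 0.
Proof. by have := dotBl x x x; rewrite !subrr. Qed.

Lemma nr_norm x : `|x| = (nr x)%:C.
Proof. exact: dot_norm. Qed.

Lemma nr_ge0 x : 0 <= nr x.
Proof. exact: sqrtr_ge0. Qed.
Hint Resolve nr_ge0 : core.

Lemma nr_sqr x : nr x ^+ 2 = dot x x.
Proof. exact: sqr_sqrtr. Qed.

Lemma nrD x y : nr (x + y) <= nr x + nr y.
Proof. by rewrite -lecR rmorphD/= -!nr_norm ler_normD. Qed.

Lemma nrN x : nr (- x) = nr x.
Proof. by apply: complexI; rewrite -!nr_norm normrN. Qed.

Lemma nrB x y : nr (x - y) = nr (y - x).
Proof. by rewrite -nrN opprB. Qed.

Lemma nrZ s x : nr (s%:C *: x) = `|s| * nr x.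
Proof.
by rewrite /nr dotZl dotZr mulrA -expr2 sqrtrM ?sqr_ge0// sqrtr_sqr.
Qed.

Lemma nr0 : nr 0 = 0.
Proof. by apply: complexI; rewrite -nr_norm normr0. Qed.

Lemma nr_eq0 x : nr x = 0 -> x = 0.
Proof. by move=> x0; apply/normr0_eq0; rewrite nr_norm x0. Qed.

Lemma nr_triangle y x z : nr (x - z) <= nr (x - y) + nr (y - z).
Proof. by rewrite (le_trans _ (nrD _ _))// addrA subrK. Qed.

Lemma dot_CS x y : dot x y <= nr x * nr y.
Proof.
have := @quad_disc R (nr x) (nr y) (2 * dot x y) (nr_ge0 _) (nr_ge0 _).
rewrite -mulrA ler_pM2l// => -> // s.
have := dot_ge0 (s%:C *: x + y).
rewrite !(dotDl, dotDr, dotZl, dotZr) !nr_sqr (dotC y x); lra.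
Qed.

Lemma cvg_nrP (T : Type) (F : set_system T) (FF : Filter F) (f : T -> V) l :
  f t @[t --> F] --> l <-> forall e : R, 0 < e -> \forall t \near F, nr (l - f t) < e.
Proof.
split=> [/cvgrPdist_lt fl e e0|fl].
  have := fl e%:C; rewrite ltcR => /(_ e0); apply: filterS => t.
  by rewrite nr_norm ltcR.
apply/cvgrPdist_lt => -[e e']; rewrite ltcE/= => /andP[/eqP -> e0].
by apply: filterS (fl _ e0) => t; rewrite nr_norm -ltcR.
Qed.

Lemma cvg_seqP (s : nat -> V) l : s k @[k --> \oo] --> l <->
  forall e : R, 0 < e -> exists N, forall n, (N <= n)%N -> nr (l - s n) < e.
Proof.
rewrite cvg_nrP; split=> H e e0.
  by have [N _ HN] := H e e0; exists N.
by have [N HN] := H e e0; exists N.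
Qed.

Lemma cvg_nr_le (s : nat -> V) l a C : s k @[k --> \oo] --> l ->
  (forall k, nr (s k - a) <= C) -> nr (l - a) <= C.
Proof.
move=> /cvg_seqP sl sC; apply/ler_addgt0Pl => e e0.
have [N /(_ N (leqnn N))] := sl e e0.
by have := nr_triangle (s N) l a; have := sC N; lra.
Qed.

Lemma cvg_dot (s : nat -> V) l a : s k @[k --> \oo] --> l ->
  dot (s k) a @[k --> \oo] --> dot l a.
Proof.
move=> /cvg_seqP sl; apply/cvgrPdist_lt => e e0.
have na : 0 < nr a + 1 by rewrite ltr_wpDl.
have [|N HN] := sl (e / (nr a + 1)); first exact: divr_gt0.
exists N => // n /= /HN; rewrite ltr_pdivlMr// => H.
have H1 := dot_CS (l - s n) a; have := dot_CS (s n - l) a.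
rewrite nrB; move: H1; rewrite !dotBl => H1 H2.
rewrite ltr_norml; have := nr_ge0 (l - s n); lra.
Qed.

Lemma cvg_nr_unique (s : nat -> V) (l l' : V) :
  s k @[k --> \oo] --> l -> s k @[k --> \oo] --> l' -> l = l'.
Proof.
move=> /cvg_seqP sl /cvg_seqP sl'; apply/eqP; rewrite -subr_eq0; apply/eqP/nr_eq0.
apply/eqP; rewrite eq_le nr_ge0 andbT; apply/ler_addgt0Pl => e e0.
have [N HN] := sl _ (divr_gt0 e0 (ltr0n R 2)).
have [N' HN'] := sl' _ (divr_gt0 e0 (ltr0n R 2)).
have := HN _ (leq_maxl N N'); have := HN' _ (leq_maxr N N').
have := nr_triangle (s (maxn N N')) l l'; rewrite (nrB (s _) l').
by lra.
Qed.

(** A geometric sum in telescoped form; keeping the subtracted term is what makes the induction on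
    [j] close. *)
Lemma fast_cauchy (s : nat -> V) C :
  (forall k, nr (s k.+1 - s k) <= C * 2^-1 ^+ k) ->
  forall k j, nr (s (k + j)%N - s k) <= 2 * C * (2^-1 ^+ k - 2^-1 ^+ (k + j)).
Proof.
move=> sC k; elim=> [|j IH]; first by rewrite addn0 !subrr nr0 mulr0.
apply: le_trans (nr_triangle (s (k + j)%N) _ _) _.
rewrite addnS; have := sC (k + j)%N; rewrite exprS.
by move: IH; lra.
Qed.

(** The limit of difference quotients as an o(t) estimate free of divisions, the form used in all
    generator arguments. *)
Lemma generator_limP (T : R -> V -> V) x y :
  (t^-1)%:C *: (T t x - x) @[t --> 0^'+] --> y <->
  forall e : R, 0 < e -> exists2 d, 0 < d &
    forall t, 0 < t -> t < d -> nr (T t x - x - t%:C *: y) < e * t.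
Proof.
have E t : 0 < t -> forall e : R,
    (nr (y - (t^-1)%:C *: (T t x - x)) < e) = (nr (T t x - x - t%:C *: y) < e * t).
  move=> t0 e.
  have -> : y - (t^-1)%:C *: (T t x - x) = - ((t^-1)%:C *: (T t x - x - t%:C *: y)).
    rewrite [in RHS]scalerBr scalerA -rmorphM /= mulVf ?gt_eqF// scale1r opprB.
    by [].
  by rewrite nrN nrZ gtr0_norm ?invr_gt0// mulrC ltr_pdivrMr.
rewrite cvg_nrP; split => H e e0.
  have /nbhs_right0_dltP[d d0 dP] := H e e0; exists d => // t t0 td.
  by rewrite -E// dP.
by apply/nbhs_right0_dltP; have [d d0 dP] := H e e0; exists d => // t t0 td; rewrite E// dP.
Qed.

(** * Density from a trivial orthogonal complement *)

Section Projection.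
Context (complete : forall s : nat -> V,
  (forall e : R, 0 < e -> exists N, forall m n, (N <= m)%N -> (N <= n)%N ->
     nr (s m - s n) < e) -> exists l : V, s k @[k --> \oo] --> l).
Context (D : set V) (D0 : D 0)
  (D_linear : forall (s : R) x y, D x -> D y -> D (s%:C *: x + y)).

(* A minimizing sequence for the distance to D is Cauchy by the parallelogram
   law, and the difference to its limit is orthogonal to D. *)
Lemma dense_orth : (forall y, (forall x, D x -> dot x y = 0) -> y = 0) ->
  forall y (e : R), 0 < e -> exists2 x, D x & nr (y - x) < e.
Proof.
move=> Dperp y e0 e0gt.
pose E := [set nr (y - x) ^+ 2 | x in D].
have Einf : has_inf E.
  split; first by exists (nr (y - 0) ^+ 2), 0.
  by exists 0 => _ [x _ <-]; exact: sqr_ge0.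
pose m := inf E.
have mE x : D x -> m <= nr (y - x) ^+ 2 by move=> Dx; apply: (ge_inf Einf.2); exists x.
have /choice[s sP] (k : nat) : exists x, D x /\ nr (y - x) ^+ 2 < m + 2^-1 ^+ k.
  have p0 : 0 < (2^-1 : R) ^+ k by rewrite exprn_gt0// invr_gt0.
  have [_ [x Dx <-] xm] := @inf_adherent _ _ _ p0 Einf.
  by exists x.
have par k l : nr (s k - s l) ^+ 2 <= 2 * 2^-1 ^+ k + 2 * 2^-1 ^+ l.
  have [Dk Hk] := sP k; have [Dl Hl] := sP l.
  have : D (2^-1%:C *: (s k) + 2^-1%:C *: (s l)).
    by apply: D_linear => //; rewrite -[_ *: s l]addr0; exact: D_linear.
  move=> /mE; move: Hk Hl; rewrite !nr_sqr.
  rewrite !(dotDl, dotDr, dotNl, dotNr, dotZl, dotZr).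
  rewrite (dotC (s k) y) (dotC (s l) y) (dotC (s l) (s k)); lra.
have [|l sl] := @complete s.
  move=> e egt; have e4 : 0 < e ^+ 2 / 4 by rewrite divr_gt0// exprn_gt0.
  have [N HN] := half_powP e4.
  exists N => p q Np Nq; rewrite -ltr_sqr ?nnegrE ?nr_ge0 ?(ltW egt)//.
  by have := par p q; have := HN _ Np; have := HN _ Nq; lra.
have yl x : D x -> dot x (y - l) = 0.
  move=> Dx.
  (* Minimality of [m] tested at [t x + s k], in the limit over [k], gives a nonnegative quadratic
     polynomial in [t] without constant term; its linear coefficient must vanish. The summand
     [0 ^+ 2] matches [quad_disc]. *)
  have key (t : R) : 0 <= t ^+ 2 * nr x ^+ 2 + t * (- 2 * dot x (y - l)) + 0 ^+ 2.
    apply/ler_addgt0Pl => e egt; rewrite addrC.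
    have H k : m <= nr (y - (t%:C *: x + s k)) ^+ 2.
      by apply: mE; apply: D_linear => //; exact: (sP k).1.
    have e3 : 0 < e / 2 by rewrite divr_gt0.
    have tt : 0 < 4 * `|t| + 1 by rewrite ltr_wpDl// mulr_ge0.
    have e4 : 0 < e / (4 * `|t| + 1) by rewrite divr_gt0.
    have [N1 HN1] := half_powP e3.
    have /cvgrPdist_lt/(_ _ e4)[N2 _ HN2] := @cvg_dot s l x sl.
    pose k := maxn N1 N2.
    have := HN2 k (leq_maxr _ _); have := HN1 k (leq_maxl _ _).
    have := H k; have := (sP k).2; rewrite !nr_sqr /=.
    rewrite !(dotDl, dotDr, dotNl, dotNr, dotZl, dotZr).
    rewrite (dotC (s k) y) (dotC x y) (dotC x (s k)) (dotC x l).
    move=> h1 h2 h3; rewrite ltr_pdivlMr// => h4.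
    have h5 : t * (dot (s k) x - dot l x) <= `|t| * `|dot l x - dot (s k) x|.
      by rewrite distrC -normrM ler_norm.
    have := normr_ge0 (dot l x - dot (s k) x).
    lra.
  have := @quad_disc R (nr x) 0 _ (nr_ge0 _) (lexx 0) key.
  have := @quad_disc R (nr x) 0 (2 * dot x (y - l)) (nr_ge0 _) (lexx 0).
  rewrite mulr0 => H1 H2; apply/eqP; rewrite eq_le; apply/andP; split; last by lra.
  have : 2 * dot x (y - l) <= 0; last by lra.
  by apply: H1 => t; have := key (- t); lra.
have yl0 : y = l by apply/eqP; rewrite -subr_eq0; apply/eqP/Dperp.
have /cvg_seqP/(_ e0 e0gt)[N /(_ N (leqnn N))] := sl; rewrite -yl0 => H.
by exists (s N) => //; exact: (sP N).1.
Qed.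

End Projection.

(** Dissipativity makes the cross term of [|x - l H x|^2 = |x|^2 - 2 l <H x, x> + l^2 |H x|^2]
    nonnegative. The bound yields uniqueness and contractivity of the resolvent and, with a closed
    graph, a closed range. *)
Lemma resolvent_lower_bound (H : operator V)
  (diss : forall x, dom H x -> dot (H x) x <= 0) (l : R) x : 0 <= l -> dom H x ->
  nr x <= nr (x - l%:C *: H x).
Proof.
move=> l0 Dx; rewrite -ler_sqr ?nnegrE ?nr_ge0// !nr_sqr.
rewrite !(dotDl, dotDr, dotNl, dotNr, dotZl, dotZr) (dotC x (H x)).
have := mulr_ge0 (mulr_ge0 l0 l0) (dot_ge0 (H x)).
have : l * dot (H x) x <= 0 by rewrite mulr_ge0_le0// diss.
lra.
Qed.

(** * Construction of the semigroup by implicit Euler steps on dyadic grids *)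

Section Generation.
Context (complete : forall s : nat -> V,
  (forall e : R, 0 < e -> exists N, forall m n, (N <= m)%N -> (N <= n)%N ->
     nr (s m - s n) < e) -> exists l : V, s k @[k --> \oo] --> l).
Context (H : operator V)
  (diss : forall x, dom H x -> dot (H x) x <= 0)
  (surj : forall (l : R), 0 < l -> forall y, exists2 x, dom H x & x - l%:C *: H x = y)
  (dense : forall y (e : R), 0 < e -> exists2 x, dom H x & nr (y - x) < e).

(** The resolvent [(1 - l H)^-1]; by [surj] the default value 0 is never resorted to when
    [l > 0]. *)
Let J (l : R) (y : V) : V := xget 0 [set x | dom H x /\ x - l%:C *: H x = y].

Let JP (l : R) y : 0 < l -> dom H (J l y) /\ J l y - l%:C *: H (J l y) = y.
Proof.
move=> l0; rewrite /J; case: xgetP => [x _ //|]; have [x Dx xy] := surj l0 y.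
by move=> /(_ x) /= [].
Qed.

Let J_unique (l : R) x : 0 < l -> dom H x -> J l (x - l%:C *: H x) = x.
Proof.
move=> l0 Dx; have [DJ JE] := JP (x - l%:C *: H x) l0.
apply/eqP; rewrite -subr_eq0; apply/eqP/nr_eq0/eqP.
rewrite eq_le nr_ge0 andbT; apply: le_trans (resolvent_lower_bound diss (ltW l0) (dom_sub DJ Dx)) _.
by rewrite op_sub// scalerBr !opprD !opprK addrACA JE -[- x + _]opprK [- (- x + _)]opprD opprK subrr nr0.
Qed.

Let J_contract (l : R) y : 0 < l -> nr (J l y) <= nr y.
Proof.
move=> l0; have [DJ JE] := JP y l0.
by have := resolvent_lower_bound diss (ltW l0) DJ; rewrite JE.
Qed.

Let J_linear (l : R) : 0 < l -> linear (J l).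
Proof.
move=> l0 a y z; have [Dy Ey] := JP y l0; have [Dz Ez] := JP z l0.
have Dyz := dom_linear a Dy Dz.
rewrite -(J_unique l0 Dyz); congr (J l _).
by rewrite op_linear// scalerDr opprD addrACA Ez !scalerA mulrC -scalerA -scalerBr Ey.
Qed.

Let JB (l : R) y z : 0 < l -> J l (y - z) = J l y - J l z.
Proof.
by move=> l0; rewrite addrC -scaleN1r J_linear// scaleN1r addrC.
Qed.

(** [H (J l x)] equals [l^-1 (J l x - x)] and so lies in the domain together with [x]; then [J l]
    cancels against [1 - l H]. *)
Let J_comm (l : R) x : 0 < l -> dom H x -> H (J l x) = J l (H x).
Proof.
move=> l0 Dx; have [DJ JE] := JP x l0.
have lC : l%:C != 0 by rewrite fmorph_eq0 gt_eqF.
have E : H (J l x) = l%:C^-1 *: (J l x - x).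
  by rewrite -[X in _ - X]JE opprB addrC subrK scalerA mulVf// scale1r.
have D1 : dom H (H (J l x)) by rewrite E; apply/dom_scale/dom_sub.
rewrite -(J_unique l0 D1); congr (J l _).
rewrite {2}E op_scale ?op_sub//; last exact: dom_sub.
by rewrite scalerA mulfV// scale1r opprB addrC subrK.
Qed.

Let J_near (l : R) x : 0 < l -> dom H x -> nr (J l x - x) <= l * nr (H x).
Proof.
move=> l0 Dx; have [DJ JE] := JP x l0.
rewrite -[X in _ - X]JE opprB addrC subrK J_comm// nrZ gtr0_norm//.
by rewrite ler_pM2l// J_contract.
Qed.

Let D2 x := dom H x /\ dom H (H x).

Let J_D2 (l : R) x : 0 < l -> dom H x -> D2 (J l x).
Proof. by move=> l0 Dx; split; [exact: (JP x l0).1|rewrite J_comm//; exact: (JP (H x) l0).1]. Qed.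

(** For [w = J l x], applying [1 - (l/2) H] twice to [w] gives [x + (l^2/4) H (H w)]. Two half steps
    therefore miss one full step by an error of second order. *)
Let JJ (l : R) x : 0 < l -> D2 x ->
  nr (J (l / 2) (J (l / 2) x) - J l x) <= l ^+ 2 / 4 * nr (H (H x)).
Proof.
move=> l0 [Dx DHx]; have [Dw wE] := JP x l0.
have l20 : 0 < l / 2 by rewrite divr_gt0.
have DHw : dom H (H (J l x)) by rewrite J_comm//; have [] := JP (H x) l0.
set w := J l x in Dw wE DHw *.
have E1 : J (l / 2) (w - (l / 2)%:C *: H w) = w by rewrite J_unique.
have D1 : dom H (w - (l / 2)%:C *: H w) by apply/dom_sub => //; exact/dom_scale.
have := J_unique l20 D1; rewrite op_sub// ?op_scale//; last exact: dom_scale.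
have -> : w - (l / 2)%:C *: H w - (l / 2)%:C *: (H w - (l / 2)%:C *: H (H w)) =
    x + (l ^+ 2 / 4)%:C *: H (H w).
  rewrite scalerBr opprB scalerA -wE [_ - (l / 2)%:C *: H w in X in _ + X]addrC.
  rewrite addrA -[w - _ - _]addrA -opprD -scalerDl -rmorphM -rmorphD /= -splitr.
  by congr (_ + _%:C *: _); field.
move=> E2; rewrite -E1 -E2 -!JB//.
rewrite opprD addrA subrr add0r.
apply: le_trans (J_contract _ l20) _; apply: le_trans (J_contract _ l20) _.
rewrite nrN nrZ ger0_norm ?divr_ge0 ?sqr_ge0// ler_wpM2l ?divr_ge0 ?sqr_ge0//.
by rewrite /w !J_comm//; exact: J_contract.
Qed.

Let JnB n (l : R) y z : 0 < l -> iter n (J l) (y - z) = iter n (J l) y - iter n (J l) z.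
Proof. by move=> l0; elim: n => // n IH /=; rewrite IH JB. Qed.

Let Jn_contract n (l : R) y : 0 < l -> nr (iter n (J l) y) <= nr y.
Proof. by move=> l0; elim: n => // n IH /=; apply: le_trans (J_contract _ l0) _. Qed.

Let Jn_dom n (l : R) x : 0 < l -> dom H x ->
  dom H (iter n (J l) x) /\ H (iter n (J l) x) = iter n (J l) (H x).
Proof.
move=> l0 Dx; elim: n => //= n [IH1 IH2]; split; first by have [] := JP (iter n (J l) x) l0.
by rewrite J_comm// IH2.
Qed.

Let Jn_near n (l : R) x : 0 < l -> dom H x ->
  nr (iter n (J l) x - x) <= n%:R * l * nr (H x).
Proof.
move=> l0 Dx; elim: n => [|n IH] /=; first by rewrite subrr nr0 !mul0r.
apply: le_trans (nr_triangle (J l x) _ _) _.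
rewrite -JB// -natr1 !mulrDl mul1r lerD ?J_near//.
exact: le_trans (J_contract _ l0) _.
Qed.

(** The local errors of [JJ] add up without amplification, because the resolvents are contractions
    and commute with [H]. *)
Let Jn_halve n (l : R) x : 0 < l -> D2 x ->
  nr (iter (n.*2) (J (l / 2)) x - iter n (J l) x) <= n%:R * (l ^+ 2 / 4) * nr (H (H x)).
Proof.
move=> l0 Dx; have l20 : 0 < l / 2 by rewrite divr_gt0.
elim: n x Dx => [|n IH] x Dx; first by rewrite /= subrr nr0 !mul0r.
rewrite doubleS !iterSr.
apply: le_trans (nr_triangle (iter n.*2 (J (l / 2)) (J l x)) _ _) _.
rewrite -JnB// -(natr1 n) mulrDl mulrDl mul1r addrC lerD//; last first.
  exact: le_trans (Jn_contract _ _ l20) (JJ l0 Dx).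
apply: le_trans (IH _ (J_D2 l0 Dx.1)) _.
rewrite ler_wpM2l//; first by rewrite mulr_ge0// divr_ge0// sqr_ge0.
by rewrite (J_comm l0 Dx.1) (J_comm l0 Dx.2) J_contract.
Qed.




(** Implicit Euler approximation with step [2^-k], the time [t] being rounded down to the grid. *)
Let Tk (t : R) (x : V) (k : nat) := iter (Num.truncn (t * 2 ^+ k)) (J (2^-1 ^+ k)) x.

Let h0 k : 0 < (2^-1 : R) ^+ k.
Proof. by rewrite exprn_gt0// invr_gt0. Qed.

Let h2 k : (2 : R) ^+ k * 2^-1 ^+ k = 1.
Proof. by rewrite -exprMn divff// expr1n. Qed.

Let truncn_le (t : R) k : 0 <= t -> (Num.truncn (t * 2 ^+ k))%:R * 2^-1 ^+ k <= t.
Proof.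
move=> t0; have /andP[H1 _] := truncn_itv (mulr_ge0 t0 (exprn_ge0 k (ler0n R 2))).
by have := ler_wpM2r (ltW (h0 k)) H1; rewrite -(mulrA t) h2 mulr1.
Qed.

Let truncn_gt (t : R) k : 0 <= t -> t < (Num.truncn (t * 2 ^+ k)).+1%:R * 2^-1 ^+ k.
Proof.
move=> t0; have /andP[_ H1] := truncn_itv (mulr_ge0 t0 (exprn_ge0 k (ler0n R 2))).
by have := H1; rewrite -(ltr_pM2r (h0 k)) -(mulrA t) h2 mulr1.
Qed.

Let Jn_step n m (l : R) x : 0 < l -> dom H x -> (n = m \/ n = m.+1) ->
  nr (iter n (J l) x - iter m (J l) x) <= l * nr (H x).
Proof.
move=> l0 Dx [->|->]; first by rewrite subrr nr0 mulr_ge0// ltW.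
rewrite iterSr -JnB//; apply: le_trans (Jn_contract _ _ l0) _.
exact: J_near.
Qed.

Let truncn_double (s : R) : 0 <= s ->
  Num.truncn (s * 2) = (Num.truncn s).*2 \/ Num.truncn (s * 2) = (Num.truncn s).*2.+1.
Proof.
move=> s0; have /andP[H1 H2] := truncn_itv s0.
have /andP[H3 H4] := truncn_itv (mulr_ge0 s0 (ler0n R 2)).
set n := Num.truncn s in H1 H2 *; set m := Num.truncn (s * 2) in H3 H4 *.
have E1 : (n.*2 < m.+1)%N by rewrite -(ltr_nat R) -muln2 natrM; lra.
have E2 : (m < n.+1.*2)%N by rewrite -(ltr_nat R) -muln2 natrM; lra.
lia.
Qed.

Let truncn_add (s t : R) : 0 <= s -> 0 <= t ->
  Num.truncn (s + t) = (Num.truncn s + Num.truncn t)%N \/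
  Num.truncn (s + t) = (Num.truncn s + Num.truncn t).+1.
Proof.
move=> s0 t0; have /andP[H1 H2] := truncn_itv s0; have /andP[H5 H6] := truncn_itv t0.
have /andP[H3 H4] := truncn_itv (addr_ge0 s0 t0).
set n := Num.truncn s in H1 H2 *; set p := Num.truncn t in H5 H6 *.
set m := Num.truncn (s + t) in H3 H4 *.
have E1 : (n + p < m.+1)%N by rewrite -(ltr_nat R) natrD; lra.
have E2 : (m < n.+1 + p.+1)%N by rewrite -(ltr_nat R) natrD; lra.
lia.
Qed.

(** With [l = 2^-k], halving the step costs at most [t l / 4] times [nr (H (H x))]. Rounding down at
    the finer level may add one step of length [l / 2], which costs at most [l / 2] times
    [nr (H x)]. *)
Let Tk_step (t : R) x k : 0 <= t -> D2 x ->
  nr (Tk t x k.+1 - Tk t x k) <= (t * nr (H (H x)) + nr (H x)) * 2^-1 ^+ k.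
Proof.
move=> t0 Dx; set n := Num.truncn (t * 2 ^+ k).
have E : (2^-1 : R) ^+ k.+1 = 2^-1 ^+ k / 2 by rewrite exprSr.
apply: le_trans (nr_triangle (iter n.*2 (J (2^-1 ^+ k.+1)) x) _ _) _.
have h1 : nr (Tk t x k.+1 - iter n.*2 (J (2^-1 ^+ k.+1)) x) <= 2^-1 ^+ k.+1 * nr (H x).
  apply: Jn_step => //; first exact: Dx.1.
  rewrite exprSr mulrA; apply: truncn_double.
  by rewrite mulr_ge0// exprn_ge0.
have := Jn_halve n (h0 k) Dx; rewrite -E -/(Tk t x k) => h3.
have := truncn_le k t0; rewrite -/n => h4.
apply: le_trans (lerD h1 h3) _.
rewrite E; have := h0 k; set l := 2^-1 ^+ k in h4 *; move=> l0.
have c0 : 0 <= l / 4 * nr (H (H x)) by rewrite mulr_ge0// divr_ge0// ltW.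
have := ler_wpM2r c0 h4.
have := mulr_ge0 (ltW l0) (nr_ge0 (H x)).
have := mulr_ge0 (mulr_ge0 t0 (ltW l0)) (nr_ge0 (H (H x))).
by lra.
Qed.


(** Resolvents map the domain into the domain of [H^2] and converge to the identity there as [l]
    decreases to 0. *)
Let dense2 y (e : R) : 0 < e -> exists2 x, D2 x & nr (y - x) < e.
Proof.
move=> e0; have [x Dx xy] := dense y (divr_gt0 e0 (ltr0n R 2)).
have n1 : 0 < nr (H x) + 1 by rewrite ltr_wpDl.
have [l l0 lE] : exists2 l, 0 < l & l * (nr (H x) + 1) = e / 2.
  exists (e / 2 / (nr (H x) + 1)); first by rewrite divr_gt0// divr_gt0.
  by rewrite mulfVK// gt_eqF.
exists (J l x); first exact: J_D2.
apply: le_lt_trans (nr_triangle x _ _) _.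
have := J_near l0 Dx; rewrite (nrB (J l x)) => H1.
lra.
Qed.

Let TkB (t : R) x y k : Tk t (x - y) k = Tk t x k - Tk t y k.
Proof. exact: JnB. Qed.

Let Tk_contract (t : R) x k : nr (Tk t x k) <= nr x.
Proof. exact: Jn_contract. Qed.

(** The approximations are Cauchy on the domain of [H^2] by [Tk_step], and everywhere by density and
    uniform contractivity. *)
Let Tk_cvg (t : R) x : 0 <= t -> exists l : V, Tk t x k @[k --> \oo] --> l.
Proof.
move=> t0; apply: complete => e e0.
have [z Dz zx] := dense2 x (divr_gt0 e0 (ltr0n R 4)).
pose C := t * nr (H (H z)) + nr (H z) + 1.
have C0 : 0 < C by rewrite ltr_wpDl// addr_ge0// mulr_ge0.
have [N HN] := half_powP (divr_gt0 (divr_gt0 e0 (ltr0n R 8)) C0).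
have fast k : nr (Tk t z k.+1 - Tk t z k) <= C * 2^-1 ^+ k.
  apply: le_trans (Tk_step k t0 Dz) _.
  by rewrite ler_wpM2r ?(ltW (h0 k))// /C lerDl.
have main n : (N <= n)%N -> nr (Tk t x n - Tk t z N) < e / 2.
  move=> Nn; apply: le_lt_trans (nr_triangle (Tk t z n) _ _) _.
  have := fast_cauchy fast N (n - N); rewrite subnKC// -TkB.
  have := Tk_contract t (x - z) n; have := HN N (leqnn N).
  rewrite ltr_pdivlMr//; have := mulr_ge0 (ltW C0) (ltW (h0 n)).
  move: zx; lra.
exists N => m n /main H1 /main H2.
have := nr_triangle (Tk t z N) (Tk t x m) (Tk t x n).
by rewrite (nrB (Tk t z N)); lra.
Qed.

Let T (t : R) x : V := xget 0 [set l : V | Tk t x k @[k --> \oo] --> l].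

Let TP (t : R) x : 0 <= t -> Tk t x k @[k --> \oo] --> T t x.
Proof.
move=> t0; rewrite /T; case: xgetP => [y _ //|].
by have [l xl] := Tk_cvg x t0 => /(_ l) /(_ xl).
Qed.

Let T_contract (t : R) x : 0 <= t -> nr (T t x) <= nr x.
Proof.
move=> t0; rewrite -(subr0 (T t x)); apply: (@cvg_nr_le _ _ _ _ (@TP _ x t0)) => k.
by rewrite subr0 Tk_contract.
Qed.

Let Jn_linear n (l : R) : 0 < l -> linear (iter n (J l)).
Proof. by move=> l0 a x y; elim: n => //= n ->; rewrite J_linear. Qed.

Let T_linear (t : R) : 0 <= t -> linear (T t).
Proof.
move=> t0 a x y; apply: (cvg_nr_unique (@TP _ _ t0)).
have -> : Tk t (a *: x + y) = fun k => a *: Tk t x k + Tk t y k.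
  by apply/funext => k; rewrite /Tk Jn_linear.
by apply: cvgD; [apply: cvgZr|]; exact: TP.
Qed.

Let TB (t : R) x y : 0 <= t -> T t (x - y) = T t x - T t y.
Proof. by move=> t0; rewrite addrC -scaleN1r T_linear// scaleN1r addrC. Qed.

Let T_near (t : R) x : 0 <= t -> dom H x -> nr (T t x - x) <= t * nr (H x).
Proof.
move=> t0 Dx; apply: (@cvg_nr_le _ _ _ _ (@TP _ x t0)) => k.
apply: le_trans (Jn_near _ (h0 k) Dx) _.
by rewrite ler_wpM2r// truncn_le.
Qed.

Let T0 x : T 0 x = x.
Proof.
apply: (cvg_nr_unique (@TP _ x (lexx 0))).
have -> : Tk 0 x = fun=> x by apply/funext => k; rewrite /Tk mul0r truncn0.
exact: cvg_cst.
Qed.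

(** Rounding [s], [t] and [s + t] separately may lose one Euler step; on the domain a step moves a
    vector by at most [2^-n * nr (H x)], which disappears in the limit. *)
Let T_add_dom (s t : R) x : 0 <= s -> 0 <= t -> dom H x -> T (s + t) x = T s (T t x).
Proof.
move=> s0 t0 Dx; apply: (cvg_nr_unique (@TP _ x (addr_ge0 s0 t0))).
apply/cvg_seqP => e e0.
have e3 : 0 < e / 3 by rewrite divr_gt0.
have n1 : 0 < nr (H x) + 1 by rewrite ltr_wpDl.
have [N1 HN1] := half_powP (divr_gt0 e3 n1).
have /cvg_seqP/(_ _ e3)[N2 HN2] := @TP _ (T t x) s0.
have /cvg_seqP/(_ _ e3)[N3 HN3] := @TP _ x t0.
exists (maxn N1 (maxn N2 N3)) => n; rewrite !geq_max => /and3P[/HN1 h1 /HN2 h2' /HN3 h3].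
apply: le_lt_trans (nr_triangle (Tk s (T t x) n) _ _) _.
have : nr (Tk s (T t x) n - Tk s (Tk t x n) n) < e / 3.
  by rewrite -TkB (le_lt_trans (Tk_contract _ _ _)).
have : nr (Tk s (Tk t x n) n - Tk (s + t) x n) < e / 3.
  rewrite nrB /Tk -iterD; apply: le_lt_trans (Jn_step (h0 n) Dx _) _.
    by rewrite mulrDl; apply: truncn_add; rewrite mulr_ge0// exprn_ge0.
  move: h1; rewrite ltr_pdivlMr//; have := h0 n; lra.
have := nr_triangle (Tk s (Tk t x n) n) (Tk s (T t x) n) (Tk (s + t) x n).
lra.
Qed.

Let T_add (s t : R) x : 0 <= s -> 0 <= t -> T (s + t) x = T s (T t x).
Proof.
move=> s0 t0; apply/eqP; rewrite -subr_eq0; apply/eqP/nr_eq0/eqP.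
rewrite eq_le nr_ge0 andbT; apply/ler_addgt0Pl => e e0; rewrite addr0.
have [z Dz zx] := dense x (divr_gt0 e0 (ltr0n R 2)).
apply: le_trans (nr_triangle (T (s + t) z) _ _) _.
rewrite -TB ?addr_ge0//.
have := T_contract (x - z) (addr_ge0 s0 t0).
rewrite (T_add_dom s0 t0 Dz) -!TB//.
have := T_contract (T t (z - x)) s0; have := T_contract (z - x) t0.
rewrite (nrB z x); lra.
Qed.

Let T_cvg0 x (e : R) : 0 < e -> exists2 d, 0 < d &
  forall t, 0 < t -> t < d -> nr (T t x - x) < e.
Proof.
move=> e0; have [z Dz zx] := dense x (divr_gt0 e0 (ltr0n R 3)).
have n1 : 0 < nr (H z) + 1 by rewrite ltr_wpDl.
exists (e / 3 / (nr (H z) + 1)) => [|t t0]; first by rewrite !divr_gt0.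
rewrite ltr_pdivlMr// => td.
have := T_contract (x - z) (ltW t0); have := T_near (ltW t0) Dz; rewrite (TB _ _ (ltW t0)).
have := nr_triangle (T t z) (T t x) x; have := nr_triangle z (T t z) x.
rewrite (nrB z x); lra.
Qed.

(** [iter n (J l) x - x] is the sum of [l * iter j (J l) (H x)] over [1 <= j <= n], so its distance
    to [n l H x] is governed by how far the iterates move [H x]. *)
Let Jn_gen n (l : R) x w : 0 < l -> dom H x ->
  (forall j, (j <= n)%N -> nr (iter j (J l) (H x) - H x) <= w) ->
  nr (iter n (J l) x - x - (n%:R * l)%:C *: H x) <= n%:R * l * w.
Proof.
move=> l0 Dx; elim: n => [|n IH] jw.
  by rewrite /= subrr sub0r nrN mul0r mul0r scale0r nr0.
have E : iter n.+1 (J l) x - x - (n.+1%:R * l)%:C *: H x =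
    (iter n (J l) x - x - (n%:R * l)%:C *: H x) +
    l%:C *: (iter n.+1 (J l) (H x) - H x).
  have [D1 H1] := Jn_dom n.+1 l0 Dx; rewrite -H1.
  have E1 : iter n (J l) x = iter n.+1 (J l) x - l%:C *: H (iter n.+1 (J l) x).
    by rewrite iterS (JP _ l0).2.
  rewrite {1}E1 -(natr1 n) mulrDl mul1r rmorphD scalerDl scalerBr.
  rewrite opprD !addrA; congr (_ - _).
  by rewrite [RHS]addrAC; congr (_ - _); rewrite [RHS]addrAC subrK.
rewrite E; apply: le_trans (nrD _ _) _.
rewrite -(natr1 n) !mulrDl mul1r lerD//; first by apply: IH => j jn; apply: jw; exact: leqW.
by rewrite nrZ gtr0_norm// ler_pM2l// jw.
Qed.

(** [H x] need not lie in the domain, so the motion of its iterates is controlled through an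
    approximating [z] that does. *)
Let T_gen (t : R) x z : 0 <= t -> dom H x -> dom H z ->
  nr (T t x - x - t%:C *: H x) <= t * (2 * nr (H x - z) + t * nr (H z)).
Proof.
move=> t0 Dx Dz; apply/ler_addgt0Pl => e e0.
have e2 : 0 < e / 2 by rewrite divr_gt0.
have n1 : 0 < nr (H x) + 1 by rewrite ltr_wpDl.
have [N1 HN1] := half_powP (divr_gt0 e2 n1).
have /cvg_seqP/(_ _ e2)[N2 HN2] := @TP _ x t0.
set k := maxn N1 N2; pose l := 2^-1 ^+ k : R; pose n := Num.truncn (t * 2 ^+ k).
have l0 : 0 < l by exact: h0.
have nt := truncn_le k t0; rewrite -/n -/l in nt.
have tn := truncn_gt k t0; rewrite -/n -/l in tn.
have H1 : nr (Tk t x k - x - (n%:R * l)%:C *: H x) <=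
    n%:R * l * (2 * nr (H x - z) + t * nr (H z)).
  apply: Jn_gen => // j jn.
  have := nr_triangle (iter j (J l) z) (iter j (J l) (H x)) (H x).
  have := nr_triangle z (iter j (J l) z) (H x).
  rewrite -JnB//; have := Jn_contract j (H x - z) (h0 k); rewrite -/l.
  have := Jn_near j (h0 k) Dz; rewrite -/l (nrB z (H x)).
  have : j%:R * l * nr (H z) <= t * nr (H z).
    rewrite ler_wpM2r//; apply: le_trans nt.
    by rewrite ler_wpM2r ?ler_nat// ltW//; exact: h0.
  lra.
have := HN2 k (leq_maxr _ _); have := HN1 k (leq_maxl _ _); rewrite -/l.
rewrite ltr_pdivlMr// => H2 H3.
have -> : T t x - x - t%:C *: H x = (T t x - Tk t x k) +
    ((Tk t x k - x - (n%:R * l)%:C *: H x) - (t - n%:R * l)%:C *: H x).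
  by rewrite rmorphB scalerBl opprB [X in _ = _ + X]addrA subrK !addrA subrK.
apply: le_trans (nrD _ _) _.
have := nrD (Tk t x k - x - (n%:R * l)%:C *: H x) (- ((t - n%:R * l)%:C *: H x)).
rewrite nrN nrZ ger0_norm ?subr_ge0//.
have : (t - n%:R * l) * nr (H x) <= l * nr (H x).
  by rewrite ler_wpM2r//; move: tn; rewrite -(natr1 n) mulrDl; lra.
have : n%:R * l * (2 * nr (H x - z) + t * nr (H z)) <=
    t * (2 * nr (H x - z) + t * nr (H z)).
  by rewrite ler_wpM2r// addr_ge0// mulr_ge0.
have := h0 k; rewrite -/l.
lra.
Qed.

Theorem generation : generates_contraction_semigroup H.
Proof.
have genH x : dom H x -> forall e : R, 0 < e -> exists2 d, 0 < d &
    forall t, 0 < t -> t < d -> nr (T t x - x - t%:C *: H x) < e * t.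
  move=> Dx e e0; have [z Dz zx] := dense (H x) (divr_gt0 e0 (ltr0n R 4)).
  have n1 : 0 < nr (H z) + 1 by rewrite ltr_wpDl.
  exists (e / 2 / (nr (H z) + 1)) => [|t t0]; first by rewrite !divr_gt0.
  rewrite ltr_pdivlMr// => td.
  apply: le_lt_trans (T_gen (ltW t0) Dx Dz) _.
  by rewrite mulrC ltr_pM2r//; lra.
exists T; split.
- split=> //.
  + move=> t t0 x; apply/cvg_nrP => e e0.
    have /cvg_nrP/(_ e e0) : (y : V) @[y --> x] --> x by exact: cvg_id.
    apply: filterS => y; rewrite -TB//; exact: le_lt_trans (T_contract _ t0).
  + by move=> s t s0 t0 x; exact: T_add.
  + move=> x; apply/cvg_nrP => e e0; apply/nbhs_right0_dltP.
    by have [d d0 dP] := T_cvg0 x e0; exists d => // t t0 td; rewrite nrB dP.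
- by move=> t t0 x; rewrite !nr_norm lecR T_contract.
- move=> x y; rewrite generator_limP; split=> [[Dx <-]|xy]; first exact: genH.
  (* If the difference quotients at [x] tend to [y], those at [x - z] tend to [y - H z = x - z]. The
     orbit of [x - z] would grow like [1 + t] to first order, against contractivity, unless
     [x = z]. *)
  have [z Dz zE] := surj ltr01 (x - y); rewrite scale1r in zE.
  have zx : x = z.
    apply/eqP; rewrite -subr_eq0; apply/eqP/nr_eq0/eqP; rewrite eq_le nr_ge0 andbT.
    apply/ler_addgt0Pl => e e0; rewrite addr0.
    have e2 : 0 < e / 2 by rewrite divr_gt0.
    have [d1 d10 H1] := xy _ e2; have [d2 d20 H2] := genH z Dz _ e2.
    pose t := Num.min d1 d2 / 2.
    have m0 : 0 < Num.min d1 d2 by rewrite lt_min d10.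
    have t0 : 0 < t by rewrite divr_gt0.
    have td1 : t < d1 by rewrite /t; have := ge_min d1 d1 d2; rewrite lexx/=; lra.
    have td2 : t < d2 by rewrite /t; have := ge_min d2 d1 d2; rewrite lexx orbT/=; lra.
    have := H1 t t0 td1; have := H2 t t0 td2 => h2' h1.
    have E : (1 + t)%:C *: (x - z) = T t (x - z) -
        ((T t x - x - t%:C *: y) - (T t z - z - t%:C *: H z)).
      have E4 (a b p q : V) : a - b - ((a - p) - (b - q)) = p - q.
        by rewrite opprB addrA [a - b + _]addrA subrK opprB addrC addrA subrK.
      have -> : y = x - z + H z.
        by rewrite -[LHS](subKr x) -zE opprB addrA addrAC.
      rewrite TB ?ltW// -[T t x - x - _]addrA -[T t z - z - _]addrA -!opprD E4.
      rewrite (scalerDr _ (x - z)) rmorphD rmorph1 scalerDl scale1r opprD !addrA.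
      by rewrite [RHS]addrAC addrK [RHS]addrAC.
    have := nrD (T t (x - z))
      (- ((T t x - x - t%:C *: y) - (T t z - z - t%:C *: H z))).
    rewrite -E nrZ nrN gtr0_norm ?addr_gt0//.
    have := T_contract (x - z) (ltW t0).
    have := nrD (T t x - x - t%:C *: y) (- (T t z - z - t%:C *: H z)).
    rewrite nrN => h3 h4 h5.
    have : t * nr (x - z) <= t * e by lra.
    by rewrite ler_pM2l.
  by rewrite zx; split=> //; rewrite zx in zE; apply: oppr_inj; apply: (addrI z).
Qed.

End Generation.

(** Dissipativity and the closed graph make the range of [1 - l H] closed, and the trivial
    complement makes it dense. Density of the domain is then a consequence of surjectivity and
    dissipativity. *)
Theorem generation_perp
  (complete : forall s : nat -> V,
  (forall e : R, 0 < e -> exists N, forall m n, (N <= m)%N -> (N <= n)%N ->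
     nr (s m - s n) < e) -> exists l : V, s k @[k --> \oo] --> l)
  (H : operator V)
  (diss : forall x, dom H x -> dot (H x) x <= 0)
  (closed_graph : forall (s : nat -> V) (x w : V), (forall k, dom H (s k)) ->
     s k @[k --> \oo] --> x -> H (s k) @[k --> \oo] --> w -> dom H x /\ H x = w)
  (perp : forall l : R, 0 < l -> forall y,
     (forall x, dom H x -> dot (l%:C *: x - H x) y = 0) -> y = 0) :
  generates_contraction_semigroup H.
Proof.
have surj (l : R) : 0 < l -> forall y, exists2 x, dom H x & x - l%:C *: H x = y.
  move=> l0 y; pose D := [set x - l%:C *: H x | x in dom H].
  have lC : l%:C != 0 by rewrite fmorph_eq0 gt_eqF.
  have D0 : D 0 by exists 0; [exact: dom0|rewrite op_zero scaler0 subrr].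
  have Dl (s : R) x z : D x -> D z -> D (s%:C *: x + z).
    move=> [x' Dx <-] [z' Dz <-]; exists (s%:C *: x' + z'); first exact: dom_linear.
    rewrite op_linear// scalerDr opprD addrACA; congr (_ + _).
    by rewrite scalerA mulrC -scalerA scalerBr.
  have Dp z : (forall x, D x -> dot x z = 0) -> z = 0.
    move=> zD; apply: (perp l^-1); rewrite ?invr_gt0// => x Dx.
    have -> : (l^-1)%:C *: x - H x = (l^-1)%:C *: (x - l%:C *: H x).
      by rewrite scalerBr scalerA -rmorphM /= mulVf ?gt_eqF// scale1r.
    by rewrite dotZl zD ?mulr0//; exists x.
  have /choice[s sP] (k : nat) : exists x, dom H x /\
      nr (y - (x - l%:C *: H x)) < 2^-1 ^+ k.
    have p0 : 0 < (2^-1 : R) ^+ k by rewrite exprn_gt0// invr_gt0.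
    by have [_ [x Dx <-] xy] := dense_orth complete D0 Dl Dp y p0; exists x.
  have [|x sx] := @complete s.
    move=> e e0; have [N HN] := half_powP (divr_gt0 e0 (ltr0n R 2)).
    exists N => m n Nm Nn.
    have [Dm Hm] := sP m; have [Dn Hn] := sP n.
    apply: le_lt_trans (resolvent_lower_bound diss (ltW l0) (dom_sub Dm Dn)) _.
    rewrite op_sub// scalerBr.
    have -> : s m - s n - (l%:C *: H (s m) - l%:C *: H (s n)) =
        (s m - l%:C *: H (s m)) - (s n - l%:C *: H (s n)).
      by rewrite !opprD !opprK addrACA.
    apply: le_lt_trans (nr_triangle y _ _) _; rewrite (nrB _ y).
    by have := HN m Nm; have := HN n Nn; lra.
  have sy : s k - l%:C *: H (s k) @[k --> \oo] --> (y : V).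
    apply/cvg_seqP => e e0; have [N HN] := half_powP e0.
    by exists N => n /HN; have [_] := sP n; lra.
  have [|||Dx Hx] := closed_graph s x ((l^-1)%:C *: (x - y)) => //.
  - by move=> k; have [] := sP k.
  - have -> : (fun k => H (s k)) =
        fun k => (l^-1)%:C *: (s k - (s k - l%:C *: H (s k))).
      apply/funext => k; rewrite opprB addrC subrK scalerA -rmorphM /= mulVf ?gt_eqF//.
      by rewrite scale1r.
    by apply: cvgZr; apply: cvgB.
  - exists x => //; rewrite Hx scalerA -rmorphM /= mulfV ?gt_eqF// scale1r.
    by rewrite opprB addrC subrK.
apply: generation => //; apply: dense_orth => //; first exact: dom0.
  by move=> s x y; exact: dom_linear.
(* For [y] orthogonal to the domain and [x - H x = y], one gets
   [0 = <x, y> = |x|^2 - <x, H x> >= |x|^2]. *)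
move=> y yD; have [x Dx xy] := surj 1 ltr01 y; rewrite scale1r in xy.
have := diss x Dx; have := yD x Dx; rewrite -xy dotDr dotNr (dotC x (H x)) -nr_sqr.
move=> h1 h2; have : nr x ^+ 2 = 0.
  by apply/eqP; rewrite eq_le sqr_ge0 andbT; lra.
move/eqP; rewrite sqrf_eq0 => /eqP/nr_eq0 ->.
by rewrite op_zero subr0.
Qed.

(** * Dissipativity and maximality of generators of contractions *)

Section Generator.
Context (complete : forall s : nat -> V,
  (forall e : R, 0 < e -> exists N, forall m n, (N <= m)%N -> (N <= n)%N ->
     nr (s m - s n) < e) -> exists l : V, s k @[k --> \oo] --> l).
Context (H : operator V) (genH : generates_contraction_semigroup H).

(** The inequality [<T t x, x> <= |x|^2] is an equality at [t = 0], so it can be differentiated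
    there. *)
Lemma generator_dissipative x : dom H x -> dot (H x) x <= 0.
Proof.
have [T [TC Tc TH]] := genH => Dx.
apply/ler_addgt0Pl => e e0; rewrite addr0.
have n1 : 0 < nr x + 1 by rewrite ltr_wpDl.
have /generator_limP/(_ _ (divr_gt0 e0 n1))[d d0 dP] := (TH x (H x)).1 (conj Dx erefl).
pose t := d / 2; have t0 : 0 < t by rewrite divr_gt0.
have /(dP t t0) : t < d by rewrite /t; lra.
rewrite mulrAC ltr_pdivlMr// => h1.
have := dot_CS (- (T t x - x - t%:C *: H x)) x; rewrite nrN.
have := dot_CS (T t x) x.
have : nr (T t x) <= nr x by rewrite -lecR -!nr_norm; apply: Tc; exact: ltW.
rewrite !(dotNl, dotDl, dotZl) -nr_sqr => h2 h3 h4.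
have h5 := ler_wpM2r (nr_ge0 x) h2.
rewrite -(ler_pM2l t0).
have := nr_ge0 (T t x - x - t%:C *: H x); lra.
Qed.

Context (H_dense : forall y, (forall x, dom H x -> dot x y = 0) -> y = 0).

(* On the orbit of x in the domain, theta t := dot y (T t x) satisfies
   theta (t + s) = (1 + s) theta t + o(s) uniformly in t when y is orthogonal to
   the range of 1 - H, so a nonzero theta 0 would make the bounded function theta
   grow without bound. *)
Lemma generator_range_perp y :
  (forall x, dom H x -> dot (x - H x) y = 0) -> y = 0.
Proof.
have [T [TC Tc TH]] := genH => yP; apply: H_dense => x Dx.
have Tn t z : 0 <= t -> nr (T t z) <= nr z.
  by move=> t0; rewrite -lecR -!nr_norm; exact: Tc.
have TB t z1 z2 : 0 <= t -> T t (z1 - z2) = T t z1 - T t z2.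
  by move=> t0; rewrite addrC -scaleN1r (C0_linear TC t0) scaleN1r addrC.
have TZ t a z : 0 <= t -> T t (a *: z) = a *: T t z.
  move=> t0; have T00 : T t 0 = 0 by rewrite -[in LHS](subrr z) TB// subrr.
  by rewrite -[in LHS](addr0 (_ *: z)) (C0_linear TC t0) T00 addr0.
have TgenE t s : 0 <= t -> 0 < s ->
    T s (T t x) - T t x - s%:C *: T t (H x) = T t (T s x - x - s%:C *: H x).
  by move=> t0 s0; rewrite !TB// TZ// -(C0_comp TC (ltW s0) t0) -(C0_comp TC t0 (ltW s0)) (addrC s).
have TD t : 0 <= t -> dom H (T t x) /\ H (T t x) = T t (H x).
  move=> t0; apply/TH/generator_limP => e e0.
  have /generator_limP/(_ _ e0)[d d0 dP] := (TH x (H x)).1 (conj Dx erefl).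
  exists d => // s s0 sd; rewrite TgenE//.
  exact: le_lt_trans (Tn _ _ t0) (dP s s0 sd).
apply/eqP; apply/negPn/negP => th0.
pose th t := dot (T t x) y.
pose a := `|dot x y|; have a0 : 0 < a by rewrite normr_gt0.
have n1 : 0 < nr y + 1 by rewrite ltr_wpDl.
have e0 : 0 < a / 2 / (nr y + 1) by rewrite !divr_gt0.
have /generator_limP/(_ _ e0)[d d0 dP] := (TH x (H x)).1 (conj Dx erefl).
pose s := d / 2; have s0 : 0 < s by rewrite divr_gt0.
have sd : s < d by rewrite /s; lra.
have step t : 0 <= t -> `|th (s + t) - (1 + s) * th t| <= s * (a / 2).
  move=> t0; have [D1 D2] := TD t t0.
  have -> : th (s + t) - (1 + s) * th t = dot (T t (T s x - x - s%:C *: H x)) y.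
    rewrite -TgenE// !(dotDl, dotNl, dotZl) /th (C0_comp TC (ltW s0) t0).
    have := yP _ D1; rewrite dotDl dotNl D2 => h; rewrite -D2.
    have -> : dot (H (T t x)) y = dot (T t x) y by rewrite D2; lra.
    by lra.
  have h1 : nr (T t (T s x - x - s%:C *: H x)) * (nr y + 1) <= s * (a / 2).
    have := Tn t (T s x - x - s%:C *: H x) t0; have := dP s s0 sd.
    move: (nr (T t _)) (nr (T s x - _ - _)) => p q.
    rewrite mulrAC ltr_pdivlMr// => h1 h2.
    have := ler_wpM2r (ltW n1) h2; lra.
  have := dot_CS (T t (T s x - x - s%:C *: H x)) y.
  have := dot_CS (- T t (T s x - x - s%:C *: H x)) y.
  rewrite nrN dotNl; have := nr_ge0 (T t (T s x - x - s%:C *: H x)).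
  by rewrite ler_norml; lra.
(* One step multiplies [|th|] by [1 + s] up to an error [s a / 2]. As long as [|th| >= a], the gain
   is at least [s a / 2]; linear growth already contradicts boundedness. *)
have grow n : a + n%:R * (s * (a / 2)) <= `|th (n%:R * s)|.
  elim: n => [|n IH].
    by rewrite !mul0r /th (C0_id TC) addr0.
  have ns : 0 <= n%:R * s by rewrite mulr_ge0// ltW.
  have := step _ ns; rewrite -(natr1 n) [(_ + 1) * s]mulrDl mul1r (addrC s).
  have := ler_dist_dist (th (n%:R * s + s)) ((1 + s) * th (n%:R * s)).
  rewrite normrM ger0_norm ?addr_ge0 ?ler01 ?(ltW s0)// ler_norml => /andP[h1 h2] h3.
  have h4 : s * a <= s * `|th (n%:R * s)|.
    rewrite ler_pM2l//; apply: le_trans IH.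
    by rewrite lerDl mulr_ge0// mulr_ge0 ?(ltW s0)// divr_ge0// ltW.
  by move: IH; lra.
have bound n : `|th (n%:R * s)| <= nr x * nr y.
  have ns : 0 <= n%:R * s by rewrite mulr_ge0// ltW.
  have h1 := dot_CS (T (n%:R * s) x) y; have h2 := dot_CS (- T (n%:R * s) x) y.
  rewrite nrN dotNl in h2.
  have h3 := ler_wpM2r (nr_ge0 y) (Tn _ x ns).
  by rewrite ler_norml /th; lra.
have sa : 0 < s * (a / 2) by rewrite mulr_gt0// divr_gt0.
have := le_trans (grow (Num.truncn (nr x * nr y / (s * (a / 2)))).+1) (bound _).
have := truncnS_gt (nr x * nr y / (s * (a / 2))).
rewrite ltr_pdivrMr//; lra.
Qed.

(** When [z - H z] approximates [x - w], the sign hypothesis forces both [z] towards [x] and [H z]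
    towards [w]. It remains that generators are closed, which holds because the o(t) estimate at [z]
    depends only on the orbit of [H z]. *)
Lemma generator_maximal x w :
  (forall z, dom H z -> dot (w - H z) (x - z) <= 0) -> dom H x /\ H x = w.
Proof.
have [T [TC Tc TH]] := genH => maxH.
pose D := [set z - H z | z in dom H].
have D0 : D 0 by exists 0; [exact: dom0|rewrite op_zero subrr].
have Dl (s : R) u v : D u -> D v -> D (s%:C *: u + v).
  move=> [x' Dx <-] [z' Dz <-]; exists (s%:C *: x' + z'); first exact: dom_linear.
  by rewrite op_linear// opprD addrACA scalerBr.
have Dp z : (forall u, D u -> dot u z = 0) -> z = 0.
  by move=> zD; apply: generator_range_perp => u Du; apply: zD; exists u.
have approx (e : R) : 0 < e -> exists z, [/\ dom H z, nr (x - z) < e & nr (w - H z) < e].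
  move=> e0; have [_ [z Dz <-] zP] := dense_orth complete D0 Dl Dp (x - w) (divr_gt0 e0 (ltr0n R 2)).
  have E : x - w - (z - H z) = (x - z) - (w - H z).
    by rewrite !opprD !opprK addrACA.
  (* In [|(x - z) - (w - H z)|^2] the cross term [- 2 <w - H z, x - z>] is nonnegative by
     hypothesis. *)
  have h1 : nr (x - z) <= nr (x - w - (z - H z)).
    rewrite -ler_sqr ?nnegrE ?nr_ge0// !nr_sqr E.
    have := maxH z Dz; have := dot_ge0 (w - H z).
    move: (x - z) (w - H z) => p q.
    rewrite !(dotDl, dotDr, dotNl, dotNr) (dotC p q); lra.
  exists z; split=> //; first by lra.
  have -> : w - H z = (x - z) - (x - w - (z - H z)) by rewrite E opprB [RHS]addrC subrK.
  by apply: le_lt_trans (nrD _ _) _; rewrite nrN; lra.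
have Tn t z : 0 <= t -> nr (T t z) <= nr z.
  by move=> t0; rewrite -lecR -!nr_norm; exact: Tc.
have TB t z1 z2 : 0 <= t -> T t (z1 - z2) = T t z1 - T t z2.
  by move=> t0; rewrite addrC -scaleN1r (C0_linear TC t0) scaleN1r addrC.
have TZ t a z : 0 <= t -> T t (a *: z) = a *: T t z.
  move=> t0; have T00 : T t 0 = 0 by rewrite -[in LHS](subrr z) TB// subrr.
  by rewrite -[in LHS](addr0 (_ *: z)) (C0_linear TC t0) T00 addr0.
(* T t z - z - t H z is t times an average of T s (H z) - H z over s <= t *)
have mean z (t c : R) : dom H z -> 0 < t ->
    (forall s, 0 <= s -> s <= t -> nr (T s (H z) - H z) <= c) ->
    nr (T t z - z - t%:C *: H z) <= t * c.
  move=> Dz t0 sc; apply/ler_addgt0Pl => e e0.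
  have /generator_limP/(_ _ (divr_gt0 e0 t0))[d d0 dP] := (TH z (H z)).1 (conj Dz erefl).
  pose n := (Num.truncn (t / d)).+1; pose s := t / n%:R.
  have n0 : 0 < n%:R :> R by rewrite ltr0n.
  have s0 : 0 < s by rewrite divr_gt0.
  have sd : s < d.
    by rewrite ltr_pdivrMr// mulrC -ltr_pdivrMr// truncnS_gt.
  have st : n%:R * s = t by rewrite mulrC divfK// gt_eqF.
  have ind m : (m <= n)%N ->
      nr (T (m%:R * s) z - z - (m%:R * s)%:C *: H z) <= m%:R * s * (e / t + c).
    elim: m => [|m IH] mn.
      by rewrite !mul0r (C0_id TC) subrr sub0r nrN scale0r nr0.
    have ms : 0 <= m%:R * s by rewrite mulr_ge0// ltW.
    have mt : m%:R * s <= t.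
      by rewrite -st ler_pM2r// ler_nat; exact: ltnW.
    have -> : T (m.+1%:R * s) z - z - (m.+1%:R * s)%:C *: H z =
        T (m%:R * s) (T s z - z - s%:C *: H z) +
        ((T (m%:R * s) z - z - (m%:R * s)%:C *: H z) +
         s%:C *: (T (m%:R * s) (H z) - H z)).
      rewrite -(natr1 m) mulrDl mul1r (C0_comp TC ms (ltW s0)) !TB// TZ//.
      rewrite rmorphD scalerDl scalerBr opprD.
      move: (T (m%:R * s) (T s z)) (T (m%:R * s) z) ((m%:R * s)%:C *: H z) => p q v.
      rewrite [RHS]addrACA addKr -[q - z - _]addrA [in RHS](addrA (p - q)) subrK.
      by rewrite !addrA.
    have := nrD (T (m%:R * s) (T s z - z - s%:C *: H z))
      ((T (m%:R * s) z - z - (m%:R * s)%:C *: H z) +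
         s%:C *: (T (m%:R * s) (H z) - H z)).
    have := nrD (T (m%:R * s) z - z - (m%:R * s)%:C *: H z)
         (s%:C *: (T (m%:R * s) (H z) - H z)).
    have := dP s s0 sd; have := Tn _ (T s z - z - s%:C *: H z) ms.
    rewrite nrZ gtr0_norm//; have := sc _ ms mt.
    rewrite -(ler_pM2l s0); have := IH (ltnW mn); rewrite -(natr1 m) mulrDl mul1r.
    lra.
  have := ind n (leqnn n); rewrite st => h.
  by apply: le_trans h _; rewrite mulrDr mulrCA mulfV ?gt_eqF// mulr1 addrC.
apply/TH/generator_limP => e e0.
have /cvg_nrP/(_ _ (divr_gt0 e0 (ltr0n R 2)))/nbhs_right0_dltP[d d0 dP] := @C0_cvg _ _ _ TC w.
exists d => // t t0 td.
(* Since [t] is fixed, [z] may depend on it. The errors [T t (x - z)] and [x - z] count [2 eta], the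
   term [t (w - H z)] counts [t eta], and the orbit of [H z] counts [2 t eta]. *)
pose eta := e * t / 4 / (2 + 3 * t).
have t1 : 0 < 2 + 3 * t by lra.
have eta0 : 0 < eta by rewrite !divr_gt0// mulr_gt0.
have etaE : eta * (2 + 3 * t) = e * t / 4 by rewrite divfK// gt_eqF.
have [z [Dz zx zw]] := approx _ eta0.
clearbody eta.
have h0 s : 0 <= s -> s <= t -> nr (T s (H z) - H z) <= e / 2 + 2 * eta.
  move=> s0 st.
  have h1 : nr (T s w - w) <= e / 2.
    move: s0; rewrite le_eqVlt => /predU1P[<-|s0].
      by rewrite (C0_id TC) subrr nr0 divr_ge0// ltW.
    by rewrite nrB ltW// dP//; exact: le_lt_trans td.
  have := Tn s (H z - w) s0; rewrite TB// (nrB (H z) w).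
  have := nr_triangle (T s w) (T s (H z)) (H z); have := nr_triangle w (T s w) (H z).
  lra.
have h1 := mean z t _ Dz t0 h0; have := Tn t (x - z) (ltW t0).
have E : T t x - x - t%:C *: w = T t (x - z) + ((T t z - z - t%:C *: H z) -
    ((x - z) + t%:C *: (w - H z))).
  rewrite TB ?(ltW t0)// scalerBr.
  move: (T t x) (T t z) (t%:C *: w) (t%:C *: H z) => p q u v.
  have -> : q - z - v = q - (z + v) by rewrite opprD addrA.
  have -> : (x - z) + (u - v) = (x + u) - (z + v) by rewrite opprD addrACA.
  by rewrite opprB [X in _ = _ + X]addrA subrK [RHS]addrA subrK opprD addrA.
have := nrD (T t (x - z)) ((T t z - z - t%:C *: H z) - ((x - z) + t%:C *: (w - H z))).
have := nrD (T t z - z - t%:C *: H z) (- ((x - z) + t%:C *: (w - H z))).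
have := nrD (x - z) (t%:C *: (w - H z)).
rewrite -E nrN nrZ gtr0_norm//.
have h2 : t * nr (w - H z) <= t * eta by rewrite ler_pM2l// ltW.
have := mulr_gt0 t0 e0.
lra.
Qed.

End Generator.
End InnerProduct.

(** * The energy space *)

Section Forms.
Context {R : realType}.
Local Notation C := R[i].

Definition rform d (W : 'M[C]_d) (x y : 'cV[C]_d) : R := Re (sform W x y).

Lemma qformE d (W : 'M[C]_d) x : qform W x = rform W x x. Proof. by []. Qed.

Lemma rformC d (W : 'M[C]_d) x y : W ^t* = W -> rform W x y = rform W y x.
Proof. by move=> WH; rewrite /rform (sform_conj y x WH) Re_conj. Qed.

Lemma rformDl d (W : 'M[C]_d) x y z : rform W (x + y) z = rform W x z + rform W y z.
Proof. by rewrite /rform sformDl ReD. Qed.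

Lemma rformDr d (W : 'M[C]_d) x y z : rform W x (y + z) = rform W x y + rform W x z.
Proof. by rewrite /rform sformDr ReD. Qed.

Lemma rformZl d (W : 'M[C]_d) (s : R) x y : rform W (s%:C *: x) y = s * rform W x y.
Proof. by rewrite /rform sformZl !cplxE oppr0 mul0r subr0. Qed.

Lemma rformZr d (W : 'M[C]_d) (s : R) x y : rform W x (s%:C *: y) = s * rform W x y.
Proof. by rewrite /rform sformZr !cplxE mul0r subr0. Qed.

Lemma rformNl d (W : 'M[C]_d) x y : rform W (- x) y = - rform W x y.
Proof. by have := rformZl W (-1) x y; rewrite rmorphN scaleN1r mulN1r. Qed.

Lemma rformNr d (W : 'M[C]_d) x y : rform W x (- y) = - rform W x y.
Proof. by have := rformZr W (-1) x y; rewrite rmorphN scaleN1r mulN1r. Qed.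

Lemma sform_mulr d (W A : 'M[C]_d) x y : sform W x (A *m y) = sform (W *m A) x y.
Proof. by rewrite /sform !mulmxA. Qed.

Lemma sform_mull d (W A : 'M[C]_d) x y : sform W (A *m x) y = sform (A ^t* *m W) x y.
Proof. by rewrite /sform trmx_mul map_mxM !mulmxA. Qed.

Definition psd d (W : 'M[C]_d) := W ^t* = W /\ forall z, 0 <= qform W z.

Lemma rform_le d (W : 'M[C]_d) x y : psd W -> `|rform W x y| <= qform W x + qform W y.
Proof.
move=> [WH W0]; have := W0 (x + y); have := W0 (x - y).
rewrite !qformE !(rformDl, rformDr, rformNl, rformNr) (rformC y x WH) -!qformE.
have := W0 x; have := W0 y; rewrite ler_norml.
by move: (qform W x) (qform W y) (rform W x y) => a b c; lra.
Qed.

Lemma rform_CS d (W : 'M[C]_d) x y : psd W -> rform W x y ^+ 2 <= qform W x * qform W y.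
Proof.
move=> [WH W0].
have H s : 0 <= s ^+ 2 * Num.sqrt (qform W x) ^+ 2 + s * (2 * rform W x y) +
    Num.sqrt (qform W y) ^+ 2.
  rewrite !sqr_sqrtr//; have := W0 (s%:C *: x + y).
  rewrite qformE !(rformDl, rformDr, rformZl, rformZr) (rformC y x WH) -!qformE.
  by move: (qform W x) (qform W y) (rform W x y) => a b c; lra.
have H' s : 0 <= s ^+ 2 * Num.sqrt (qform W x) ^+ 2 + s * (- (2 * rform W x y)) +
    Num.sqrt (qform W y) ^+ 2.
  by have := H (- s); rewrite sqrrN mulrN mulNr.
have := quad_disc (sqrtr_ge0 _) (sqrtr_ge0 _) H.
have := quad_disc (sqrtr_ge0 _) (sqrtr_ge0 _) H'.
move=> h1 h2; rewrite -(sqr_sqrtr (W0 x)) -(sqr_sqrtr (W0 y)) -exprMn.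
rewrite -(real_normK (num_real (rform W x y))) ler_sqr ?nnegrE ?mulr_ge0 ?sqrtr_ge0//.
by rewrite ler_norml; lra.
Qed.

Lemma psd1 d : psd (1%:M : 'M[C]_d).
Proof. by split; [rewrite trmx1 map_mx1|exact: qform1_ge0]. Qed.

Lemma qform1E d (z : 'cV[C]_d) : qform 1%:M z = \sum_i (Re (z i 0) ^+ 2 + Im (z i 0) ^+ 2).
Proof.
rewrite /qform sform1 mxE; elim/big_rec2: _ => // i y1 y2 _ IH.
by rewrite ReD IH; congr (_ + _); rewrite !mxE !cplxE mulNr opprK !expr2.
Qed.

Lemma entry_le d (z : 'cV[C]_d) i : Re (z i 0) ^+ 2 + Im (z i 0) ^+ 2 <= qform 1%:M z.
Proof.
rewrite qform1E (bigD1 i)//= lerDl; apply: sumr_ge0 => j _.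
by rewrite addr_ge0 ?sqr_ge0.
Qed.

Lemma Re_le_norm (z : C) : Re z <= Re `|z|.
Proof.
have := normc_ge_Re z; rewrite lecE => /andP[_ /=].
exact: le_trans (ler_norm _).
Qed.

Lemma rform_bound d (W : 'M[C]_d) (M : R) : (forall i j, `|W i j| <= M%:C) ->
  forall x y, `|rform W x y| <= M * d%:R / 2 * (qform 1%:M x + qform 1%:M y).
Proof.
move=> WM.
have H x y : rform W x y <= M * d%:R / 2 * (qform 1%:M x + qform 1%:M y).
  pose n2 (c : C) := Re c ^+ 2 + Im c ^+ 2.
  have E : sform W x y = \sum_j \sum_i (x i 0)^* * W i j * y j 0.
    rewrite /sform mxE; apply: eq_bigr => j _; rewrite mxE mulr_suml.
    by apply: eq_bigr => i _; rewrite !mxE.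
  have Re_sum (I : finType) (F : I -> C) : Re (\sum_i F i) = \sum_i Re (F i).
    by elim/big_rec2: _ => // i a b _ <-; rewrite ReD.
  have entry i j : Re ((x i 0)^* * W i j * y j 0) <= M / 2 * (n2 (x i 0) + n2 (y j 0)).
    have := Re_le_norm ((x i 0)^* * W i j * y j 0).
    rewrite !normrM norm_conjC; have := WM i j.
    rewrite !normc_def /n2; case: (x i 0) (y j 0) (W i j) => [a b] [a' b'] [w w'] /=.
    rewrite lecR; set p := Num.sqrt (a ^+ 2 + b ^+ 2); set q := Num.sqrt (a' ^+ 2 + b' ^+ 2).
    set m := Num.sqrt _ => mM; rewrite !(mul0r, mulr0, subr0, addr0).
    have pE : p ^+ 2 = a ^+ 2 + b ^+ 2 by rewrite sqr_sqrtr ?addr_ge0 ?sqr_ge0.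
    have qE : q ^+ 2 = a' ^+ 2 + b' ^+ 2 by rewrite sqr_sqrtr ?addr_ge0 ?sqr_ge0.
    rewrite -pE -qE; have p0 : 0 <= p by exact: sqrtr_ge0.
    have q0 : 0 <= q by exact: sqrtr_ge0.
    have m0 : 0 <= m by exact: sqrtr_ge0.
    move=> h; apply: le_trans h _.
    have h1 := ler_wpM2r (mulr_ge0 p0 q0) mM.
    have h2 : M * (p * q) <= M * ((p ^+ 2 + q ^+ 2) / 2).
      by rewrite ler_wpM2l ?(le_trans m0)//; have := sqr_ge0 (p - q); rewrite sqrrB; lra.
    lra.
  rewrite /rform E Re_sum !qform1E -/(n2 _).
  apply: (@le_trans _ _ (\sum_j \sum_i (M / 2 * (n2 (x i 0) + n2 (y j 0))))).
    by apply: ler_sum => j _; rewrite Re_sum; apply: ler_sum => i _; exact: entry.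
  under eq_bigr do rewrite -mulr_sumr big_split /= sumr_const card_ord.
  rewrite -mulr_sumr big_split /= sumr_const card_ord sumrMnl.
  rewrite /n2 -mulrnDl le_eqVlt; apply/orP; left; apply/eqP; rewrite -(mulr_natl _ d); ring.
move=> x y; rewrite ler_norml H andbT lerNl -rformNl.
have -> : qform 1%:M x = qform 1%:M (- x).
  by rewrite !qformE rformNl rformNr opprK.
exact: H.
Qed.

Lemma qform_bound d (W : 'M[C]_d) (M : R) : (forall i j, `|W i j| <= M%:C) ->
  forall x, qform W x <= M * d%:R * qform 1%:M x.
Proof.
by move=> WM x; have := rform_bound WM x x; rewrite -qformE ler_norml => /andP[_]; lra.
Qed.

(* Cauchy-Schwarz for W applied to x and W x *)
Lemma mulmx_bound d (W : 'M[C]_d) (M : R) : psd W -> 0 <= M ->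
  (forall i j, `|W i j| <= M%:C) ->
  forall x, qform 1%:M (W *m x) <= M * d%:R * qform W x.
Proof.
move=> pW M0 WM x; have [WH W0] := pW.
have E : rform W x (W *m x) = qform 1%:M (W *m x).
  rewrite qformE /rform sform_mulr; congr Re.
  by rewrite /sform trmx_mul map_mxM WH mulmx1 !mulmxA.
have := rform_CS x (W *m x) pW; rewrite E => h.
have n0 := qform1_ge0 (W *m x); have := W0 x => q0.
have h2 := qform_bound WM (W *m x).
move: n0; rewrite le_eqVlt => /predU1P[<-|n0].
  by rewrite !mulr_ge0.
rewrite -(ler_pM2r n0) -expr2; apply: le_trans h _.
by rewrite (mulrC (M * d%:R)) -mulrA; exact: ler_wpM2l.
Qed.

End Forms.

Section EnergyInnerProduct.
Local Open Scope quotient_scope.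
Context {R : realType} {d : nat} (h : energy_density R d).
Local Notation C := R[i].
Local Notation mu := (@lebesgue_measure R).
Local Notation L2 := (L2H h).
Implicit Types (f k : R -> 'cV[C]_d) (x y z : L2).

Lemma ae_and (P Q : R -> Prop) : (\forall t \ae mu, P t) -> (\forall t \ae mu, Q t) ->
  \forall t \ae mu, P t /\ Q t.
Proof. by move=> aP aQ; have F := ae_filter_ringOfSetsType mu; exact: filterI. Qed.

Lemma ae_halfline (P : R -> Prop) : (\forall t \ae mu, 0 <= t -> P t) ->
  \forall t \ae mu, halfline t -> P t.
Proof. by move=> H; apply: (ae_mono H) => t; rewrite /= in_itv/= andbT. Qed.

Lemma ae_psd : \forall t \ae mu, 0 <= t -> psd (h t).
Proof.
by apply: (ae_mono (density_psd h)) => t; rewrite /= in_itv/= andbT => H /H.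
Qed.

(** Membership in the energy space at the level of functions; the local square integrability asked
    for in [L2H_pred] follows from local coercivity. *)
Definition square_integrable f := mxmeasurable halfline f /\
  intble halfline (fun t => qform (h t) (f t)).
Local Notation sqint := square_integrable.

Lemma mxmeasurableS (D D' : set R) f : measurable D -> D' `<=` D ->
  mxmeasurable D f -> mxmeasurable D' f.
Proof.
by move=> mD DD' mf i j; have [m1 m2] := mf i j; split; exact: measurable_funS DD' _.
Qed.

Lemma measurable_rform (W : R -> 'M[C]_d) (D : set R) f k : mxmeasurable D W ->
  mxmeasurable D f -> mxmeasurable D k -> measurable_fun D (fun t => rform (W t) (f t) (k t)).
Proof. by move=> mW mf mk; exact: (cmeasurable_sform mW mf mk).1. Qed.

Lemma sqint_intble1 f b : sqint f -> intble `[0, b] (fun t => qform 1%:M (f t)).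
Proof.
move=> [mf fi]; pose n := (Num.truncn b).+1.
have [m [m0 hm]] := density_coerciveN h n.
apply: (@intble_ae_le _ _ _ (fun t => m^-1 * qform (h t) (f t))) => //.
- apply: measurable_rform; first exact: mxmeasurable_cst1.
    by apply: mxmeasurableS mf => // t /=; rewrite !in_itv/= andbT => /andP[].
  by apply: mxmeasurableS mf => // t /=; rewrite !in_itv/= andbT => /andP[].
- by apply: intbleZ => //; exact: (intble_locint fi b).
- apply: (ae_mono hm) => t H; rewrite /= in_itv/= => /andP[t0 tb].
  rewrite ger0_norm ?qform1_ge0// mulrC ler_pdivlMr// mulrC; apply: H => //.
  by apply: le_trans tb _; rewrite ltW// truncnS_gt.
Qed.

Lemma intble_lty (D : set R) (F : R -> R) : measurable D -> intble D F ->
  (\int[mu]_(t in D) (F t)%:E < +oo)%E.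
Proof. by move=> mD; exact: integrable_lty. Qed.

Lemma sqint_L2H f : sqint f -> L2H_pred h f.
Proof.
move=> [mf fi]; split; last exact: intble_lty fi.
split=> // b; have := intble_lty (measurable_itv `[0%R, b]) (sqint_intble1 b (conj mf fi)).
by under eq_integral do rewrite /= /qform sform1.
Qed.

Lemma L2H_sqint f : L2H_pred h f -> sqint f.
Proof.
move=> [[mf lf] ff]; split=> //.
exact: (L2_integrable (@measurable_halfline R) (density_measurable h) (density_psd h) (conj mf ff)).
Qed.

Lemma sqint_rep x : sqint (L2H_rep x).
Proof. exact/L2H_sqint/L2H_funP. Qed.

Lemma sqint_linear a f k : sqint f -> sqint k -> sqint (fun t => a *: f t + k t).
Proof. by move=> /sqint_L2H Lf /sqint_L2H Lk; apply/L2H_sqint/L2H_linear. Qed.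

Lemma L2H_of_fun f : sqint f -> exists x, \forall t \ae mu, 0 <= t -> L2H_rep x t = f t.
Proof.
move=> /sqint_L2H Lf; have Lf' : f \in L2H_mem h by exact/asboolP.
by exists (\pi_(L2H h) (L2HFun Lf')); exact: L2H_rep_pi.
Qed.

Lemma L2H_ext x y : (\forall t \ae mu, 0 <= t -> L2H_rep x t = L2H_rep y t) -> x = y.
Proof. by move=> xy; rewrite -[x]reprK -[y]reprK; apply/eqP/L2H_eqP. Qed.

Lemma L2H_rep_linear a x y : \forall t \ae mu, 0 <= t ->
  L2H_rep (a *: x + y) t = a *: L2H_rep x t + L2H_rep y t.
Proof.
have -> : a *: x + y = \pi_(L2H h) (a *: (repr x : L2H_fun h) + repr y).
  by rewrite -L2H_piD -L2H_pi_scale !reprK.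
exact: L2H_rep_pi.
Qed.

Lemma L2H_rep0 : \forall t \ae mu, 0 <= t -> L2H_rep (0 : L2) t = 0.
Proof.
apply: (ae_mono (L2H_rep_linear (-1) (0 : L2) 0)) => t + t0 => /(_ t0).
by rewrite scaler0 addr0 scaleN1r addNr.
Qed.

Lemma intble_rform f k : sqint f -> sqint k ->
  intble halfline (fun t => rform (h t) (f t) (k t)).
Proof.
move=> [mf fi] [mk ki].
apply: (@intble_ae_le _ _ _ (fun t => qform (h t) (f t) + qform (h t) (k t))) => //.
- exact: measurable_rform (density_measurable h) mf mk.
- exact: intbleD.
- by apply: ae_halfline; apply: (ae_mono ae_psd) => t + t0 => /(_ t0); exact: rform_le.
Qed.

Definition rdot x y := \int[mu]_(t in halfline) rform (h t) (L2H_rep x t) (L2H_rep y t).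

Lemma rdotE x y f k : sqint f -> sqint k ->
  (\forall t \ae mu, 0 <= t -> L2H_rep x t = f t) ->
  (\forall t \ae mu, 0 <= t -> L2H_rep y t = k t) ->
  rdot x y = \int[mu]_(t in halfline) rform (h t) (f t) (k t).
Proof.
move=> sf sk xf yk; apply: eq_ae_Rintegral => //.
- exact: intble_measurable (intble_rform (sqint_rep x) (sqint_rep y)).
- exact: intble_measurable (intble_rform sf sk).
- apply: ae_halfline; apply: (ae_mono (ae_and xf yk)) => t [h1 h2] t0.
  by rewrite h1// h2.
Qed.

Lemma rdotC x y : rdot x y = rdot y x.
Proof.
apply: eq_ae_Rintegral => //.
- exact: intble_measurable (intble_rform (sqint_rep x) (sqint_rep y)).
- exact: intble_measurable (intble_rform (sqint_rep y) (sqint_rep x)).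
- apply: ae_halfline; apply: (ae_mono ae_psd) => t + t0 => /(_ t0) [hH _].
  exact: rformC.
Qed.

Lemma rdot_linear (s : R) x y z : rdot (s%:C *: x + y) z = s * rdot x z + rdot y z.
Proof.
rewrite (rdotE (sqint_linear s%:C (sqint_rep x) (sqint_rep y)) (sqint_rep z)
  (L2H_rep_linear _ _ _) (aeW _ (fun t _ => erefl))).
rewrite (@eq_Rintegral _ _ _ mu _ (fun t => s * rform (h t) (L2H_rep x t) (L2H_rep z t) +
  rform (h t) (L2H_rep y t) (L2H_rep z t))); last first.
  by move=> t _; rewrite rformDl rformZl.
have i1 := intble_rform (sqint_rep x) (sqint_rep z).
rewrite RintegralD; [|exact: measurable_itv|exact: intbleZ|].
- by rewrite RintegralZl.
- exact: intble_rform (sqint_rep y) (sqint_rep z).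
Qed.

Lemma rdotDl x y z : rdot (x + y) z = rdot x z + rdot y z.
Proof. by have := rdot_linear 1 x y z; rewrite scale1r mul1r. Qed.

Lemma rdotZl (s : R) x y : rdot (s%:C *: x) y = s * rdot x y.
Proof.
have rdot0 : rdot 0 y = 0 by have := rdot_linear (-1) 0 0 y; rewrite scaler0 addr0; lra.
by have := rdot_linear s x 0 y; rewrite !addr0 rdot0 addr0.
Qed.

Lemma rdot_ge0 x : 0 <= rdot x x.
Proof.
exact: (Q_ge0 (@measurable_halfline R) (density_measurable h) (density_psd h) (sqint_rep x).1).
Qed.

Lemma rdot_norm x : `|x| = (Num.sqrt (rdot x x))%:C.
Proof. by rewrite L2H_normE. Qed.

End EnergyInnerProduct.

(** * Convergence of sequences of complex numbers and vectors *)

Section ComplexSequences.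
Context {R : realType}.
Local Notation C := R[i].

Definition ccvg (a : nat -> C) (l : C) :=
  Re (a n) @[n --> \oo] --> Re l /\ Im (a n) @[n --> \oo] --> Im l.

Lemma ccvg_cst (c : C) : ccvg (fun=> c) c.
Proof. by split; exact: cvg_cst. Qed.

Lemma ccvgD (a b : nat -> C) l m : ccvg a l -> ccvg b m -> ccvg (fun n => a n + b n) (l + m).
Proof.
move=> [a1 a2] [b1 b2]; split.
  by rewrite ReD; under eq_fun do rewrite ReD; exact: cvgD.
by rewrite ImD; under eq_fun do rewrite ImD; exact: cvgD.
Qed.

Lemma ccvgM (a b : nat -> C) l m : ccvg a l -> ccvg b m -> ccvg (fun n => a n * b n) (l * m).
Proof.
move=> [a1 a2] [b1 b2]; split.
  rewrite ReM; under eq_fun do rewrite ReM; apply: cvgB; exact: cvgM.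
rewrite ImM; under eq_fun do rewrite ImM; apply: cvgD; exact: cvgM.
Qed.

Lemma ccvg_conj (a : nat -> C) l : ccvg a l -> ccvg (fun n => (a n)^*) (l^*).
Proof.
move=> [a1 a2]; split; first by rewrite Re_conj; under eq_fun do rewrite Re_conj.
by rewrite Im_conj; under eq_fun do rewrite Im_conj; exact: cvgN.
Qed.

Lemma ccvg_shift (a : nat -> C) l n : ccvg a l -> ccvg (fun k => a (n + k)%N) l.
Proof.
by move=> [a1 a2]; split; [exact: (cvg_comp _ _ (cvg_addnl n) a1)|exact: (cvg_comp _ _ (cvg_addnl n) a2)].
Qed.

Lemma ccvg_sum n (a : 'I_n -> nat -> C) (l : 'I_n -> C) : (forall i, ccvg (a i) (l i)) ->
  ccvg (fun k => \sum_i a i k) (\sum_i l i).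
Proof.
move=> al; elim: (index_enum _) => [|i s IH].
  by rewrite big_nil; under eq_fun do rewrite big_nil; exact: ccvg_cst.
by rewrite big_cons; under eq_fun do rewrite big_cons; exact: ccvgD.
Qed.

Lemma cvg_rform d (W : 'M[C]_d) (a b : nat -> 'cV[C]_d) (l m : 'cV[C]_d) :
  (forall i, ccvg (fun n => a n i 0) (l i 0)) -> (forall i, ccvg (fun n => b n i 0) (m i 0)) ->
  rform W (a n) (b n) @[n --> \oo] --> rform W l m.
Proof.
move=> al bm.
have E (x y : 'cV[C]_d) : sform W x y = \sum_j (\sum_i (x i 0)^* * W i j) * y j 0.
  rewrite /sform mxE; apply: eq_bigr => j _; rewrite mxE; congr (_ * _).
  by apply: eq_bigr => i _; rewrite !mxE.
rewrite /rform E; under eq_fun do rewrite E.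
apply: (proj1 (ccvg_sum (a := fun j n => (\sum_i (a n i 0)^* * W i j) * b n j 0) _)) => j.
apply: ccvgM => //; apply: ccvg_sum => i; apply: ccvgM; last exact: ccvg_cst.
exact: ccvg_conj.
Qed.

Lemma cvg_summable_increments (a b : nat -> R) S : (forall k, `|a k.+1 - a k| <= b k) ->
  (forall n, \sum_(0 <= k < n) b k <= S) -> cvgn a.
Proof.
move=> ab bS; pose D k := a k.+1 - a k.
have cD : cvgn (series D).
  apply: normed_cvg; apply: nondecreasing_is_cvgn.
    by apply: nondecreasing_series => k _ _; exact: normr_ge0.
  exists S => _ [n _ <-]; apply: le_trans (bS n).
  by rewrite /series /=; apply: ler_sum => k _; exact: ab.
have -> : a = fun n => series D n + a 0%N.
  by apply/funext => n; rewrite /series /= telescope_sumr// subrK.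
by apply: is_cvgD => //; exact: is_cvg_cst.
Qed.

Lemma limn_einf_le (u : nat -> \bar R) c : (forall n, (u n <= c)%E) -> (limn_einf u <= c)%E.
Proof.
move=> uc; rewrite limn_einf_lim; apply: lime_le; first exact: is_cvg_einfs.
apply: nearW => n; apply: le_trans (uc n).
by apply: ereal_inf_lbound; exists n => //=.
Qed.

End ComplexSequences.

(** * Completeness of the energy space *)

Section Completeness.
Context {R : realType} {d : nat} (h : energy_density R d).
Local Notation C := R[i].
Local Notation mu := (@lebesgue_measure R).
Local Notation L2 := (L2H h).
Local Notation sqint := (square_integrable h).
Local Notation nrm := (nr (@rdot R d h)).

Lemma L2H_rep_sub (x y : L2) : \forall t \ae mu, 0 <= t ->
  L2H_rep (x - y) t = L2H_rep x t - L2H_rep y t.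
Proof.
have := L2H_rep_linear (-1) y x; rewrite scaleN1r addrC => H.
by apply: (ae_mono H) => t + t0 => /(_ t0) ->; rewrite scaleN1r addrC.
Qed.

Lemma sqint_sub (f k : R -> 'cV[C]_d) : sqint f -> sqint k -> sqint (fun t => f t - k t).
Proof.
move=> sf sk; have := sqint_linear (-1) sk sf; congr square_integrable.
by apply/funext => t; rewrite scaleN1r addrC.
Qed.

Lemma nrm_sub (x y : L2) (f k : R -> 'cV[C]_d) : sqint f -> sqint k ->
  (\forall t \ae mu, 0 <= t -> L2H_rep x t = f t) ->
  (\forall t \ae mu, 0 <= t -> L2H_rep y t = k t) ->
  nrm (x - y) ^+ 2 = \int[mu]_(t in halfline) qform (h t) (f t - k t).
Proof.
move=> sf sk xf yk; rewrite (nr_sqr (@rdot_ge0 R d h)).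
have xy : \forall t \ae mu, 0 <= t -> L2H_rep (x - y) t = f t - k t.
  apply: (ae_mono (ae_and (L2H_rep_sub x y) (ae_and xf yk))) => t [h1 [h2 h3]] t0.
  by rewrite h1// h2// h3.
exact: (rdotE (sqint_sub sf sk) (sqint_sub sf sk) xy xy).
Qed.

Lemma int_abs_qform (f : R -> 'cV[C]_d) : sqint f ->
  (\int[mu]_(t in halfline) `|qform (h t) (f t)|%:E)%E =
  (\int[mu]_(t in halfline) qform (h t) (f t))%:E.
Proof.
move=> [mf fi]; rewrite /Rintegral fineK; last exact: integrable_fin_num.
have /= := int_q_abs (@measurable_halfline R) (density_measurable h) (density_psd h) mf.
by [].
Qed.

(** The Riesz-Fischer argument for quadratic forms. The series of [2^k] times the energies of the
    increments has a finite integral, hence converges almost everywhere; local coercivity turns this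
    into convergence of the coordinates, and Fatou's lemma carries the estimates to the limit. *)
Lemma fast_complete (y : nat -> L2) : (forall k, nrm (y k.+1 - y k) <= 2^-1 ^+ k) ->
  exists l, forall k, nrm (l - y k) <= 2 * 2^-1 ^+ k.
Proof.
move=> yk; pose f k := L2H_rep (y k).
have sf k : sqint (f k) by exact: sqint_rep.
have mf k := (sf k).1.
have sub_int m n : (\int[mu]_(t in halfline) `|qform (h t) (f m t - f n t)|%:E)%E =
    (nrm (y m - y n) ^+ 2)%:E.
  rewrite (int_abs_qform (sqint_sub (sf m) (sf n))) (nrm_sub (sf m) (sf n))//.
    by apply: aeW.
  by apply: aeW.
have mq m n : measurable_fun (halfline : set R) (fun t => qform (h t) (f m t - f n t)).
  exact: intble_measurable (sqint_sub (sf m) (sf n)).2.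
pose g k t := (2 ^+ k * `|qform (h t) (f k.+1 t - f k t)|)%:E.
have mg k : measurable_fun (halfline : set R) (g k).
  apply/measurable_EFinP; by apply: measurable_funM => //; apply: measurableT_comp => //; exact: mq.
have g0 k t : (0 <= g k t)%E by rewrite lee_fin mulr_ge0.
have ig k : (\int[mu]_(t in halfline) g k t <= (2^-1 ^+ k)%:E)%E.
  rewrite /g; under eq_integral do rewrite EFinM.
  rewrite ge0_integralZl_EFin//; last by apply/measurable_EFinP; apply: measurableT_comp => //; exact: mq.
  rewrite sub_int -EFinM lee_fin.
  have h1 : nrm (y k.+1 - y k) ^+ 2 <= (2^-1 ^+ k) ^+ 2.
    by rewrite lerXn2r// ?nnegrE ?nr_ge0// exprn_ge0// invr_ge0.
  have := ler_wpM2l (exprn_ge0 k (ler0n R 2)) h1.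
  have cc : (2 : R) ^+ k * 2^-1 ^+ k = 1 by rewrite -exprMn divff// expr1n.
  suff -> : (2 : R) ^+ k * (2^-1 ^+ k) ^+ 2 = 2^-1 ^+ k by [].
  by rewrite [X in _ * X]expr2 mulrA cc mul1r.
pose G t := (\sum_(0 <= k <oo) g k t)%E.
have mG : measurable_fun (halfline : set R) G.
  apply: (@emeasurable_fun_cvg _ _ _ _ (fun n t => \sum_(0 <= k < n) g k t)%E).
    by move=> m; apply: emeasurable_sum => k; exact: mg.
  by move=> t _; apply: is_cvg_nneseries => k _ _; exact: g0.
have half_sum n : \sum_(0 <= k < n) (2^-1 : R) ^+ k <= 2.
  suff -> : \sum_(0 <= k < n) (2^-1 : R) ^+ k = 2 - 2 * 2^-1 ^+ n.
    by rewrite gerBl mulr_ge0// exprn_ge0// invr_ge0.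
  elim: n => [|n IH]; first by rewrite big_geq// expr0; lra.
  by rewrite big_nat_recr//= IH exprS; lra.
have intG : mu.-integrable (halfline : set R) G.
  apply/integrableP; split=> //.
  have -> : (\int[mu]_(t in halfline) `|G t| = \int[mu]_(t in halfline) G t)%E.
    apply: eq_integral => t _; apply: gee0_abs.
    by apply: nneseries_ge0 => k _ _; exact: (g0 k t).
  rewrite integral_nneseries//; apply: le_lt_trans (ltry 2).
  apply: lime_le; first by apply: is_cvg_nneseries => k _ _; exact: integral_ge0.
  apply: nearW => n; apply: (@le_trans _ _ (\sum_(0 <= k < n) (2^-1 ^+ k)%:E)%E).
    by apply: lee_sum => k _; exact: ig.
  by rewrite sumEFin lee_fin half_sum.
have aeG : \forall t \ae mu, halfline t -> G t \is a fin_num.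
  by apply: integrable_ae intG; exact: measurable_itv.
(* Upper limits are measurable whether or not the sequence converges; the points of divergence form
   a null set on which the value of [F] is irrelevant. *)
pose F t := \col_i (fine (limn_esup (fun k => (Re (f k t i 0))%:E)) +i*
                    fine (limn_esup (fun k => (Im (f k t i 0))%:E))).
have mF : mxmeasurable halfline F.
  move=> i j; rewrite ord1; split.
    rewrite (_ : (fun t => _) = fine \o (fun t => limn_esup (fun k => (Re (f k t i 0))%:E))).
      apply: measurableT_comp => //; apply: measurable_fun_limn_esup => k.
      by apply/measurable_EFinP; exact: (mf k i 0).1.
    by apply/funext => t; rewrite /= mxE.
  rewrite (_ : (fun t => _) = fine \o (fun t => limn_esup (fun k => (Im (f k t i 0))%:E))).
    apply: measurableT_comp => //; apply: measurable_fun_limn_esup => k.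
    by apply/measurable_EFinP; exact: (mf k i 0).2.
  by apply/funext => t; rewrite /= mxE.
have coer : \forall t \ae mu, forall n : nat, exists2 m : R, 0 < m & (0 <= t -> t <= n%:R ->
    forall z : 'cV[C]_d, m * qform 1%:M z <= qform (h t) z).
  apply: ae_foralln => n; have [m [m0 hm]] := density_coerciveN h n.
  by apply: (ae_mono hm) => t H; exists m.
have Fcvg : \forall t \ae mu, 0 <= t -> forall i, ccvg (fun k => f k t i 0) (F t i 0).
  apply: (ae_mono (ae_and aeG coer)) => t [h1 h2] t0 i.
  have Gfin : G t \is a fin_num by apply: h1; rewrite /= in_itv/= t0.
  have [m m0 /(_ t0 (ltW (truncnS_gt t))) hm] := h2 (Num.truncn t).+1.
  pose b k := 2^-1 ^+ k + 2 ^+ k * `|qform (h t) (f k.+1 t - f k t)| / m.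
  have bS n : \sum_(0 <= k < n) b k <= 2 + fine (G t) / m.
    rewrite big_split/= lerD// -mulr_suml ler_wpM2r ?invr_ge0 ?(ltW m0)//.
    rewrite -lee_fin fineK// -sumEFin; apply: nneseries_lim_ge => k _ _; exact: g0.
  have sq k (a : R) : a ^+ 2 <= qform 1%:M (f k.+1 t - f k t) -> `|a| <= b k.
    move=> ha; have c0 : 0 < (2 : R) ^+ k by rewrite exprn_gt0.
    have cc : (2 : R) ^+ k * 2^-1 ^+ k = 1 by rewrite -exprMn divff// expr1n.
    have q1 : a ^+ 2 * m <= `|qform (h t) (f k.+1 t - f k t)|.
      apply: le_trans (ler_norm _); apply: le_trans (hm _).
      by rewrite mulrC ler_pM2l.
    have q2 : 2 ^+ k * a ^+ 2 <= 2 ^+ k * `|qform (h t) (f k.+1 t - f k t)| / m.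
      by rewrite -mulrA ler_pM2l// ler_pdivlMr.
    (* From [(2^k |a| - 1)^2 >= 0]: summable weighted squares dominate the increments up to a
       geometric series. *)
    have q3 : `|a| <= 2^-1 ^+ k + 2 ^+ k * a ^+ 2.
      have := sqr_ge0 (2 ^+ k * `|a| - 1).
      rewrite -(real_normK (num_real a)) sqrrB mulr1 expr1n exprMn.
      have : 0 <= `|a| by [].
      move: (2^-1 ^+ k) c0 cc (`|a|) => e; move: (2 ^+ k) => c c0 cc x x0 H.
      rewrite -(ler_pM2l c0) mulrDr cc; nra.
    by apply: le_trans q3 _; rewrite lerD2l.
  have cv (P : C -> R) : (forall k, (P (f k.+1 t i 0) - P (f k t i 0)) ^+ 2 <=
      qform 1%:M (f k.+1 t - f k t)) ->
      P (f k t i 0) @[k --> \oo] --> fine (limn_esup (fun k => (P (f k t i 0))%:E)).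
    move=> HP; have c : cvgn (fun k => P (f k t i 0)).
      by apply: (@cvg_summable_increments _ _ b _ _ bS) => k; apply: sq; exact: HP.
    have c' : (P (f k t i 0))%:E @[k --> \oo] --> (limn (fun k => P (f k t i 0)))%:E.
      by apply: cvg_EFin => //; exact: nearW.
    by have [_ ->] := cvg_limn_einf_sup c'.
  rewrite /F mxE; split; apply: cv => k.
    have := entry_le (f k.+1 t - f k t) i; rewrite !mxE !cplxE.
    by have := sqr_ge0 (Im (f k.+1 t i 0) - Im (f k t i 0)); lra.
  have := entry_le (f k.+1 t - f k t) i; rewrite !mxE !cplxE.
    by have := sqr_ge0 (Re (f k.+1 t i 0) - Re (f k t i 0)); lra.
have mFn n : mxmeasurable halfline (fun t => F t - f n t).
  have := mxmeasurable_linear (-1) (mf n) mF; congr mxmeasurable.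
  by apply/funext => t; rewrite scaleN1r addrC.
have mqF n : measurable_fun (halfline : set R) (fun t => qform (h t) (F t - f n t)).
  exact: measurable_rform (density_measurable h) (mFn n) (mFn n).
have fat n : (\int[mu]_(t in halfline) `|qform (h t) (F t - f n t)|%:E <=
    ((2 * 2^-1 ^+ n) ^+ 2)%:E)%E.
  pose P m t := `|qform (h t) (f (n + m)%N t - f n t)|%:E.
  have mP m : measurable_fun (halfline : set R) (P m).
    by apply/measurable_EFinP; apply: measurableT_comp => //; exact: mq.
  have mP' : measurable_fun (halfline : set R) (fun t => limn_einf (P^~ t)).
    rewrite (_ : (fun t => _) = (fun t => - limn_esup (-%E \o P^~ t))%E); last first.
      by apply/funext => t; rewrite limn_esupN oppeK.
    apply: measurableT_comp => //; apply: measurable_fun_limn_esup => m.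
    exact: measurableT_comp.
  have P0 m t : (0 <= P m t)%E by rewrite lee_fin.
  have Plim0 t : (0 <= limn_einf (P^~ t))%E.
    rewrite limn_einf_lim; apply: lime_ge; first exact: is_cvg_einfs.
    by apply: nearW => m; apply: le_ereal_inf_tmp => _ [k _ <-]; exact: P0.
  have -> : (\int[mu]_(t in halfline) `|qform (h t) (F t - f n t)|%:E =
      \int[mu]_(t in halfline) limn_einf (P^~ t))%E.
    apply: ge0_ae_eq_integral => //.
      by apply/measurable_EFinP; apply: measurableT_comp => //; exact: mqF.
    apply: (ae_mono Fcvg) => t Ft; rewrite /= in_itv/= andbT => /Ft {}Ft.
    have Ft' i : ccvg (fun m => (f (n + m)%N t - f n t) i 0) ((F t - f n t) i 0).
      have subE (a b : 'cV[C]_d) : (a - b) i 0 = a i 0 - b i 0 by rewrite !mxE.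
      rewrite subE; under eq_fun do rewrite subE.
      apply: (@ccvgD _ (fun m => f (n + m)%N t i 0) (fun=> - f n t i 0)); last exact: ccvg_cst.
      exact: (@ccvg_shift _ (fun m => f m t i 0) _ n (Ft i)).
    have := @cvg_rform _ d (h t) _ _ _ _ Ft' Ft' => /cvg_norm c.
    have c' : P m t @[m --> \oo] --> `|qform (h t) (F t - f n t)|%:E.
      by apply: cvg_EFin => //; exact: nearW.
    by have [-> _] := cvg_limn_einf_sup c'.
  have fatP := @fatou _ _ _ mu _ (@measurable_halfline R) _ mP (fun m t _ => P0 m t).
  apply: le_trans fatP _.
  apply: limn_einf_le => m; rewrite sub_int lee_fin.
  have yk' k : nrm (y k.+1 - y k) <= 1 * 2^-1 ^+ k by rewrite mul1r.
  have e0 k : 0 <= (2^-1 : R) ^+ k by rewrite exprn_ge0// invr_ge0.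
  rewrite ler_sqr ?nnegrE ?nr_ge0 ?mulr_ge0//.
  apply: le_trans (fast_cauchy (@rdot_norm R d h) yk' n m) _.
  by rewrite mulr1 ler_wpM2l// gerBl.
have sFn n : sqint (fun t => F t - f n t).
  split=> //; apply/integrableP; split; first by apply/measurable_EFinP; exact: mqF.
  exact: le_lt_trans (fat n) (ltry _).
have sF : sqint F.
  have := sqint_linear 1 (sFn 0%N) (sf 0%N); congr square_integrable.
  by apply/funext => t; rewrite scale1r subrK.
have [l lF] := L2H_of_fun sF.
exists l => n; rewrite -ler_sqr ?nnegrE ?nr_ge0 ?mulr_ge0 ?exprn_ge0 ?invr_ge0//.
rewrite (nrm_sub sF (sf n) lF (aeW _ (fun t _ => erefl))) -lee_fin.
by rewrite -(int_abs_qform (sFn n)).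
Qed.

Lemma L2H_complete (s : nat -> L2) :
  (forall e : R, 0 < e -> exists N, forall m n, (N <= m)%N -> (N <= n)%N -> nrm (s m - s n) < e) ->
  exists l : L2, s k @[k --> \oo] --> l.
Proof.
move=> cs; have e0 k : 0 < (2^-1 : R) ^+ k by rewrite exprn_gt0// invr_gt0.
have [N NP] := choice (fun k => cs _ (e0 k)).
(* The partial sums of [N] are monotone and dominate each [N k], so they index a rapidly converging
   subsequence. *)
pose phi k := (\sum_(i < k.+1) N i)%N.
have phiN k : (N k <= phi k)%N by rewrite /phi big_ord_recr/= leq_addl.
have phi_S k : (phi k <= phi k.+1)%N by rewrite /phi [X in (_ <= X)%N]big_ord_recr/= leq_addr.
have [k|l lP] := @fast_complete (fun k => s (phi k)).
  by apply/ltW/NP; [exact: leq_trans (phiN k) (phi_S k)|exact: phiN].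
exists l; apply/(cvg_seqP (@rdot_norm R d h)) => e egt.
have [k /(_ k (leqnn k)) ke] := half_powP (divr_gt0 egt (ltr0n R 3)).
exists (N k) => n Nn; apply: le_lt_trans (nr_triangle (@rdot_norm R d h) (s (phi k)) l (s n)) _.
have aux (a b c : R) : a <= 2 * c -> b < c -> c < e / 3 -> a + b < e by lra.
exact: aux (lP k) (NP k (phi k) n (phiN k) Nn) ke.
Qed.

End Completeness.

(** * Measurability of determinants, adjugates and inverses *)

Section MeasurableInverse.
Context {R : realType}.
Local Notation C := R[i].
Implicit Types (D : set R).

Lemma cmeasurable_prod D n (F : 'I_n -> R -> C) :
  (forall i, cmeasurable D (F i)) -> cmeasurable D (fun t => \prod_i F i t).
Proof.
move=> mF; elim: (index_enum _) => [|i s IH].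
  by under eq_fun do rewrite big_nil; exact: cmeasurable_cst.
by under eq_fun do rewrite big_cons; exact: cmeasurableM.
Qed.

Lemma cmeasurable_det D n (A : R -> 'M[C]_n) : mxmeasurable D A ->
  cmeasurable D (fun t => \det (A t)).
Proof.
move=> mA; rewrite /determinant.
elim: (index_enum _) => [|s r IH].
  by under eq_fun do rewrite big_nil; exact: cmeasurable_cst.
under eq_fun do rewrite big_cons; apply: cmeasurableD => //.
apply: cmeasurableM; first exact: cmeasurable_cst.
exact: cmeasurable_prod.
Qed.

Lemma mxmeasurable_adj D n (A : R -> 'M[C]_n) : mxmeasurable D A ->
  mxmeasurable D (fun t => \adj (A t)).
Proof.
move=> mA i j; under eq_fun do rewrite mxE /cofactor.
apply: cmeasurableM; first exact: cmeasurable_cst.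
by apply: cmeasurable_det => k l; under eq_fun do rewrite !mxE.
Qed.

Lemma cmeasurable_inv D (f : R -> C) : measurable D -> cmeasurable D f ->
  cmeasurable D (fun t => (f t)^-1).
Proof.
move=> mD [f1 f2]; pose N t := Re (f t) ^+ 2 + Im (f t) ^+ 2.
have mN : measurable_fun D (fun t => (N t)^-1).
  have -> : (fun t => (N t)^-1) = (fun t => N t `^ -1).
    by apply/funext => t; rewrite powR_inv1// /N addr_ge0// sqr_ge0.
  apply: (@measurableT_comp _ _ _ _ _ _ (fun x => x `^ -1)); first exact: measurable_powR.
  by apply: measurable_funD; exact: measurable_funX.
have E t : (f t)^-1 = (N t)^-1%:C * (f t)^*.
  rewrite /N; case: (f t) => a b; apply/eqP; rewrite eq_complex /=.
  by apply/andP; split; apply/eqP => /=; rewrite -?mulrN; ring.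
under eq_fun do rewrite E.
apply: cmeasurableM; last exact: cmeasurable_conj.
by split=> //; exact: measurable_cst.
Qed.

Lemma mxmeasurable_mulmx D m n p (A : R -> 'M[C]_(m, n)) (B : R -> 'M[C]_(n, p)) :
  mxmeasurable D A -> mxmeasurable D B -> mxmeasurable D (fun t => A t *m B t).
Proof.
move=> mA mB i j; under eq_fun do rewrite mxE.
by apply: cmeasurable_sum => k; exact: cmeasurableM.
Qed.

End MeasurableInverse.

(** * Energy variables and their absolutely continuous representatives *)

Section EnergyVariable.
Context {R : realType} {d : nat} (h : energy_density R d).
Local Notation C := R[i].
Local Notation mu := (@lebesgue_measure R).
Local Notation L2 := (L2H h).
Local Notation sqint := (square_integrable h).
Implicit Types (f k U V : R -> 'cV[C]_d) (x y : L2).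

Lemma density_bound : exists2 M : R, 0 <= M & forall t, 0 <= t -> forall i j, `|h t i j| <= M%:C.
Proof.
have [M HM] := density_bounded h; exists `|M| => // t t0 i j.
by apply: le_trans (HM t t0 i j) _; rewrite lecR ler_norm.
Qed.

Lemma vlocint_qform1 f : mxmeasurable halfline f ->
  (forall b, intble `[0, b] (fun t => qform 1%:M (f t))) -> vlocint f.
Proof.
move=> mf fi i.
have mS b : mxmeasurable `[0, b] f.
  apply: (@mxmeasurableS _ _ (halfline : set R)) mf => // t.
  by rewrite /= !in_itv/= andbT => /andP[].
have H b : intble `[0, b] (fun t => 1 + qform 1%:M (f t)).
  by apply: intbleD => //; exact: locint_cst.
have aux (a c q : R) : a ^+ 2 + c ^+ 2 <= q -> `|a| <= 1 + q.
  move=> aq; have := sqr_ge0 c; have := sqr_ge0 (`|a| - 1).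
  by rewrite sqrrB real_normK ?num_real// mulr1 expr1n; have := normr_ge0 a; lra.
split=> b; apply: (intble_ae_le _ _ (H b)) => //.
- exact: (mS b i 0).1.
- by apply: aeW => t _; exact: aux (entry_le _ i).
- exact: (mS b i 0).2.
- by apply: aeW => t _; apply: (aux _ (Re (f t i 0))); rewrite addrC; exact: entry_le.
Qed.

Lemma sqint_vlocint f : sqint f -> vlocint f.
Proof. by move=> sf; apply: vlocint_qform1 => [|b]; [exact: sf.1|exact: (sqint_intble1 b sf)]. Qed.

Lemma sqint_ae f k : sqint f -> mxmeasurable halfline k ->
  (\forall t \ae mu, 0 <= t -> k t = f t) -> sqint k.
Proof.
move=> [mf fi] mk kf; split=> //; apply: (intble_ae_le _ _ fi) => //.
  exact: (measurable_rform (density_measurable h) mk mk).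
apply: ae_halfline; apply: (ae_mono (ae_and kf (ae_psd h))) => t [h1 h2] t0.
by rewrite h1// ger0_norm//; apply: (h2 t0).2.
Qed.

Lemma mxmeasurable_density f : mxmeasurable halfline f ->
  mxmeasurable halfline (fun t => h t *m f t).
Proof. exact: mxmeasurable_mulmx (density_measurable h). Qed.

(** [|h t f|^2] is at most a constant times [f^* h t f] by [mulmx_bound], so energy variables are
    square integrable without weight. *)
Lemma intble_qform1_density f : sqint f ->
  intble halfline (fun t => qform 1%:M (h t *m f t)).
Proof.
move=> [mf fi]; have [M M0 HM] := density_bound.
apply: (@intble_ae_le _ _ _ (fun t => M * d%:R * qform (h t) (f t))) => //.
- apply: measurable_rform; first exact: mxmeasurable_cst1.
    exact: mxmeasurable_density.
  exact: mxmeasurable_density.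
- exact: intbleZ.
- apply: ae_halfline; apply: (ae_mono (ae_psd h)) => t hp t0.
  by rewrite ger0_norm ?qform1_ge0//; apply: mulmx_bound (hp t0) M0 (HM t t0) _.
Qed.

Lemma sqint_qform1 f : mxmeasurable halfline f ->
  intble halfline (fun t => qform 1%:M (f t)) -> sqint f.
Proof.
move=> mf fi; have [M M0 HM] := density_bound; split=> //.
apply: (@intble_ae_le _ _ _ (fun t => M * d%:R * qform 1%:M (f t))) => //.
- exact: (measurable_rform (density_measurable h) mf mf).
- exact: intbleZ.
- apply: ae_halfline; apply: (ae_mono (ae_psd h)) => t hp t0.
  by rewrite ger0_norm ?(hp t0).2//; exact: qform_bound (HM t t0) _.
Qed.

(** Cauchy-Schwarz bounds the square of [qform W z] by [|z|^2 |W z|^2], and coercivity bounds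
    [|z|^2] by [qform W z / m]. *)
Lemma coercive_mulmx (W : 'M[C]_d) (m : R) z : psd W -> 0 < m ->
  (forall z, m * qform 1%:M z <= qform W z) ->
  qform W z <= qform 1%:M (W *m z) / m.
Proof.
move=> [WH W0] m0 Wm.
have E : qform W z = rform 1%:M z (W *m z) by rewrite /rform sform_mulr mul1mx.
have CS := rform_CS z (W *m z) (psd1 d); rewrite -E in CS.
have q0 := qform1_ge0 (W *m z); have q1 := qform1_ge0 z.
have := Wm z; have := W0 z; rewrite ler_pdivlMr//.
move: (qform W z) (qform 1%:M z) (qform 1%:M (W *m z)) CS q0 q1 => a b c CS c0 b0 a0 ba.
have [->|an] := eqVneq a 0; first by rewrite mul0r.
have {an}a0 : 0 < a by rewrite lt0r an.
rewrite -(ler_pM2l a0); nra.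
Qed.

(** The field [(h t)^-1 U t] has energy at most [|U t|^2 / m]. Coercivity may degenerate as [t]
    grows, so [m] is allowed to depend on [t] and [U] must be small accordingly. The adjugate
    formula keeps the inverse measurable. *)
Lemma density_inverse U (b : R -> R) : mxmeasurable halfline U -> intble halfline b ->
  (\forall t \ae mu, 0 <= t -> exists2 m, 0 < m &
     (forall z, m * qform 1%:M z <= qform (h t) z) /\ qform 1%:M (U t) <= m * b t) ->
  exists2 f, sqint f & \forall t \ae mu, 0 <= t -> h t *m f t = U t.
Proof.
move=> mU bi bU.
pose f t := (\det (h t))^-1 *: (\adj (h t) *m U t).
have mf : mxmeasurable halfline f.
  have -> : f = fun t => ((\det (h t))^-1)%:M *m (\adj (h t) *m U t).
    by apply/funext => t; rewrite mul_scalar_mx.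
  apply: mxmeasurable_mulmx; last first.
    by apply: mxmeasurable_mulmx => //; apply: mxmeasurable_adj; exact: density_measurable.
  move=> i j; rewrite (_ : (fun t => _) = fun t => (\det (h t))^-1 * (i == j)%:R).
    apply: cmeasurableM; last exact: cmeasurable_cst.
    by apply: cmeasurable_inv => //; apply: cmeasurable_det; exact: density_measurable.
  by apply/funext => t; rewrite mxE mulr_natr.
have hf : \forall t \ae mu, 0 <= t -> h t *m f t = U t.
  apply: (ae_mono bU) => t + t0 => /(_ t0)[m m0 [hm _]].
  rewrite /f -scalemxAr mulmxA mul_mx_adj mul_scalar_mx scalerA mulVf ?scale1r//.
  apply/negP => /det0P[v vn0 v0].
  have : (v ^t*) != 0.
    by apply: contra vn0 => /eqP ve; rewrite -(trmxCK v) ve trmx0 map_mx0.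
  apply/negP; rewrite negbK; apply/eqP/qform1_eq0/eqP.
  rewrite eq_le qform1_ge0 andbT -(pmulr_rle0 _ m0); apply: le_trans (hm _) _.
  by rewrite /qform /sform trmxCK v0 mul0mx mxE.
exists f => //; split=> //; apply: (@intble_ae_le _ _ _ b) => //.
  exact: (measurable_rform (density_measurable h) mf mf).
apply: ae_halfline; apply: (ae_mono (ae_and (ae_and bU hf) (ae_psd h))) => t [[h1 h2] h3] t0.
rewrite ger0_norm ?(h3 t0).2//; have [m m0 [hm hb]] := h1 t0.
apply: le_trans (coercive_mulmx _ (h3 t0) m0 hm) _.
by rewrite h2// ler_pdivrMr// mulrC.
Qed.

(* [U] is the continuous representative of [Hx x] and [k] its derivative. *)
Definition Hx_AC x U k :=
  [/\ vAC U k, \forall t \ae mu, 0 <= t -> Hx x t = U t & sqint k].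

Lemma Hx_vlocint x : vlocint (Hx x).
Proof.
apply: vlocint_qform1; first exact: mxmeasurable_density (sqint_rep x).1.
by move=> b; apply: (intble_locint (intble_qform1_density (sqint_rep x))).
Qed.

Lemma Hx_derivativeP x g : Hx_derivative x g <->
  exists2 U, vAC U (L2H_rep g) & \forall t \ae mu, 0 <= t -> Hx x t = U t.
Proof.
split=> [xg|[U UAC xU]].
  by apply: distr_derivative_vAC xg; [exact: Hx_vlocint|exact: sqint_vlocint (sqint_rep g)].
apply: (vAC_distr_derivative _ _ UAC xU); last exact: aeW.
  exact: mxmeasurable_density (sqint_rep x).1.
exact: (sqint_rep g).1.
Qed.

Lemma vAC_ae d' (U k k' : R -> 'cV[C]_d') : vAC U k -> mxmeasurable halfline k' ->
  (\forall t \ae mu, 0 <= t -> k' t = k t) -> vAC U k'.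
Proof.
move=> Uk mk' kk i.
have aux (f g g' : R -> R) : AC f g -> measurable_fun (halfline : set R) g' ->
    (\forall t \ae mu, 0 <= t -> g' t = g t) -> AC f g'.
  move=> [lg fg] mg' gg'.
  have gS b : \forall t \ae mu, `[0%R, b]%classic t -> g' t = g t.
    by apply: (ae_mono gg') => t + /= ; rewrite in_itv/= => H /andP[/H].
  have mS (b : R) : measurable_fun (`[0%R, b] : set R) g'.
    by apply: measurable_funS mg' => // t /=; rewrite !in_itv/= andbT => /andP[].
  split=> [b|t t0].
    apply: (intble_ae_le _ _ (intble_norm (measurable_itv _) (lg b))) => //.
    by apply: (ae_mono (gS b)) => t + bt => /(_ bt) ->.
  rewrite fg//; congr (_ + _); apply: eq_ae_Rintegral => //.
    exact: intble_measurable (lg t).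
  by apply: (ae_mono (gS t)) => s + st => /(_ st) ->.
have [Re_AC Im_AC] := Uk i; split.
  apply: aux Re_AC (mk' i 0).1 _; by apply: (ae_mono kk) => t + t0 => /(_ t0) ->.
by apply: aux Im_AC (mk' i 0).2 _; apply: (ae_mono kk) => t + t0 => /(_ t0) ->.
Qed.

Lemma max_domP x : max_dom h x <-> exists U k, Hx_AC x U k.
Proof.
split=> [[g /Hx_derivativeP[U Ug xU]]|[U [k [Uk xU sk]]]].
  by exists U, (L2H_rep g); split=> //; exact: sqint_rep.
have [g gk] := L2H_of_fun sk; exists g; apply/Hx_derivativeP; exists U => //.
exact: vAC_ae Uk (sqint_rep g).1 gk.
Qed.

Lemma pH_graphP P1 P0 x y : pH_graph P1 P0 x y <-> exists U k, Hx_AC x U k /\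
  \forall t \ae mu, 0 <= t -> L2H_rep y t = P1 *m k t + P0 *m U t.
Proof.
split=> [[g /Hx_derivativeP[U Ug xU] yg]|[U [k [[Uk xU sk] yk]]]].
  exists U, (L2H_rep g); split; first by split=> //; exact: sqint_rep.
  by apply: (ae_mono (ae_and xU yg)) => t [h1 h2] t0; rewrite h2// h1.
have [g gk] := L2H_of_fun sk; exists g.
  by apply/Hx_derivativeP; exists U => //; exact: vAC_ae Uk (sqint_rep g).1 gk.
apply: (ae_mono (ae_and gk (ae_and yk xU))) => t [h1 [h2 h3]] t0.
by rewrite h2// h1// h3.
Qed.

Lemma Hx_AC_value0 x U k : Hx_AC x U k -> value0 (Hx x) = U 0.
Proof. by move=> [Uk xU _]; exact: vAC_value0 Uk xU. Qed.

Lemma Hx_AC_unique x U k U' k' : Hx_AC x U k -> Hx_AC x U' k' ->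
  (forall t, 0 <= t -> U t = U' t) /\ \forall t \ae mu, 0 <= t -> k t = k' t.
Proof.
move=> [Uk xU _] [Uk' xU' _]; apply: vAC_derivative_unique Uk Uk' _.
by apply: (ae_mono (ae_and xU xU')) => t [h1 h2] t0; rewrite -h1// h2.
Qed.

Lemma Hx_AC_linear a x y U k V l : Hx_AC x U k -> Hx_AC y V l ->
  Hx_AC (a *: x + y) (fun t => a *: U t + V t) (fun t => a *: k t + l t).
Proof.
move=> [Uk xU sk] [Vl yV sl]; split; [exact: vAC_linear|idtac|exact: sqint_linear].
apply: (ae_mono (ae_and (L2H_rep_linear a x y) (ae_and xU yV))) => t [h1 [h2 h3]] t0.
by rewrite /Hx h1// mulmxDr -scalemxAr -h2// -h3.
Qed.

Lemma Hx_AC_intble x U k : Hx_AC x U k -> intble halfline (fun t => qform 1%:M (U t)).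
Proof.
move=> [Uk xU _]; apply: (intble_ae_le _ _ (intble_qform1_density (sqint_rep x))) => //.
  exact: (measurable_rform (@mxmeasurable_cst1 _ _ _) (vAC_measurable Uk) (vAC_measurable Uk)).
apply: ae_halfline; apply: (ae_mono xU) => t + t0 => /(_ t0) <-.
by rewrite ger0_norm ?qform1_ge0.
Qed.

Lemma Hx_AC_of_fun U k (b : R -> R) : vAC U k -> sqint k -> intble halfline b ->
  (\forall t \ae mu, 0 <= t -> exists2 m, 0 < m &
     (forall z, m * qform 1%:M z <= qform (h t) z) /\ qform 1%:M (U t) <= m * b t) ->
  exists x, Hx_AC x U k.
Proof.
move=> Uk sk bi bU; have [f sf hf] := density_inverse (vAC_measurable Uk) bi bU.
have [x xf] := L2H_of_fun sf; exists x; split=> //.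
by apply: (ae_mono (ae_and xf hf)) => t [h1 h2] t0; rewrite /Hx h1// h2.
Qed.

End EnergyVariable.

(** * Green's identity *)

Section Green.
Context {R : realType} {d : nat} (h : energy_density R d).
Local Notation C := R[i].
Local Notation mu := (@lebesgue_measure R).
Local Notation L2 := (L2H h).
Local Notation sqint := (square_integrable h).
Implicit Types (f k U V : R -> 'cV[C]_d) (x y : L2).

Lemma matrix_bound m n (W : 'M[C]_(m, n)) : exists2 M : R, 0 <= M & forall i j, `|W i j| <= M%:C.
Proof.
have E (z : C) : `|z| = (Re `|z|)%:C by rewrite normc_def.
have R0 (z : C) : 0 <= Re `|z| by rewrite normc_def/= sqrtr_ge0.
exists (\sum_i \sum_j Re `|W i j|) => [|i j].
  by apply: sumr_ge0 => i _; apply: sumr_ge0.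
rewrite [leLHS]E lecR (bigD1 i)//= (bigD1 j)//= -addrA lerDl addr_ge0//.
  by apply: sumr_ge0 => l _; exact: R0.
by apply: sumr_ge0 => l _; apply: sumr_ge0 => l2 _; exact: R0.
Qed.

Lemma rform1_density (a b : 'cV[C]_d) t : rform (h t) a b = rform 1%:M a (h t *m b).
Proof. by rewrite /rform sform_mulr mul1mx. Qed.

Lemma intble_rform1 (W : 'M[C]_d) f k : mxmeasurable halfline f -> mxmeasurable halfline k ->
  intble halfline (fun t => qform 1%:M (f t)) -> intble halfline (fun t => qform 1%:M (k t)) ->
  intble halfline (fun t => rform W (f t) (k t)).
Proof.
move=> mf mk fi ki; have [M M0 HM] := matrix_bound W.
apply: (@intble_ae_le _ _ _ (fun t => M * d%:R / 2 * (qform 1%:M (f t) + qform 1%:M (k t)))) => //.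
- by apply: (@measurable_rform _ _ (fun=> W)) => //; move=> i j; exact: cmeasurable_cst.
- by apply: intbleZ => //; exact: intbleD.
- by apply: aeW => t _; exact: rform_bound.
Qed.

(** The weight turns the second factor into its energy variable, so the integrand is the real part
    of [(P1 k + P0 U)^* V + U^* (P1 l + P0 V)]. The [P0] terms cancel by skew-symmetry, and the rest
    is the derivative of [U^* P1 V]. *)
Lemma rdot_green (P1 P0 : 'M[C]_d) x y wx wy U k V l : P1 ^t* = P1 -> P0 ^t* = - P0 ->
  Hx_AC x U k -> Hx_AC y V l ->
  (\forall t \ae mu, 0 <= t -> L2H_rep wx t = P1 *m k t + P0 *m U t) ->
  (\forall t \ae mu, 0 <= t -> L2H_rep wy t = P1 *m l t + P0 *m V t) ->
  rdot wx y + rdot x wy = - rform P1 (U 0) (V 0).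
Proof.
move=> P1H P0H xU yV wxE wyE; have [Uk xUt sk] := xU; have [Vl yVt sl] := yV.
pose g t := rform P1 (k t) (V t) + rform P1 (U t) (l t).
have fg : AC (fun t => rform P1 (U t) (V t)) g.
  by apply: (eq_AC (vAC_sform P1 Uk Vl).1) => t //; rewrite /g /rform ReD.
pose F t := rform (h t) (L2H_rep wx t) (L2H_rep y t) + rform (h t) (L2H_rep x t) (L2H_rep wy t).
have i1 := intble_rform (sqint_rep wx) (sqint_rep y).
have i2 := intble_rform (sqint_rep x) (sqint_rep wy).
have iF : intble halfline F by exact: intbleD.
have Fg : \forall t \ae mu, 0 <= t -> F t = g t.
  have H := ae_and (ae_psd h) (ae_and (ae_and wxE wyE) (ae_and xUt yVt)).
  apply: (ae_mono H) => t [h0 [[h1 h2] [h3 h4]]] t0; rewrite /F.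
  have [hH _] := h0 t0.
  rewrite [X in _ + X](rformC _ _ hH) !rform1_density -/(Hx x t) -/(Hx y t).
  rewrite h1// h2// h3// h4// /g.
  have oneH := (@psd1 R d).1; rewrite !rformDl (rformC (P1 *m l t) _ oneH) (rformC (P0 *m V t) _ oneH).
  rewrite /rform !(sform_mull, sform_mulr) !mul1mx !mulmx1 P1H P0H.
  rewrite -!/(rform _ _ _) (_ : rform (- P0) (U t) (V t) = - rform P0 (U t) (V t)).
    by ring.
  by rewrite /rform /sform mulmxN mulNmx mxE ReN.
have mg := locint_measurable fg.1.
have ig : intble halfline g.
  apply: (intble_ae_le _ mg (intble_norm _ iF)) => //.
  by apply: ae_halfline; apply: (ae_mono Fg) => t + t0 => /(_ t0) ->.
(* Square integrability of [U] and [V] makes [U^* P1 V] integrable, which removes the boundary term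
   at infinity. *)
have iUV : intble halfline (fun t => rform P1 (U t) (V t)).
  exact: (intble_rform1 _ (vAC_measurable Uk) (vAC_measurable Vl) (Hx_AC_intble xU) (Hx_AC_intble yV)).
rewrite -(AC_integrable_vanish fg ig iUV) -RintegralD//.
apply: eq_ae_Rintegral => //; first exact: intble_measurable iF.
exact: ae_halfline.
Qed.

End Green.

(** * The invariance of the energy space under P1 *)

Section Oscillation.
Context {R : realType} {J : finType}.
Local Notation mu := (@lebesgue_measure R).
Local Notation I s t g := (\int[mu]_(x in `[s, t]) g x).
Implicit Types (phi : J -> R -> R).

(** The two signs give opposite cross terms, so one of them makes the cross term nonpositive. *)
Lemma sign_choice (S a : J -> R) : exists2 e : R, e = 1 \/ e = -1 &
  \sum_j (S j + e * a j) ^+ 2 <= \sum_j S j ^+ 2 + \sum_j a j ^+ 2.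
Proof.
have E e : e ^+ 2 = 1 :> R -> \sum_j (S j + e * a j) ^+ 2 =
    \sum_j S j ^+ 2 + \sum_j a j ^+ 2 + e * (\sum_j S j * a j *+ 2).
  move=> e2; rewrite mulr_sumr -!big_split/=; apply: eq_bigr => j _.
  by rewrite sqrrD exprMn e2; ring.
have [s0|s0] := leP 0 (\sum_j S j * a j *+ 2).
  by exists (-1); [right|rewrite E ?sqrrN ?expr1n//; lra].
by exists 1; [left|rewrite E ?expr1n//; lra].
Qed.

Lemma le_I_norm (g : R -> R) s t : locint g -> 0 <= s -> `|I s t g| <= I s t (fun x => `|g x|).
Proof. by move=> lg s0; apply: le_normr_Rintegral => //; exact: locint_itv. Qed.

Lemma locint_sum (phi : J -> R -> R) : (forall j, locint (phi j)) ->
  locint (fun t => \sum_j phi j t).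
Proof.
move=> lphi; elim: (index_enum _) => [|j s IH].
  by under eq_fun do rewrite big_nil; exact: locint_cst.
by under eq_fun do rewrite big_cons; exact: locintD.
Qed.

Lemma locint_norm (g : R -> R) : locint g -> locint (fun t => `|g t|).
Proof. by move=> lg b; exact: intble_norm. Qed.

Lemma locint_sign (e g : R -> R) : measurable_fun (halfline : set R) e -> (forall t, e t = 1 \/ e t = -1) ->
  locint g -> locint (fun t => e t * g t).
Proof.
move=> me e1 lg b; apply: (@intbleM _ _ e g 1) => //.
  by apply: measurable_funS me => // t /=; rewrite !in_itv/= andbT => /andP[].
by move=> t _; have [->|->] := e1 t; rewrite ?normrN normr1.
Qed.

Lemma I_le_sub (g : R -> R) s r r' t : locint g -> (forall x, 0 <= g x) -> 0 <= s -> s <= r ->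
  r <= r' -> r' <= t -> I r r' g <= I s t g.
Proof.
move=> lg g0 s0 sr rr' r't; have := I_norm_mono lg s0 sr rr' r't.
by have -> : (fun x => `|g x|) = g by apply/funext => x; rewrite ger0_norm.
Qed.

(* On a fine partition of [a, b] the signs are chosen one after the other, so
   that the squares of the partial integrals grow by at most the sum of the
   squares of the increments. *)
Lemma oscillating_sign phi a b eta : (forall j, locint (phi j)) -> 0 <= a -> a <= b ->
  0 < eta -> exists e : R -> R, [/\ measurable_fun setT e, forall t, e t = 1 \/ e t = -1 &
    forall s, a <= s -> s <= b -> forall j, `|I a s (fun t => e t * phi j t)| <= eta].
Proof.
move=> lphi a0 ab eta0; pose w t := \sum_j `|phi j t|.
have lw : locint w by apply: locint_sum => j; exact: locint_norm.
have w0 t : 0 <= w t by exact: sumr_ge0.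
have phiw j t : `|phi j t| <= w t by rewrite /w (bigD1 j)//= lerDl sumr_ge0.
pose N : R := #|J|%:R; pose L := I a b w.
have N0 : 0 <= N by exact: ler0n.
have L0 : 0 <= L by apply: Rintegral_ge0.
(* [th] bounds the integral of [w] over one piece. At a grid point the squares sum to at most
   [N th L]; inside a piece [(S + e2 V)^2 <= 2 S^2 + 2 V^2 <= N th (2 L + 2)], which must not exceed
   [eta^2]. The cap [th <= 1] serves to bound [V^2] by [N th]. *)
pose th := Num.min 1 (eta ^+ 2 / (N * (2 * L + 2) + 1)).
have den : 0 < N * (2 * L + 2) + 1 by rewrite ltr_wpDl// mulr_ge0// addr_ge0// mulr_ge0.
have th0 : 0 < th by rewrite lt_min ltr01 divr_gt0// exprn_gt0.
have th1 : th <= 1 by rewrite ge_min lexx.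
have thE : N * th * (2 * L + 2) <= eta ^+ 2.
  have : th <= eta ^+ 2 / (N * (2 * L + 2) + 1) by rewrite ge_min lexx orbT.
  rewrite ler_pdivlMr// => H; apply: le_trans H.
  have -> : N * th * (2 * L + 2) = th * (N * (2 * L + 2)) by ring.
  by rewrite [leRHS]mulrDr mulr1 lerDl ltW.
have [dl dl0 Hdl] := @abs_continuity _ w b th lw th0.
have Iphi j r s : a <= r -> r <= s -> s <= b -> s - r < dl ->
    (I r s (phi j)) ^+ 2 <= th * I r s w.
  move=> ar rs sb sr; have r0 := le_trans a0 ar.
  have H1 : `|I r s (phi j)| <= I r s w.
    apply: le_trans (le_I_norm _ (lphi j) r0) _.
    apply: le_Rintegral => //; [|exact: locint_itv].
    by apply: locint_itv => //; exact: locint_norm.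
  have H2 : I r s w <= th.
    apply/ltW/(le_lt_trans _ (Hdl r s r0 rs sb sr)).
    apply: le_Rintegral => //; try exact: locint_itv.
      by apply: locint_itv => //; exact: locint_norm.
    by move=> x _; exact: ler_norm.
  rewrite -real_normK ?num_real// expr2; apply: ler_pM => //.
  exact: le_trans H1 H2.
have sumN (c : R) (F : J -> R) : (forall j, F j <= c) -> \sum_j F j <= N * c.
  move=> Fc; rewrite mulrC mulr_natr -sumr_const; exact: ler_sum.
pose P r := exists e : R -> R, [/\ measurable_fun setT e, forall t, e t = 1 \/ e t = -1,
    \sum_j (I a (a + r) (fun t => e t * phi j t)) ^+ 2 <= N * th * I a (a + r) w &
    forall s, a <= s -> s <= a + r -> forall j, `|I a s (fun t => e t * phi j t)| <= eta].
suff : P (b - a) by move=> [e [me e1 _ H]]; exists e; split=> // s; move: (H s); rewrite addrC subrK.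
apply: (partition_ind dl0); first by rewrite subr_ge0.
  exists (fun=> 1); split=> //; first by left.
    rewrite addr0 I_point mulr0 big1// => j _; by rewrite I_point expr0n.
  move=> s as_ sa j; have -> : s = a by apply/eqP; rewrite eq_le as_ -[X in _ <= X]addr0 sa.
  by rewrite I_point normr0 ltW.
move=> r r' r0 rr' r'b rd [e [me e1 eS eB]].
pose v j := I (a + r) (a + r') (phi j).
have [e2 e2P e2S] := sign_choice (fun j => I a (a + r) (fun t => e t * phi j t)) v.
pose e' t := if t < a + r then e t else e2.
have me' : measurable_fun setT e'.
  apply: measurable_fun_ifT => //; exact: measurable_fun_ltr.
have e'1 t : e' t = 1 \/ e' t = -1 by rewrite /e'; case: ifP.
have ar : a <= a + r by rewrite lerDl.
have arr' : a + r <= a + r' by rewrite lerD2l.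
have ar0 : 0 <= a + r by exact: le_trans a0 ar.
have ar'b : a + r' <= b by rewrite -lerBrDl.
have le' j := locint_sign (measurable_funTS me') e'1 (lphi j).
have le j := locint_sign (measurable_funTS me) e1 (lphi j).
(* The old and the new signs may differ at the grid point [a + r], which is a null set. *)
have E1 s j : a <= s -> s <= a + r ->
    I a s (fun t => e' t * phi j t) = I a s (fun t => e t * phi j t).
  move=> as_ sr; apply: eq_ae_Rintegral => //.
  - exact: intble_measurable (locint_itv s (le' j) a0).
  - exact: intble_measurable (locint_itv s (le j) a0).
  - apply: (ae_mono (ae_neq (a + r))) => t tn; rewrite /= in_itv/= => /andP[_ ts].
    by rewrite /e' lt_neqAle tn (le_trans ts sr).
have E2 s j : a + r <= s -> I a s (fun t => e' t * phi j t) =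
    I a (a + r) (fun t => e t * phi j t) + e2 * I (a + r) s (phi j).
  move=> rs; rewrite (I_split (le' j) a0 ar rs) E1//; congr (_ + _).
  rewrite -RintegralZl//; last exact: locint_itv.
  apply: eq_Rintegral => t; rewrite inE /= in_itv/= => /andP[rt _].
  by rewrite /e' ltNge rt.
have Iw s : a + r <= s -> I a s w = I a (a + r) w + I (a + r) s w by exact: I_split.
exists e'; split=> //.
  under eq_bigr do rewrite (E2 _ _ arr'); apply: le_trans e2S _.
  rewrite (Iw _ arr') mulrDr lerD// -mulrA; apply: sumN => j.
  by apply: Iphi => //; rewrite (_ : a + r' - (a + r) = r' - r)//; ring.
move=> s as_ sr' j; have [sr|/ltW rs] := leP s (a + r); first by rewrite E1// eB.
rewrite E2// -ler_sqr ?nnegrE ?(ltW eta0)// real_normK ?num_real//.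
have sb := le_trans sr' ar'b.
have srd : s - (a + r) < dl.
  by apply: le_lt_trans rd; rewrite opprD addrA lerD2r lerBlDl.
have H1 : (I a (a + r) (fun t => e t * phi j t)) ^+ 2 <= N * th * L.
  apply: (@le_trans _ _ (\sum_j (I a (a + r) (fun t => e t * phi j t)) ^+ 2)).
    by rewrite (bigD1 j)//= lerDl sumr_ge0// => i _; exact: sqr_ge0.
  apply: le_trans eS _; rewrite ler_wpM2l ?mulr_ge0 ?(ltW th0)//.
  by apply: I_le_sub => //; exact: le_trans rs sb.
have N1 : 1 <= N by rewrite /N ler1n; apply/card_gt0P; exists j.
have Iwth : I (a + r) s w <= th.
  apply/ltW/(le_lt_trans _ (Hdl _ _ ar0 rs sb srd)).
  by have := ler_norm (I (a + r) s w) => /le_trans; apply; exact: le_I_norm.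
have H2 := Iphi j _ _ ar rs sb srd.
have e22 : e2 ^+ 2 = 1 by case: e2P => ->; rewrite ?sqrrN expr1n.
have H3 : th * I (a + r) s w <= N * th.
  apply: (@le_trans _ _ (th * 1)); first by rewrite ler_pM2l// (le_trans Iwth th1).
  by rewrite mulrC ler_pM2r.
have fin (S V B : R) : S ^+ 2 <= N * th * L -> V ^+ 2 <= B -> B <= N * th ->
    e2 ^+ 2 = 1 -> (S + e2 * V) ^+ 2 <= eta ^+ 2.
  move=> {}H1 {}H2 {}H3 {}e22; move: thE; rewrite mulrDr => thE.
  have := sqr_ge0 (S - e2 * V); rewrite sqrrB sqrrD exprMn e22 mul1r => H5.
  have : N * th * (2 * L) = 2 * (N * th * L) by ring.
  by lra.
exact: fin H1 H2 H3 e22.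
Qed.

Lemma measurable_pieces (F : nat -> R -> R) : (forall n, measurable_fun setT (F n)) ->
  measurable_fun (halfline : set R) (fun t => F (Num.truncn t) t).
Proof.
move=> mF _ Y mY.
rewrite (_ : _ `&` _ = \bigcup_n (`[n%:R, n.+1%:R[%classic `&` (F n @^-1` Y))).
  apply: bigcup_measurable => n _; apply: measurableI => //.
  by rewrite -[F n @^-1` Y]setTI; exact: mF.
apply/seteqP; split=> t /=.
  rewrite in_itv/= andbT => -[t0 Yt]; exists (Num.truncn t) => //; split=> //=.
  by rewrite in_itv/=; exact: truncn_itv.
move=> [n _ [/=]]; rewrite !in_itv/= andbT => nt Yt.
by rewrite (truncn_def nt) (le_trans (ler0n _ n) (andP nt).1).
Qed.

(* Subtracting the mean of each unit interval makes the primitive vanish at the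
   integers, hence small everywhere. *)
Lemma oscillating_integrand phi (eta : nat -> R) : (forall j, locint (phi j)) ->
  (forall n, 0 < eta n) -> exists (e : R -> R) (c : nat -> J -> R),
    [/\ measurable_fun (halfline : set R) e, forall t, e t = 1 \/ e t = -1,
      forall n j, `|c n j| <= eta n &
      forall j, let g t := e t * phi j t - c (Num.truncn t) j in
        locint g /\ forall n t, n%:R <= t -> t <= n.+1%:R -> `|I 0 t g| <= 2 * eta n].
Proof.
move=> lphi eta0.
have /choice[e eP] : forall n : nat, exists e : R -> R, [/\ measurable_fun setT e,
    forall t, e t = 1 \/ e t = -1 & forall s, n%:R <= s -> s <= n.+1%:R ->
    forall j, `|I n%:R s (fun t => e t * phi j t)| <= eta n].
  move=> n; apply: oscillating_sign => //; by rewrite ?ler_nat.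
(* The interval has length 1, so this integral is the mean value. *)
pose c n j := I n%:R n.+1%:R (fun t => e n t * phi j t).
have nS n : n%:R <= n.+1%:R :> R by rewrite ler_nat.
exists (fun t => e (Num.truncn t) t), c; split.
- by apply: (@measurable_pieces e) => n; case: (eP n).
- by move=> t; case: (eP (Num.truncn t)).
- by move=> n j; have [_ _] := eP n; apply.
move=> j; set g := (X in let g := X in _); rewrite /=.
have lge n : locint (fun t => e n t * phi j t).
  by have [me e1 _] := eP n; exact: locint_sign (measurable_funTS me) e1 (lphi j).
have lgc n : locint (fun t => e n t * phi j t - c n j).
  by have := locintD (lge n) (locint_cst (- c n j)).
have mg : measurable_fun (halfline : set R) g.
  apply: measurable_funB; last first.
    by apply: (@measurable_pieces (fun n _ => c n j)) => n; exact: measurable_cst.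
  apply: measurable_funM; last exact: locint_measurable.
  by apply: (@measurable_pieces e) => n; case: (eP n).
have lg : locint g.
  move=> b; pose m := (Num.truncn b).+1.
  apply: (@intble_ae_le _ _ _ (fun t => `|phi j t| + \sum_(n < m) `|c n j|)) => //.
  - by apply: measurable_funS mg => // t /=; rewrite !in_itv/= andbT => /andP[].
  - by apply: intbleD => //; [exact: (locint_norm (lphi j))|exact: locint_cst].
  - apply: aeW => t; rewrite /= in_itv/= => /andP[t0 tb].
    apply: le_trans (ler_normB _ _) _; apply: lerD.
      have [_ e1 _] := eP (Num.truncn t).
      by have [->|->] := e1 t; rewrite ?mulN1r ?mul1r ?normrN.
    have tm : (Num.truncn t < m)%N by rewrite ltnS le_truncn.
    by rewrite (bigD1 (Ordinal tm))//= lerDl sumr_ge0.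
have gE n t : n%:R <= t -> t <= n.+1%:R -> I n%:R t g =
    I n%:R t (fun t => e n t * phi j t) - c n j * (t - n%:R).
  move=> nt tn; have n0 : 0 <= n%:R :> R by [].
  have -> : c n j * (t - n%:R) = I n%:R t (fun=> c n j).
    have := AC_increment (ACZ (c n j) (@AC_id R)) n0 nt; rewrite mulr1 => <-.
    by rewrite mulrBr.
  rewrite -RintegralB; [|exact: measurable_itv|exact: locint_itv|exact: locint_itv (locint_cst _) n0].
  apply: eq_ae_Rintegral => //.
  - exact: intble_measurable (locint_itv t lg n0).
  - exact: intble_measurable (locint_itv t (lgc n) n0).
  - apply: (ae_mono (ae_neq t)) => s st; rewrite /= in_itv/= => /andP[ns st'].
    by rewrite /g (truncn_def (n := n))// ns (lt_le_trans _ tn)// lt_neqAle st.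
have g0 n : I 0 n%:R g = 0.
  elim: n => [|n IH]; first exact: I_point.
  by rewrite (I_split lg (lexx 0) _ (nS n))// IH gE// -natrB// subSnn mulr1 subrr addr0.
split=> // n t nt tn; rewrite (I_split lg (lexx 0) _ nt)// g0 add0r gE//.
apply: le_trans (ler_normB _ _) _; rewrite mulr_natl mulr2n; apply: lerD.
  by have [_ _] := eP n; apply.
have tn1 : `|t - n%:R| <= 1 by rewrite ger0_norm ?subr_ge0// lerBlDl natr1.
rewrite normrM -[leRHS]mulr1; apply: ler_pM => //.
by have [_ _] := eP n; apply.
Qed.

End Oscillation.

(** * Operations preserving square integrability *)

Section InvariantSpace.
Context {R : realType} {d : nat} (h : energy_density R d).
Local Notation C := R[i].
Local Notation mu := (@lebesgue_measure R).
Local Notation L2 := (L2H h).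
Local Notation sqint := (square_integrable h).
Implicit Types (f k U V : R -> 'cV[C]_d) (x y : L2).

Lemma mxmeasurable_cst m n (D : set R) (W : 'M[C]_(m, n)) : mxmeasurable D (fun=> W).
Proof. by move=> i j; exact: cmeasurable_cst. Qed.

Lemma measurable_qform1 f : mxmeasurable halfline f ->
  measurable_fun (halfline : set R) (fun t => qform 1%:M (f t)).
Proof. by move=> mf; exact: (measurable_rform (@mxmeasurable_cst1 _ _ _) mf mf). Qed.

Lemma intble_qform1_mulmx (W : 'M[C]_d) f : mxmeasurable halfline f ->
  intble halfline (fun t => qform 1%:M (f t)) ->
  intble halfline (fun t => qform 1%:M (W *m f t)).
Proof.
move=> mf fi; have [M M0 HM] := matrix_bound (W ^t* *m W).
apply: (@intble_ae_le _ _ _ (fun t => M * d%:R * qform 1%:M (f t))) => //.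
- by apply: measurable_qform1; apply: mxmeasurable_mulmx => //; exact: mxmeasurable_cst.
- exact: intbleZ.
- apply: aeW => t _; rewrite ger0_norm ?qform1_ge0//.
  by rewrite {1}/qform sform_mull sform_mulr mulmx1; exact: qform_bound.
Qed.

Lemma sqint_mulmx (W : 'M[C]_d) f : mxmeasurable halfline f ->
  intble halfline (fun t => qform 1%:M (f t)) -> sqint (fun t => W *m f t).
Proof.
move=> mf fi; apply: sqint_qform1; last exact: intble_qform1_mulmx.
by apply: mxmeasurable_mulmx => //; exact: mxmeasurable_cst.
Qed.

Lemma sqint_sign (e : R -> R) f : measurable_fun (halfline : set R) e ->
  (forall t, e t = 1 \/ e t = -1) -> sqint f -> sqint (fun t => (e t)%:C *: f t).
Proof.
move=> me e1 [mf fi]; split.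
  move=> i j; rewrite (_ : (fun t => _) = fun t => (e t)%:C * f t i j); last first.
    by apply/funext => t; rewrite mxE.
  by apply: cmeasurableM => //; split=> //=; exact: measurable_cst.
rewrite (_ : (fun t => _) = fun t => qform (h t) (f t))//; apply/funext => t.
by rewrite qformZ !Re_real !Im_real; have [->|->] := e1 t; rewrite ?sqrrN expr1n expr0n addr0 mul1r.
Qed.

(** The exponential is the integrable majorant for all fields constructed on the half-line. *)
Lemma intble_expRN : intble (halfline : set R) (fun t => expR (- t)).
Proof.
have H : intble setT (exponential_pdf (1 : R)) by exact: integrable_exponential_pdf.
apply: (intble_ae_le _ _ (intbleS _ _ _ H)) => //.
  apply: measurable_funTS; apply: measurableT_comp => //.
apply: aeW => t; rewrite /= in_itv/= andbT => t0.
by rewrite exponential_pdfE// mul1r mulN1r ger0_norm ?expR_ge0.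
Qed.

End InvariantSpace.

Section KeyLemma.
Context {R : realType} {d : nat} (h : energy_density R d).
Local Notation C := R[i].
Local Notation mu := (@lebesgue_measure R).
Local Notation L2 := (L2H h).
Local Notation sqint := (square_integrable h).
Context (P1 P0 : 'M[C]_d) (A : operator L2).
Hypothesis domA : dom A = [set x | max_dom h x /\ value0 (Hx x) = 0].
Hypothesis graphA : forall x, dom A x -> pH_graph P1 P0 x (A x).

(* Oscillating signs [e] make the primitive of [e *: f] so small that it is the
   energy variable of some [x] in the domain of A, although [e *: f] has the
   same norm as [f]; the graph of A then controls [P1 *m f]. *)
Lemma sqint_P1 f : sqint f -> sqint (fun t => P1 *m f t).
Proof.
move=> sf; pose phi (j : 'I_d * bool) t := if j.2 then Im (f t j.1 0) else Re (f t j.1 0).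
have lf := sqint_vlocint sf.
have lphi j : locint (phi j) by rewrite /phi; case: j => i [] /=; have [] := lf i.
have /choice[m mP] : forall n : nat, exists m : R, 0 < m /\ \forall t \ae mu, 0 <= t -> t <= n.+1%:R ->
    forall z : 'cV[C]_d, m * qform 1%:M z <= qform (h t) z.
  by move=> n; exact: density_coerciveN.
pose N : R := #|{: 'I_d * bool}|%:R.
have N0 : 0 <= N by exact: ler0n.
have den : 0 < 4 * N + 1 by rewrite ltr_wpDl// mulr_ge0.
(* Ensures [4 N eta n <= min (m n) 1 * exp (- t)] on [[n, n + 1]]: the factor [m n] pays for the
   coercivity constant, the exponential gives integrability, and [eta n <= 1] bounds the squares of
   the primitives by [4 eta n]. *)
pose eta n := Num.min 1 (Num.min (m n) 1 * expR (- n.+1%:R) / (4 * N + 1)).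
have eta0 n : 0 < eta n.
  have [mn _] := mP n; by rewrite lt_min ltr01 divr_gt0// mulr_gt0 ?expR_gt0// lt_min mn ltr01.
have etaS n (a : R) : `|a| <= 2 * eta n -> a ^+ 2 <= 4 * eta n.
  move=> H; rewrite -real_normK ?num_real//.
  have h1 : eta n <= 1 by rewrite ge_min lexx.
  have h2 := eta0 n; have h3 := normr_ge0 a.
  by nra.
have etaE n (t : R) : t <= n.+1%:R -> N * (4 * eta n) <= Num.min (m n) 1 * expR (- t).
  move=> tn; have [mn _] := mP n.
  have m1 : 0 < Num.min (m n) 1 by rewrite lt_min mn ltr01.
  apply: (@le_trans _ _ (Num.min (m n) 1 * expR (- n.+1%:R))).
    have : eta n <= Num.min (m n) 1 * expR (- n.+1%:R) / (4 * N + 1) by rewrite ge_min lexx orbT.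
    rewrite ler_pdivlMr// => H; apply: le_trans H; have := eta0 n; nra.
  by rewrite ler_pM2l// ler_expR lerN2.
have [e [c [me e1 ce gP]]] := oscillating_integrand lphi eta0.
pose g j t := e t * phi j t - c (Num.truncn t) j.
have lg j : locint (g j) := (gP j).1.
have gB j n t : n%:R <= t -> t <= n.+1%:R ->
  `|\int[mu]_(s in `[0, t]) g j s| <= 2 * eta n := (gP j).2 n t.
pose vec (F : 'I_d * bool -> R) : 'cV[C]_d := \col_i (F (i, false) +i* F (i, true)).
have q1vec F : qform 1%:M (vec F) = \sum_j F j ^+ 2.
  have -> : \sum_j F j ^+ 2 = \sum_i \sum_b F (i, b) ^+ 2.
    by rewrite pair_bigA/=; apply: eq_bigr => -[].
  rewrite qform1E; apply: eq_bigr => i _.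
  by rewrite mxE /= big_bool/= addrC.
have sumN (a : R) (F : 'I_d * bool -> R) : (forall j, F j <= a) -> \sum_j F j <= N * a.
  by move=> Fa; rewrite mulrC mulr_natr -sumr_const; apply: ler_sum.
pose U t := vec (fun j => \int[mu]_(s in `[0, t]) g j s).
pose k t := vec (fun j => g j t).
pose cc (t : R) := vec (c (Num.truncn t)).
have Uk : vAC U k.
  move=> i; split.
    by apply: (eq_AC (AC_prim (lg (i, false)))) => t; rewrite mxE.
  by apply: (eq_AC (AC_prim (lg (i, true)))) => t; rewrite mxE.
have kE t : k t = (e t)%:C *: f t - cc t.
  apply/matrixP => i j; rewrite ord1 !mxE; apply/eqP; rewrite eq_complex /g /phi/=.
  by rewrite !cplxE /= !mul0r subr0 addr0 !eqxx.
have mcc : mxmeasurable halfline cc.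
  move=> i j; split.
    rewrite (_ : (fun t => _) = fun t => c (Num.truncn t) (i, false)).
      by apply: (@measurable_pieces _ (fun n _ => c n (i, false))) => n; exact: measurable_cst.
    by apply/funext => t; rewrite mxE.
  rewrite (_ : (fun t => _) = fun t => c (Num.truncn t) (i, true)).
    by apply: (@measurable_pieces _ (fun n _ => c n (i, true))) => n; exact: measurable_cst.
  by apply/funext => t; rewrite mxE.
have min1 n : Num.min (m n) 1 <= 1 by rewrite ge_min lexx orbT.
have qcc : intble halfline (fun t => qform 1%:M (cc t)).
  apply: (intble_ae_le _ (measurable_qform1 mcc) (@intble_expRN R)) => //.
  apply: aeW => t; rewrite /= in_itv/= andbT => t0; rewrite ger0_norm ?qform1_ge0// q1vec.
  have /andP[_ tn] := truncn_itv t0.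
  apply: (@le_trans _ _ (N * (4 * eta (Num.truncn t)))).
    apply: sumN => j; apply: etaS; apply: le_trans (ce _ j) _.
    by rewrite ler_peMl ?ler1n// ltW.
  apply: le_trans (etaE _ _ (ltW tn)) _.
  by rewrite ler_piMl ?expR_ge0.
have scc : sqint cc by exact: sqint_qform1.
have se : sqint (fun t => (e t)%:C *: f t) by exact: sqint_sign.
have sk : sqint k.
  by rewrite (_ : k = fun t => (e t)%:C *: f t - cc t); [exact: sqint_sub|apply/funext].
have coer : \forall t \ae mu, forall n : nat, 0 <= t -> t <= n.+1%:R ->
    forall z : 'cV[C]_d, m n * qform 1%:M z <= qform (h t) z.
  by apply: ae_foralln => n; have [] := mP n.
have [x xU] : exists x : L2, Hx_AC x U k.
  apply: (Hx_AC_of_fun Uk sk (@intble_expRN R)).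
  apply: (ae_mono coer) => t H t0; have /andP[nt tn] := truncn_itv t0.
  have [mn _] := mP (Num.truncn t); exists (m (Num.truncn t)) => //; split.
    exact: H (ltW tn).
  rewrite q1vec; apply: (@le_trans _ _ (N * (4 * eta (Num.truncn t)))).
    by apply: sumN => j; apply: etaS; apply: gB => //; exact: ltW.
  apply: le_trans (etaE _ _ (ltW tn)) _.
  by rewrite ler_wpM2r ?expR_ge0// ge_min lexx.
have Ax : dom A x.
  rewrite domA; split; first by apply/max_domP; exists U, k.
  rewrite (Hx_AC_value0 xU); apply/matrixP => i j; rewrite !mxE.
  by rewrite !I_point.
have /pH_graphP[U' [k' [xU' AxE]]] := graphA Ax.
have [UU' kk'] := Hx_AC_unique xU xU'.
have sP0U : sqint (fun t => P0 *m U t).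
  exact: sqint_mulmx (vAC_measurable Uk) (Hx_AC_intble xU).
have sP1c : sqint (fun t => P1 *m cc t) by exact: sqint_mulmx.
have mP1f : mxmeasurable halfline (fun t => P1 *m f t).
  by apply: mxmeasurable_mulmx; [exact: mxmeasurable_cst|exact: sf.1].
have mP1ef : mxmeasurable halfline (fun t => (e t)%:C *: (P1 *m f t)).
  rewrite (_ : (fun t => _) = fun t => P1 *m ((e t)%:C *: f t)); last first.
    by apply/funext => t; rewrite scalemxAr.
  by apply: mxmeasurable_mulmx; [exact: mxmeasurable_cst|exact: se.1].
(* Almost everywhere [P1 (e f) = A x - P0 U + P1 cc], and [P0 U] and [P1 cc] lie in the energy space
   because [U] and [cc] are square integrable without weight. *)
have sP1ef : sqint (fun t => (e t)%:C *: (P1 *m f t)).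
  apply: (sqint_ae (sqint_linear 1 (sqint_sub (sqint_rep (A x)) sP0U) sP1c)) => //.
  apply: (ae_mono (ae_and AxE kk')) => t [h1 h2] t0.
  rewrite h1// -h2// -UU'// kE mulmxBr scale1r scalemxAr addrK.
  by rewrite subrK.
(* The sign squares to 1, so multiplying by it once more removes it without changing the energy. *)
rewrite (_ : (fun t => P1 *m f t) = fun t => (e t)%:C *: ((e t)%:C *: (P1 *m f t))).
  exact: sqint_sign.
by apply/funext => t; have [->|->] := e1 t; rewrite ?scale1r// scalerA -rmorphM mulrNN mulr1 scale1r.
Qed.

End KeyLemma.

(** * The adjoint of the maximal operator *)

(** The constant coefficient [a] of the characteristic polynomial is nonzero, and [p - a = q X]; so
    [q(P) P = - a]. Whatever [P] preserves is then preserved by its inverse. *)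
Lemma invmx_horner (F : fieldType) n (P : 'M[F]_n.+1) : P \in unitmx ->
  exists q, invmx P = horner_mx P q.
Proof.
move=> uP; pose p := char_poly P; pose a := p`_0.
have a0 : a != 0.
  rewrite /a char_poly_det mulf_neq0// ?expf_neq0 ?oppr_eq0 ?oner_eq0//.
  by rewrite -unitfE -unitmxE.
have /factor_theorem[q qE] : root (p - a%:P) 0.
  by rewrite rootE !hornerE horner_coef0 subrr.
have := Cayley_Hamilton P; rewrite -/p -[p](subrK a%:P) qE subr0.
rewrite rmorphD rmorphM/= horner_mx_X horner_mx_C => /eqP.
rewrite addr_eq0 => /eqP qP.
exists (- a^-1 *: q); rewrite linearZ/=.
have -> : horner_mx P q = - (a *: invmx P).
  rewrite -[LHS](mulmxK uP) -[X in X *m _]/(horner_mx P q * P) qP.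
  by rewrite mulNmx mul_scalar_mx.
by rewrite scalerN scaleNr opprK scalerA mulVf// scale1r.
Qed.

Section Adjoint.
Context {R : realType} {d : nat} (h : energy_density R d).
Local Notation C := R[i].
Local Notation mu := (@lebesgue_measure R).
Local Notation L2 := (L2H h).
Local Notation sqint := (square_integrable h).
Implicit Types (f k U V : R -> 'cV[C]_d) (x y : L2).

Lemma sqint_invmx (P : 'M[C]_d) : P \in unitmx ->
  (forall f, sqint f -> sqint (fun t => P *m f t)) ->
  forall f, sqint f -> sqint (fun t => invmx P *m f t).
Proof.
(* Stated for a predicate on maps in a free dimension: dimension 0 has to be split off before
   [horner_mx] applies, which cannot be done on [d] directly as [h] depends on it. *)
have aux n (Q : ('cV[C]_n -> 'cV[C]_n) -> Prop) (P' : 'M[C]_n) : P' \in unitmx ->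
    Q id -> (forall F, Q F -> Q (fun z => P' *m F z)) ->
    (forall a F G, Q F -> Q G -> Q (fun z => a *: F z + G z)) -> Q (mulmx (invmx P')).
  case: n Q P' => [|n] Q P' uP Qid QP Qlin.
    rewrite (_ : mulmx _ = id)//; apply/funext => z; by rewrite [LHS]flatmx0 [RHS]flatmx0.
  have [q ->] := invmx_horner uP; elim/poly_ind: q => [|p c IH].
    rewrite rmorph0 (_ : mulmx _ = fun z => (-1) *: id z + id z).
      exact: Qlin.
    by apply/funext => z; rewrite mul0mx scaleN1r addNr.
  rewrite rmorphD rmorphM/= horner_mx_X horner_mx_C.
  have -> : mulmx (horner_mx P' p * P' + c%:M) =
      fun z : 'cV[C]_n.+1 => c *: id z + P' *m (horner_mx P' p *m z).
    apply/funext => z; rewrite mulmxDl mul_scalar_mx addrC mulmxA; congr (_ + _ *m _).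
    exact: comm_horner_mx.
  by apply: Qlin => //; exact: QP.
move=> uP HP f sf.
pose Q (F : 'cV[C]_d -> 'cV[C]_d) := sqint (fun t => F (f t)).
apply: (aux d Q P uP) => //; first by move=> F; exact: HP.
by move=> a F G; exact: sqint_linear.
Qed.

(** Fields of constant direction that vanish for large [t] are energy variables whatever the
    density, since coercivity matters only on a bounded interval. The last clause provides their
    images under [M], without using the invariance under [P1]. *)
Lemma compact_field (f f' : R -> R) (b M : R) (e : 'cV[C]_d) : AC f f' ->
  (forall t, b < t -> f t = 0 /\ f' t = 0) -> (forall t, `|f' t| <= M) ->
  exists x, Hx_AC x (fun t => (f t)%:C *: e) (fun t => (f' t)%:C *: e) /\
    forall W W' : 'M[C]_d, sqint (fun t => W *m ((f' t)%:C *: e) + W' *m ((f t)%:C *: e)).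
Proof.
move=> ff f0 f'M; pose n := (Num.truncn b).+1; pose B : R := n%:R.
have bB : b < B by exact: truncnS_gt.
have [m [m0 hm]] := density_coerciveN h n.
have [K K0 fK] : exists2 K, 0 <= K & forall t, 0 <= t -> `|f t| <= K.
  exists (`|f 0| + \int[mu]_(t in `[0, B]) `|f' t|).
    by rewrite addr_ge0//; apply: Rintegral_ge0.
  move=> t t0; have [tB|Bt] := leP t B; first exact: AC_bounded ff t0 tB.
  rewrite (f0 t (lt_trans bB Bt)).1 normr0 addr_ge0//; exact: Rintegral_ge0.
(* An integrable majorant of the indicator of [[0, B]]. *)
pose Z t := expR B * expR (- t).
have Z1 t : t <= B -> 1 <= Z t.
  by move=> tB; rewrite /Z -expRD -[leLHS]expR0 ler_expR subr_ge0.
have Z0 t : 0 <= Z t by rewrite mulr_ge0// expR_ge0.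
have iZ : intble (halfline : set R) Z by apply: intbleZ => //; exact: intble_expRN.
pose U t := (f t)%:C *: e; pose k t := (f' t)%:C *: e.
have Uk : vAC U k by exact: vAC_scale.
have qE (a : R) : qform 1%:M (a%:C *: e) = a ^+ 2 * qform 1%:M e.
  by rewrite qformZ Re_real Im_real expr0n addr0.
have qZ (F : R -> R) L : measurable_fun (halfline : set R) F -> (forall t, 0 <= t -> `|F t| <= L) ->
    (forall t, b < t -> F t = 0) -> forall t, 0 <= t ->
    qform 1%:M ((F t)%:C *: e) <= L ^+ 2 * qform 1%:M e * Z t.
  move=> mF FL F0 t t0; have L0 : 0 <= L by apply: le_trans (FL t t0).
  have [tB|Bt] := leP t B; last first.
    by rewrite (F0 t (lt_trans bB Bt)) qE expr0n mul0r !mulr_ge0// ?sqr_ge0 ?qform1_ge0.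
  rewrite qE; apply: (@le_trans _ _ (L ^+ 2 * qform 1%:M e)).
    rewrite ler_wpM2r ?qform1_ge0// -real_normK ?num_real// lerXn2r ?nnegrE//.
    exact: FL.
  by rewrite ler_peMr ?Z1// mulr_ge0 ?sqr_ge0 ?qform1_ge0.
have mf : measurable_fun (halfline : set R) f by exact: AC_measurable ff.
have mf' : measurable_fun (halfline : set R) f' by exact: locint_measurable ff.1.
have mU : mxmeasurable halfline U by exact: vAC_measurable Uk.
have mk : mxmeasurable halfline k.
  move=> i j; rewrite (_ : (fun t => _) = fun t => (f' t)%:C * e i j); last first.
    by apply/funext => t; rewrite mxE.
  by apply: cmeasurableM; [split=> //=; exact: measurable_cst|exact: cmeasurable_cst].
have iU : intble halfline (fun t => qform 1%:M (U t)).
  apply: (intble_ae_le _ (measurable_qform1 mU) (intbleZ (K ^+ 2 * qform 1%:M e) _ iZ)) => //.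
  apply: aeW => t; rewrite /= in_itv/= andbT => t0; rewrite ger0_norm ?qform1_ge0//.
  by apply: qZ => // s /f0[].
have ik : intble halfline (fun t => qform 1%:M (k t)).
  apply: (intble_ae_le _ (measurable_qform1 mk) (intbleZ (M ^+ 2 * qform 1%:M e) _ iZ)) => //.
  apply: aeW => t; rewrite /= in_itv/= andbT => t0; rewrite ger0_norm ?qform1_ge0//.
  by apply: qZ => // s /f0[].
have coer : \forall t \ae mu, forall n : nat, exists m : R, 0 < m /\ (0 <= t -> t <= n%:R ->
    forall z : 'cV[C]_d, m * qform 1%:M z <= qform (h t) z).
  by apply: ae_foralln => l; have [c [c0 hc]] := density_coerciveN h l;
    apply: (ae_mono hc) => t H; exists c.
have [x xU] : exists x : L2, Hx_AC x U k.
  apply: (Hx_AC_of_fun Uk (sqint_qform1 h mk ik) (intbleZ (m^-1 * (K ^+ 2 * qform 1%:M e)) _ iZ)) => //.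
  apply: (ae_mono (ae_and coer hm)) => t [Hc Ht] t0.
  have [tB|Bt] := leP t B.
    exists m => //; split; first exact: Ht.
    rewrite !mulrA divff ?gt_eqF// mul1r -mulrA.
    by apply: qZ => // s /f0[].
  have [c [c0 /(_ t0 (ltW (truncnS_gt t)))]] := Hc (Num.truncn t).+1.
  exists c => //; split=> //; rewrite /U (f0 t (lt_trans bB Bt)).1 qE expr0n mul0r.
  by rewrite !mulr_ge0 ?invr_ge0 ?(ltW c0) ?(ltW m0) ?sqr_ge0 ?qform1_ge0.
exists x; split=> // W W'.
have := sqint_linear 1 (sqint_mulmx h W mk ik) (sqint_mulmx h W' mU iU).
by congr square_integrable; apply/funext => t; rewrite scale1r.
Qed.


End Adjoint.

Section AdjointDomain.
Context {R : realType} {d : nat} (h : energy_density R d).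
Local Notation C := R[i].
Local Notation mu := (@lebesgue_measure R).
Local Notation L2 := (L2H h).
Local Notation sqint := (square_integrable h).
Implicit Types (f k U V : R -> 'cV[C]_d) (x y : L2).
Context (P1 P0 : 'M[C]_d).
Hypotheses (P1H : P1 ^t* = P1) (P1u : P1 \in unitmx) (P0H : P0 ^t* = - P0).
Hypothesis P1_sqint : forall f, sqint f -> sqint (fun t => P1 *m f t).

Lemma locint_rform1 (e : 'cV[C]_d) f : vlocint f -> locint (fun t => rform 1%:M e (f t)).
Proof.
move=> lf; have -> : (fun t => rform 1%:M e (f t)) =
    fun t => \sum_i (Re (e i 0) * Re (f t i 0) + Im (e i 0) * Im (f t i 0)).
  apply/funext => t; rewrite /rform sform1 mxE.
  elim/big_rec2: _ => // i a b _ <-; rewrite ReD; congr (_ + _).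
  by rewrite !mxE !cplxE; ring.
by apply: locint_sum => i; apply: locintD; apply: locintZ; case: (lf i).
Qed.

(** Pairing with a unit vector and with ['i] times it extracts the real and the imaginary part of a
    coordinate. *)
Lemma distr_derivative_rform (u g : R -> 'cV[C]_d) :
  (forall (e : 'cV[C]_d) phi, test_function phi ->
    \int[mu]_(t in halfline) (phi^`()%classic t * rform 1%:M e (u t)) =
    - \int[mu]_(t in halfline) (phi t * rform 1%:M e (g t))) -> distr_derivative u g.
Proof.
move=> H phi tphi; apply/matrixP => i j; rewrite ord1 {j} [RHS]mxE !vint_scaleE.
have delta a (z : 'cV[C]_d) : rform 1%:M (a *: delta_mx i 0) z = Re (a^* * z i 0).
  rewrite /rform sformZl sform1 mxE (bigD1 i)//= big1 => [|l /negPf li].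
    by rewrite !mxE !eqxx rmorph1 mul1r addr0.
  by rewrite !mxE li rmorph0 mul0r.
have H1 := H (1 *: delta_mx i 0) _ tphi; have H2 := H ('i *: delta_mx i 0) _ tphi.
have E1 (F : R -> R) (z : R -> 'cV[C]_d) :
    \int[mu]_(t in halfline) (F t * rform 1%:M (1 *: delta_mx i 0) (z t)) =
    \int[mu]_(t in halfline) (F t * Re (z t i 0)).
  by apply: eq_Rintegral => t _; rewrite delta rmorph1 mul1r.
have E2 (F : R -> R) (z : R -> 'cV[C]_d) :
    \int[mu]_(t in halfline) (F t * rform 1%:M ('i *: delta_mx i 0) (z t)) =
    \int[mu]_(t in halfline) (F t * Im (z t i 0)).
  by apply: eq_Rintegral => t _; rewrite delta !cplxE /= mul0r sub0r mulN1r opprK.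
by rewrite !E1 in H1; rewrite !E2 in H2; rewrite H1 H2.
Qed.

Lemma adjoint_domain (V : set 'cV[C]_d) y w : V 0 ->
  (forall x U k wx, Hx_AC x U k ->
    (\forall t \ae mu, 0 <= t -> L2H_rep wx t = P1 *m k t + P0 *m U t) ->
    V (U 0) -> rdot wx y + rdot x w = 0) ->
  exists U k, [/\ Hx_AC y U k,
    \forall t \ae mu, 0 <= t -> L2H_rep w t = P1 *m k t + P0 *m U t &
    forall c, V c -> rform P1 c (U 0) = 0].
Proof.
move=> V0 H; pose v := Hx y.
have mv : mxmeasurable halfline v by exact: mxmeasurable_density (sqint_rep y).1.
have iv : intble halfline (fun t => qform 1%:M (v t)) := intble_qform1_density (sqint_rep y).
pose u t := P1 *m v t; pose g t := L2H_rep w t - P0 *m v t.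
have mu_ : mxmeasurable halfline u by apply: mxmeasurable_mulmx => //; exact: mxmeasurable_cst.
have sg : sqint g by apply: sqint_sub; [exact: sqint_rep|exact: sqint_mulmx].
have lu : vlocint u.
  by apply: vlocint_qform1 => // b; apply: (intble_locint (intble_qform1_mulmx P1 mv iv)).
have lg : vlocint g by exact: sqint_vlocint sg.
have oneH : (1%:M : 'M[C]_d) ^t* = 1%:M by exact: (@psd1 R d).1.
have ug : distr_derivative u g.
  apply: distr_derivative_rform => e phi tphi.
  have [b b0 bP] := test_support tphi; have [dphi _ _] := tphi.
  have ACphi : AC phi phi^`()%classic.
    by apply: Cn_AC; split; [exact: (dphi 0)|split=> //; exact: (dphi 1)].
  have ACphi' : AC phi^`()%classic (phi^`()^`())%classic.
    by apply: Cn_AC; split; [exact: (dphi 1)|split=> //; exact: (dphi 2)].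
  pose M := `|phi^`()%classic 0| + \int[mu]_(t in `[0, b]) `|(phi^`()^`())%classic t|.
  have M0 : 0 <= M by rewrite addr_ge0//; apply: Rintegral_ge0.
  have phiM t : `|phi^`()%classic t| <= M.
    have [t0|/ltW t0] := leP t 0; first by rewrite (bP t (or_introl t0)).2 normr0.
    have [tb|bt] := leP t b; first exact: AC_bounded ACphi' t0 tb.
    by rewrite (bP t (or_intror bt)).2 normr0.
  have [x [xU sx]] := compact_field h e ACphi (fun t bt => bP t (or_intror bt)) phiM.
  have [wx wxE] := L2H_of_fun (sx P1 P0); have [Uk xUt sk] := xU.
  have := H _ _ _ _ xU wxE; rewrite (bP 0 (or_introl (lexx 0))).1 scale0r => /(_ V0).
  rewrite -RintegralD//; last 2 first.
  - exact: intble_rform (sqint_rep wx) (sqint_rep y).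
  - exact: intble_rform (sqint_rep x) (sqint_rep w).
  have [i1 _] := test_locint tphi (locint_rform1 e lu).
  have [_ i2] := test_locint tphi (locint_rform1 e lg).
  move=> E; apply/eqP; rewrite -addr_eq0 -RintegralD//; apply/eqP; rewrite -[RHS]E.
  apply: eq_ae_Rintegral => //.
  - by apply: intble_measurable; exact: intbleD.
  - apply: intble_measurable; apply: intbleD => //.
      exact: intble_rform (sqint_rep wx) (sqint_rep y).
    exact: intble_rform (sqint_rep x) (sqint_rep w).
  - apply: ae_halfline; apply: (ae_mono (ae_and (ae_psd h) (ae_and wxE xUt))) => t [h0 [h1 h2]] t0.
    have [hH _] := h0 t0.
    rewrite [in RHS](rformC (L2H_rep x t) _ hH) !rform1_density -/(Hx x t) -/(Hx y t) h1// h2//.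
    rewrite -!scalemxAr !rformDl !rformZl rformZr /u /g -/v.
    rewrite rformDr rformNr (rformC (L2H_rep w t) _ oneH).
    rewrite /rform !(sform_mull, sform_mulr) !mul1mx !mulmx1 P1H P0H.
    have -> z : sform (- P0 *m h t) e z = - sform (P0 *m h t) e z.
      by rewrite /sform mulNmx mulmxN mulNmx mxE.
    by rewrite ReN -addrA -mulrDr [X in _ = _ + _ * X]addrC.
have [Z Zg uZ] := distr_derivative_vAC lu lg ug.
pose U t := invmx P1 *m Z t; pose k t := invmx P1 *m g t.
have Uk : vAC U k by exact: vAC_mulmx.
have yU : \forall t \ae mu, 0 <= t -> Hx y t = U t.
  by apply: (ae_mono uZ) => t + t0 => /(_ t0) uZt; rewrite /U -uZt mulKmx.
(* [k = P1^-1 g] has to belong to the energy space, hence the invariance under the inverse. *)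
have yUk : Hx_AC y U k by split; [exact: Uk|exact: yU|exact: (sqint_invmx P1u P1_sqint sg)].
have wE : \forall t \ae mu, 0 <= t -> L2H_rep w t = P1 *m k t + P0 *m U t.
  apply: (ae_mono yU) => t + t0 => /(_ t0) yUt.
  by rewrite /k mulKVmx// /g /v yUt subrK.
exists U, k; split=> // c Vc.
pose s1 := (step 1 : R).
have s10 : s1 != 0 by rewrite gt_eqF// step1_gt0.
(* A cut-off equal to 1 at 0 and to 0 beyond 1: the field [chi c] realises the boundary value
   [c]. *)
pose chi t := 1 + (- s1^-1) * step t; pose chi' t := 0 + (- s1^-1) * bump t.
have ACchi : AC chi chi'.
  apply: ACD; first exact: AC_cst.
  by apply: ACZ; have := Cn_AC (@Cn_step R 1); rewrite derive_step.
have s1p : 0 <= s1^-1 by rewrite invr_ge0; apply/ltW/step1_gt0.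
have chi0 t : 1 < t -> chi t = 0 /\ chi' t = 0.
  move=> t1; rewrite /chi /chi' step_ge1 ?ltW// bump_out; last by right; exact: ltW.
  by rewrite mulNr mulVf// subrr mulr0 addr0.
have chiM t : `|chi' t| <= s1^-1.
  rewrite /chi' add0r normrM normrN (ger0_norm s1p) (ger0_norm (bump_ge0 t)).
  by rewrite ler_piMr// bump_le1.
have [x [xU sx]] := compact_field h c ACchi chi0 chiM.
have [wx wxE] := L2H_of_fun (sx P1 P0).
have chi00 : chi 0 = 1 by rewrite /chi step_le0// mulr0 addr0.
have := H _ _ _ _ xU wxE; rewrite chi00 scale1r => /(_ Vc).
rewrite (rdot_green P1H P0H xU yUk wxE wE) chi00 scale1r => /eqP.
by rewrite oppr_eq0 => /eqP.
Qed.

(** For such a [y] the pair [(0, y)] satisfies the adjoint relation, so [y] is the image of 0 under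
    [M]. *)
Lemma max_dom0_dense y :
  (forall x U k, Hx_AC x U k -> U 0 = 0 -> rdot x y = 0) -> y = 0.
Proof.
move=> H; have rdot0 x : rdot x 0 = 0 by rewrite rdotC (dot0l (@rdotDl _ _ h) (@rdotZl _ _ h)).
have [|x U k wx xU wxE U0|U [k [yU yE _]]] := @adjoint_domain [set 0] 0 y.
- by [].
- by rewrite rdot0 add0r (H x U k).
have z0 : Hx_AC (0 : L2) (fun=> 0) (fun=> 0).
  have := Hx_AC_linear (-1) yU yU; rewrite scaleN1r addNr.
  have E (F : R -> 'cV[C]_d) : (fun t => (-1) *: F t + F t) = fun=> 0.
    by apply/funext => t; rewrite scaleN1r addNr.
  by rewrite !E.
have [U0 k0] := Hx_AC_unique yU z0.
apply: L2H_ext; apply: (ae_mono (ae_and (L2H_rep0 h) (ae_and yE k0))) => t [h1 [h2 h3]] t0.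
by rewrite h1// h2// h3// U0// !mulmx0 addr0.
Qed.

End AdjointDomain.

(** * Boundary conditions *)

Section DiagonalForm.
Context {R : realType}.
Local Notation C := R[i].

Lemma rdiag_hermitian n (lam : 'rV[R]_n) : (rdiag lam) ^t* = rdiag lam.
Proof.
rewrite /rdiag tr_diag_mx map_diag_mx; congr diag_mx; apply/matrixP => i j.
by rewrite !mxE; apply/eqP; rewrite eq_complex Re_conj Im_conj /= oppr0 !eqxx.
Qed.

Lemma qform_rdiag n (lam : 'rV[R]_n) z :
  qform (rdiag lam) z = \sum_i lam 0 i * (Re (z i 0) ^+ 2 + Im (z i 0) ^+ 2).
Proof.
rewrite /qform /sform mxE; elim/big_rec2: _ => // i a b _ <-.
rewrite ReD; congr (_ + _); rewrite mul_mx_diag !mxE !cplxE /=.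
by ring.
Qed.

Lemma qform_rdiag_ge0 n (lam : 'rV[R]_n) : (forall i, 0 < lam 0 i) ->
  forall z, 0 <= qform (rdiag lam) z.
Proof.
move=> lam0 z; rewrite qform_rdiag; apply: sumr_ge0 => i _.
by apply: mulr_ge0; [exact: ltW|exact: addr_ge0 (sqr_ge0 _) (sqr_ge0 _)].
Qed.

Lemma psd_rdiag n (lam : 'rV[R]_n) : (forall i, 0 < lam 0 i) -> psd (rdiag lam).
Proof. by move=> lam0; split; [exact: rdiag_hermitian|exact: qform_rdiag_ge0]. Qed.

Lemma qform_rdiag_eq0 n (lam : 'rV[R]_n) : (forall i, 0 < lam 0 i) ->
  forall z, qform (rdiag lam) z <= 0 -> z = 0.
Proof.
move=> lam0 z z0; have z0' : qform (rdiag lam) z = 0.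
  by apply/eqP; rewrite eq_le z0 qform_rdiag_ge0.
apply/matrixP => i j; rewrite ord1 mxE {j}; move/eqP: z0'; rewrite qform_rdiag psumr_eq0; last first.
  by move=> j _; apply: mulr_ge0; [exact: ltW|exact: addr_ge0 (sqr_ge0 _) (sqr_ge0 _)].
move=> /allP/(_ i (mem_index_enum i))/=; rewrite mulf_eq0 gt_eqF//=.
rewrite paddr_eq0 ?sqr_ge0// !sqrf_eq0 => /andP[/eqP a0 /eqP b0].
by apply/eqP; rewrite eq_complex a0 b0 !eqxx.
Qed.

Lemma rdiag_unit n (lam : 'rV[R]_n) : (forall i, 0 < lam 0 i) -> rdiag lam \in unitmx.
Proof.
move=> lam0; rewrite unitmxE det_diag unitfE; apply/prodf_neq0 => i _.
by rewrite mxE eq_complex negb_and /= gt_eqF.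
Qed.

Lemma wnormE n (lam : 'rV[R]_n) z : wnorm lam z = Num.sqrt (qform (rdiag lam) z).
Proof. by []. Qed.

Lemma wcontractionP n m (theta : 'rV[R]_m) (lam : 'rV[R]_n) (T : 'cV[C]_m -> 'cV[C]_n) :
  (forall i, 0 < theta 0 i) ->
  wcontraction theta lam T <-> forall z, qform (rdiag lam) (T z) <= qform (rdiag theta) z.
Proof.
move=> th0; split=> H z; last by rewrite !wnormE; exact: ler_wsqrtr.
have := H z; rewrite !wnormE; apply: contraTT; rewrite -!ltNge => zT.
rewrite ltr_sqrt//; apply: le_lt_trans zT; exact: qform_rdiag_ge0.
Qed.

(* A contraction given on part of the space is extended by zero on the
   Theta-orthogonal complement; its domain is described by a maximal
   Theta-orthonormal family, the columns of [Md]. *)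
Lemma contraction_extension n m (theta : 'rV[R]_m) (lam : 'rV[R]_n)
    (W : 'cV[C]_n -> 'cV[C]_m -> Prop) :
  (forall i, 0 < theta 0 i) -> (forall i, 0 < lam 0 i) -> W 0 0 ->
  (forall a u v u' v', W u v -> W u' v' -> W (a *: u + u') (a *: v + v')) ->
  (forall u v, W u v -> qform (rdiag lam) u <= qform (rdiag theta) v) ->
  exists B : 'M[C]_(n, m), (forall u v, W u v -> u = B *m v) /\
    forall z, qform (rdiag lam) (B *m z) <= qform (rdiag theta) z.
Proof.
move=> th0 lam0 W0 Wlin Wle; pose Th := rdiag theta.
have ThH : Th ^t* = Th by exact: rdiag_hermitian.
(* The columns of [Md] are [k] vectors orthonormal for [Th], those of [Mu] their images.
   Orthonormality gives rank [k], so [k <= m] and a maximal family exists. *)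
pose P k := exists (Mu : 'M[C]_(n, k)) (Md : 'M[C]_(m, k)),
  (forall a, W (Mu *m a) (Md *m a)) /\ Md ^t* *m Th *m Md = 1%:M.
have P0 : exists k, `[< P k >].
  exists 0%N; apply/asboolP; exists 0, 0; split; last by apply/matrixP => -[].
  by move=> a; rewrite !mul0mx.
have Pm k : `[< P k >] -> (k <= m)%N.
  move=> /asboolP[Mu [Md [_ E]]]; rewrite -(mxrank1 C k) -E.
  by apply: leq_trans (mxrankM_maxr _ _) _; exact: rank_leq_row.
case: (ex_maxnP P0 Pm) => k /asboolP[Mu [Md [MW ME]]] kmax.
pose co (v : 'cV[C]_m) := Md ^t* *m Th *m v.
have WB u v : W u v -> u = Mu *m co v /\ v = Md *m co v.
  move=> uv.
  have W' : W (u - Mu *m co v) (v - Md *m co v).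
    by have := Wlin (-1) _ _ _ _ (MW (co v)) uv; rewrite !scaleN1r ![- _ + _]addrC.
  have orth : Md ^t* *m Th *m (v - Md *m co v) = 0.
    by rewrite mulmxBr mulmxA ME mul1mx subrr.
  have v0 : v - Md *m co v = 0.
    apply: contrapT => /eqP vn0; set v' := v - _ in W' orth vn0.
    set u' := u - _ in W'.
    have q0 : 0 < qform Th v'.
      rewrite ltNge; apply: contra vn0 => /(qform_rdiag_eq0 th0) ->; exact: eqxx.
    (* The residual, normalised and appended to the family, would contradict its maximality. *)
    suff : (k + 1 <= k)%N by rewrite addn1 ltnn.
    apply: kmax; apply/asboolP.
    pose s := (Num.sqrt (qform Th v'))^-1.
    exists (row_mx Mu (s%:C *: u')), (row_mx Md (s%:C *: v')); split.
      move=> a; rewrite -[a]vsubmxK !mul_row_col.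
      have E l (z : 'cV[C]_l) (b : 'M[C]_1) : z *m b = b 0 0 *: z.
        by rewrite [b in LHS]mx11_scalar mul_mx_scalar.
      rewrite !E !scalerA addrC [Y in W _ Y]addrC.
      exact: Wlin.
    have s2 : s ^+ 2 * qform Th v' = 1.
      by rewrite /s exprVn sqr_sqrtr ?mulVf ?gt_eqF// ltW.
    have vv : v' ^t* *m Th *m v' = (qform Th v')%:C%:M.
      rewrite [LHS]mx11_scalar; congr (_%:M); apply/eqP; rewrite eq_complex eqxx/=.
      have := sform_conj v' v' ThH; rewrite /sform; case: ((v' ^t* *m Th *m v') 0 0) => a b.
      by move=> /(congr1 (@Im R)); rewrite Im_conj /=; lra.
    rewrite tr_row_mx map_col_mx mul_col_mx mul_col_row ME -scalemxAr orth scaler0.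
    rewrite linearZ/= map_mxZ -!scalemxAl.
    have -> : v' ^t* *m Th *m Md = 0.
      by rewrite -[LHS]trmxCK !trmx_mul !map_mxM trmxCK ThH mulmxA orth trmx0 map_mx0.
    rewrite scaler0 -scalemxAr vv !scale_scalar_mx mulrA.
    rewrite (_ : _ * _ * _ = 1); last first.
      by apply/eqP; rewrite eq_complex !cplxE /= -s2; apply/andP; split; apply/eqP; ring.
    by rewrite scalar_mx_block.
  split; last by apply/eqP; rewrite -subr_eq0 v0.
  (* [W] relates the residual of [u] to the vanishing residual of [v], and the contraction bound
     makes it vanish as well. *)
  apply/eqP; rewrite -subr_eq0; apply/eqP; apply: (qform_rdiag_eq0 lam0).
  apply: le_trans (Wle _ _ W') _; rewrite v0.
  by rewrite /qform /sform mulmx0 mxE.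
exists (Mu *m (Md ^t* *m Th)); split=> [u v /WB[]|z]; first by rewrite -mulmxA.
rewrite -mulmxA; apply: le_trans (Wle _ _ (MW _)) _; rewrite -/(co z).
have qMd : qform Th (Md *m co z) = rform Th z (Md *m co z).
  rewrite /rform /qform /sform; congr (Re (_ 0 0)).
  transitivity ((co z) ^t* *m co z).
    by rewrite trmx_mul map_mxM !mulmxA -!(mulmxA _ _ Md) -(mulmxA (_ ^t*)) (mulmxA _ Th) ME mulmx1.
  by rewrite {1}/co !trmx_mul !map_mxM trmxCK ThH !mulmxA.
(* Bessel's inequality: the orthogonal projection [Md *m co z] is not longer than [z]. *)
have := qform_rdiag_ge0 th0 (z - Md *m co z).
rewrite -/Th qformE rformDl !rformDr !rformNl !rformNr -!qformE.
by rewrite (rformC (Md *m _) _ ThH) -qMd; lra.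
Qed.

End DiagonalForm.

(** * The boundary form in the coordinates given by S *)

Section BoundaryForm.
Context {R : realType} {np nm : nat}.
Local Notation C := R[i].
Context (S : 'M[C]_(np + nm)) (lam : 'rV[R]_np) (theta : 'rV[R]_nm).
Hypothesis hS : S \is unitarymx.
Local Notation L := (rdiag lam).
Local Notation Th := (rdiag theta).
Local Notation P1 := (S ^t* *m block_mx L 0 0 (- Th) *m S).

Lemma rform_boundary (c c' : 'cV[C]_(np + nm)) : rform P1 c c' =
  rform L (usubmx (S *m c)) (usubmx (S *m c')) -
  rform Th (dsubmx (S *m c)) (dsubmx (S *m c')).
Proof.
have -> : rform P1 c c' = rform (block_mx L 0 0 (- Th)) (S *m c) (S *m c').
  by rewrite /rform sform_mulr sform_mull mulmxA.
rewrite /rform -ReN -ReD; congr Re; move: (S *m c) (S *m c') => a b.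
rewrite -{1}[a]vsubmxK -{1}[b]vsubmxK /sform tr_col_mx map_row_mx mul_row_block !mulmx0.
by rewrite addr0 add0r mul_row_col mxE mulmxN mulNmx [(- (_ *m _)) 0 0]mxE.
Qed.

Lemma boundary_value (a : 'cV[C]_np) (b : 'cV[C]_nm) :
  usubmx (S *m (S ^t* *m col_mx a b)) = a /\ dsubmx (S *m (S ^t* *m col_mx a b)) = b.
Proof.
by move/unitarymxP: hS => SS; rewrite mulmxA SS mul1mx col_mxKu col_mxKd.
Qed.

End BoundaryForm.

(** * Boundary conditions and generation *)

Section Generation.
Context {R : realType} {np nm : nat} (h : energy_density R (np + nm)).
Local Notation C := R[i].
Local Notation mu := (@lebesgue_measure R).
Local Notation L2 := (L2H h).
Local Notation sqint := (square_integrable h).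
Context (P1 P0 : 'M[C]_(np + nm)) (S : 'M[C]_(np + nm)).
Context (lam : 'rV[R]_np) (theta : 'rV[R]_nm).
Hypotheses (P1H : P1 ^t* = P1) (P1u : P1 \in unitmx) (P0H : P0 ^t* = - P0).
Hypotheses (hS : S \is unitarymx) (hlam : forall k, 0 < lam 0 k) (htheta : forall j, 0 < theta 0 j).
Hypothesis hP1S : P1 = S ^t* *m block_mx (rdiag lam) 0 0 (- rdiag theta) *m S.
Hypothesis P1_sqint : forall f, sqint f -> sqint (fun t => P1 *m f t).
Context (H : operator L2).
Hypothesis hH : forall x, dom H x -> pH_graph P1 P0 x (- H x).
Local Notation up c := (usubmx (S *m c)).
Local Notation dn c := (dsubmx (S *m c)).
Local Notation L := (rdiag lam).
Local Notation Th := (rdiag theta).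

Let P1E c c' : rform P1 c c' = rform L (up c) (up c') - rform Th (dn c) (dn c').
Proof. by rewrite hP1S rform_boundary. Qed.

Let LP : psd L. Proof. exact: psd_rdiag. Qed.
Let ThP : psd Th. Proof. exact: psd_rdiag. Qed.

Lemma operator_graph x : dom H x -> exists U k, Hx_AC x U k /\
  \forall t \ae mu, 0 <= t -> L2H_rep (- H x) t = P1 *m k t + P0 *m U t.
Proof. by move=> /hH/pH_graphP. Qed.

Lemma operator_graphE x U k (w : L2) : dom H x -> Hx_AC x U k ->
  (\forall t \ae mu, 0 <= t -> L2H_rep w t = P1 *m k t + P0 *m U t) -> - H x = w.
Proof.
move=> /operator_graph[U' [k' [xU' HE]]] xU wE; apply: L2H_ext.
have [UU kk] := Hx_AC_unique xU xU'.
apply: (ae_mono (ae_and (ae_and HE wE) kk)) => t [[h1 h2] h3] t0.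
by rewrite h1// h2// h3// UU.
Qed.

Lemma rdot_graph (x : L2) U k (w : L2) : Hx_AC x U k ->
  (\forall t \ae mu, 0 <= t -> L2H_rep w t = P1 *m k t + P0 *m U t) ->
  2 * rdot w x = - qform P1 (U 0).
Proof.
move=> xU wE; have := rdot_green P1H P0H xU xU wE wE.
by rewrite (rdotC x w) -qformE => <-; lra.
Qed.

(** Rests on the invariance under [P1]: it keeps [P1 k] in the energy space, so that [M] is defined
    on the whole maximal domain. *)
Lemma sqint_graph (x : L2) U k : Hx_AC x U k -> exists w : L2,
  \forall t \ae mu, 0 <= t -> L2H_rep w t = P1 *m k t + P0 *m U t.
Proof.
move=> xU; have [Uk _ sk] := xU; apply: L2H_of_fun.
have := sqint_linear 1 (P1_sqint sk) (sqint_mulmx h P0 (vAC_measurable Uk) (Hx_AC_intble xU)).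
by congr square_integrable; apply/funext => t; rewrite scale1r.
Qed.

(** * A contractive boundary condition yields a generator *)

Section Sufficiency.
Context (T : {linear 'cV[C]_nm -> 'cV[C]_np}).
Hypothesis Tle : forall z, qform L (T z) <= qform Th z.
Hypothesis domH : dom H = [set x | max_dom h x /\ T (dn (value0 (Hx x))) = up (value0 (Hx x))].

Lemma dom_operatorP (x : L2) U k : Hx_AC x U k -> dom H x <-> T (dn (U 0)) = up (U 0).
Proof.
move=> xU; rewrite domH /= (Hx_AC_value0 xU); split=> [[]//|TU]; split=> //.
by apply/max_domP; exists U, k.
Qed.

Lemma operator_dissipative x : dom H x -> rdot (H x) x <= 0.
Proof.
move=> Hx; have [U [k [xU HE]]] := operator_graph Hx.
have TU : T (dn (U 0)) = up (U 0) by apply/(dom_operatorP xU).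
have := rdot_graph xU HE; rewrite qformE P1E -TU -!qformE.
rewrite (dotNl (@rdotZl R _ h)); have := Tle (dn (U 0)); lra.
Qed.

(* [orth] is the space of the boundary values of the adjoint; it is spanned by
   the pairs (a, Th^-1 B^* L a), so its own orthogonal is the graph of T. *)
Let V : set 'cV[C]_(np + nm) := [set c | T (dn c) = up c].
Let orth : set 'cV[C]_(np + nm) := [set c' | forall c, V c -> rform P1 c c' = 0].

(** With [A] the matrix of [T] and [a = up c - A (dn c)], the boundary value with components [a] and
    [Th^-1 A^* L a] lies in [orth], and its pairing with [c] is [qform L a], which therefore
    vanishes. *)
Lemma orth_orth c : (forall c', orth c' -> rform P1 c' c = 0) -> V c.
Proof.
move=> Hc; pose B := lin1_mx (trmx \o T \o trmx).
have TB z : T z = B^T *m z.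
  by apply: trmx_inj; rewrite trmx_mul trmxK mul_rV_lin1 /= trmxK.
pose A := B^T; pose a := up c - A *m dn c.
pose b := invmx Th *m (A ^t* *m L *m a).
have [ua db] := boundary_value hS a b.
have Thb : Th *m b = A ^t* *m L *m a by rewrite /b mulKVmx// rdiag_unit.
have ab v : rform Th v b = rform L (A *m v) a.
  by rewrite /rform /sform trmx_mul map_mxM -mulmxA Thb !mulmxA.
have orth_ab : orth (S ^t* *m col_mx a b).
  move=> v Vv; rewrite P1E ua db ab -TB.
  by rewrite (_ : T (dn v) = up v)// subrr.
have := Hc _ orth_ab; rewrite P1E ua db (rformC b _ ThP.1) ab => E.
have {E}a0 : rform L a a = 0.
  by rewrite {2}/a rformDr rformNr (rformC a (A *m _) LP.1).
rewrite /V /= TB -/A; apply/esym/eqP; rewrite -subr_eq0 -/a; apply/eqP.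
by apply: (qform_rdiag_eq0 hlam); rewrite qformE a0.
Qed.

(** For [z] with boundary value in [orth], Green's identity reads [<s k, M z> = <H (s k), z>], which
    passes to the limit. The description of the adjoint then gives [M x = - w] with a boundary value
    orthogonal to [orth], hence in [V]. *)
Lemma operator_closed (s : nat -> L2) x w : (forall k, dom H (s k)) ->
  s k @[k --> \oo] --> x -> H (s k) @[k --> \oo] --> w -> dom H x /\ H x = w.
Proof.
move=> Hs sx Hw.
have orth0 : orth 0 by move=> c _; rewrite /rform /sform mulmx0 mxE.
have [|z U k wz zU wzE Uorth|U [k [xU wE UV]]] :=
    @adjoint_domain _ _ h P1 P0 P1H P1u P0H P1_sqint orth x (- w).
- exact: orth0.
- have lim1 := cvg_dot (@rdotC _ _ h) (@rdotDl _ _ h) (@rdotZl _ _ h) (@rdot_ge0 _ _ h)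
    (@rdot_norm _ _ h) (a := wz) sx.
  have lim2 := cvg_dot (@rdotC _ _ h) (@rdotDl _ _ h) (@rdotZl _ _ h) (@rdot_ge0 _ _ h)
    (@rdot_norm _ _ h) (a := z) Hw.
  rewrite rdotC (dotNr (@rdotC _ _ h) (@rdotZl _ _ h)) (rdotC z); apply/eqP; rewrite subr_eq0; apply/eqP.
  have E k' : rdot (s k') wz = rdot (H (s k')) z.
    have [U' [k'' [sU' HE]]] := operator_graph (Hs k').
    have TU : V (U' 0) by apply/(dom_operatorP sU').
    have := rdot_green P1H P0H sU' zU HE wzE.
    rewrite (Uorth _ TU) oppr0 (dotNl (@rdotZl _ _ h)) => /eqP.
    by rewrite addrC subr_eq0 => /eqP.
  have {}lim2 : rdot (s k') wz @[k' --> \oo] --> rdot w z by under eq_fun do rewrite E.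
  exact: (cvg_unique (@Rhausdorff R) lim1 lim2).
have domx : dom H x by apply/(dom_operatorP xU)/orth_orth.
split=> //; apply: oppr_inj; exact: operator_graphE domx xU wE.
Qed.

(** A vector [y] orthogonal to the range satisfies [M y = l y], with a boundary value on which the
    form of [P1] is nonnegative; hence [2 l <y, y> = - qform P1 (U 0) <= 0]. *)
Lemma operator_range_perp l : 0 < l -> forall y,
  (forall x, dom H x -> rdot (l%:C *: x - H x) y = 0) -> y = 0.
Proof.
move=> l0 y Hy.
have V0 : V 0 by rewrite /V /= mulmx0 linear0 linear0 raddf0.
have [|x U k wx xU wxE UV|U [k [yU wE UV]]] :=
    @adjoint_domain _ _ h P1 P0 P1H P1u P0H P1_sqint V y (l%:C *: y).
- exact: V0.
- have domx : dom H x by apply/(dom_operatorP xU).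
  have := Hy x domx; rewrite rdotDl (operator_graphE domx xU wxE) rdotZl.
  by rewrite (dotZr (@rdotC _ _ h) (@rdotZl _ _ h)) addrC.
have := rdot_graph yU wE; rewrite rdotZl.
(* Test with the boundary value [(T v, v)] for [v = dn (U 0)]: in the weighted norms [|v|^2 = <T v,
   up (U 0)> <= |v| |up (U 0)|]. *)
have := UV (S ^t* *m col_mx (T (dn (U 0))) (dn (U 0))).
have [ua db] := boundary_value hS (T (dn (U 0))) (dn (U 0)).
rewrite /V /= ua db => /(_ erefl); rewrite P1E ua db -qformE => E.
have CS := rform_CS (T (dn (U 0))) (up (U 0)) LP.
have TU := Tle (dn (U 0)); have q0 := LP.2 (up (U 0)); have q1 := LP.2 (T (dn (U 0))).
rewrite qformE P1E -!qformE => Ey.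
have dnup : qform Th (dn (U 0)) <= qform L (up (U 0)).
  move: E CS TU q0 q1; move: (rform L _ _) (qform Th _) (qform L _) (qform L _) => r q p p'.
  move=> E CS TU q0 q1; have {}E : r = q by lra.
  rewrite E in CS; have [->//|qn] := eqVneq q 0.
  have qgt : 0 < q by rewrite lt0r qn (le_trans q1 TU).
  by rewrite -(ler_pM2l qgt); nra.
apply: (nr_eq0 (@rdot_norm _ _ h)); rewrite /nr; apply/eqP; rewrite sqrtr_eq0.
have : 2 * (l * rdot y y) <= 0 by rewrite Ey oppr_le0 subr_ge0.
by rewrite !pmulr_rle0.
Qed.

Lemma operator_generates : generates_contraction_semigroup H.
Proof.
apply: (generation_perp (@rdotC _ _ h) (@rdotDl _ _ h) (@rdotZl _ _ h) (@rdot_ge0 _ _ h)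
  (@rdot_norm _ _ h) (@L2H_complete _ _ h)).
- exact: operator_dissipative.
- exact: operator_closed.
- exact: operator_range_perp.
Qed.

End Sufficiency.

(** * A generator has a contractive boundary condition *)

Section Necessity.
Hypothesis genH : generates_contraction_semigroup H.
Hypothesis dom0H : forall (x : L2) U k, Hx_AC x U k -> U 0 = 0 -> dom H x.
Hypothesis domH_max : dom H `<=` max_dom h.

Lemma boundary_contraction : exists T : {linear 'cV[C]_nm -> 'cV[C]_np},
    (forall z, qform L (T z) <= qform Th z) /\
    dom H = [set x | max_dom h x /\ T (dn (value0 (Hx x))) = up (value0 (Hx x))].
Proof.
have diss x : dom H x -> rdot (H x) x <= 0.
  exact: (generator_dissipative (@rdotC _ _ h) (@rdotDl _ _ h) (@rdotZl _ _ h) (@rdot_ge0 _ _ h)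
    (@rdot_norm _ _ h) genH).
pose W u v := exists x U k, [/\ dom H x, Hx_AC x U k, u = up (U 0) & v = dn (U 0)].
have [||u v|B [WB Ble]] := @contraction_extension _ _ _ theta lam W htheta hlam.
- have [U [k [xU _]]] := operator_graph (dom0 H).
  have := Hx_AC_linear (-1) xU xU; rewrite scaleN1r addNr => z0.
  exists 0, (fun t => -1 *: U t + U t), (fun t => -1 *: k t + k t).
  by split=> //; [exact: dom0|rewrite scaleN1r addNr mulmx0 linear0..].
- move=> a u v u' v' [x [U [k [Hx xU -> ->]]]] [x' [U' [k' [Hx' xU' -> ->]]]].
  exists (a *: x + x'), (fun t => a *: U t + U' t), (fun t => a *: k t + k' t).
  split; [exact: dom_linear|exact: Hx_AC_linear| |].
    by rewrite mulmxDr -scalemxAr linearP.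
  by rewrite mulmxDr -scalemxAr linearP.
- move=> [x [U [k [Hx xU -> ->]]]]; have [U' [k' [xU' HE]]] := operator_graph Hx.
  have [UU _] := Hx_AC_unique xU xU'; rewrite UU//.
  have := diss x Hx; have := rdot_graph xU' HE.
  rewrite qformE P1E -!qformE (dotNl (@rdotZl _ _ h)); lra.
exists (mulmx B); split=> //; apply/seteqP; split=> x /=.
  move=> Hx; split; first exact: domH_max.
  have [U [k [xU _]]] := operator_graph Hx; rewrite (Hx_AC_value0 xU).
  by apply/esym/WB; exists x, U, k.
move=> [/max_domP[U [k xU]]]; rewrite (Hx_AC_value0 xU) => BU.
have [w wE] := sqint_graph xU.
have dense y : (forall z, dom H z -> rdot z y = 0) -> y = 0.
  move=> Hy; apply: (max_dom0_dense P1H P1u P0H P1_sqint) => z U' k' zU' U'0.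
  by apply: Hy; exact: dom0H zU' U'0.
(* The extended operator is never formed. It suffices that the pair [(x, - w)] is dissipative
   against the graph of [H], and it is, because the boundary value of [x - z] again lies in the
   graph of the contraction [B]. *)
apply: (proj1 (generator_maximal (@rdotC _ _ h) (@rdotDl _ _ h) (@rdotZl _ _ h) (@rdot_ge0 _ _ h)
    (@rdot_norm _ _ h) (@L2H_complete _ _ h) genH dense (w := - w) _)) => z Hz.
have [U' [k' [zU' HE]]] := operator_graph Hz.
have xzU := Hx_AC_linear (-1) zU' xU.
have BU' : B *m dn (U' 0) = up (U' 0) by apply/esym/WB; exists z, U', k'.
have wzE : \forall t \ae mu, 0 <= t -> L2H_rep (w + H z) t =
    P1 *m (-1 *: k' t + k t) + P0 *m (-1 *: U' t + U t).
  have := L2H_rep_linear (-1) (- H z) w; rewrite scaleN1r opprK addrC => lin.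
  apply: (ae_mono (ae_and lin (ae_and HE wE))) => t [h1 [h2 h3]] t0.
  rewrite h1// h2// h3// !mulmxDr -!scalemxAr scalerDr.
  by rewrite addrACA.
have := rdot_graph xzU wzE; rewrite scaleN1r [- z + x]addrC qformE P1E -!qformE.
have -> : up (-1 *: U' 0 + U 0) = B *m dn (-1 *: U' 0 + U 0).
  by rewrite !mulmxDr -!scalemxAr !linearP/= BU' BU.
have := Ble (dn (-1 *: U' 0 + U 0)).
by rewrite -opprD (dotNl (@rdotZl _ _ h)); lra.
Qed.

End Necessity.
End Generation.

Unset Implicit Arguments.

Theorem theorem6p2 (R : realType) (np nm : nat) (hd : (0 < np + nm)%N)
  (P1 P0 : 'M[R[i]]_(np + nm))
  (hP1 : P1 ^t* = P1) (hP1u : P1 \in unitmx) (hP0 : P0 ^t* = - P0)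
  (h : energy_density R (np + nm))
  (A : operator (L2H h))
  (hdomA : dom A = [set x | max_dom h x /\ value0 (Hx x) = 0])
  (hA : forall x, dom A x -> pH_graph P1 P0 x (A x))
  (S : 'M[R[i]]_(np + nm)) (lam : 'rV[R]_np) (theta : 'rV[R]_nm)
  (hS : S \is unitarymx)
  (hlam : forall k, 0 < lam 0 k) (htheta : forall j, 0 < theta 0 j)
  (hP1S : P1 = S ^t* *m block_mx (rdiag lam) 0 0 (- rdiag theta) *m S)
  (H : operator (L2H h))
  (hAH : dom A `<=` dom H) (hHmax : dom H `<=` max_dom h)
  (hH : forall x, dom H x -> pH_graph P1 P0 x (- H x)) :
  generates_contraction_semigroup H <->
  exists T : {linear 'cV[R[i]]_nm -> 'cV[R[i]]_np},
    wcontraction theta lam T /\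
    dom H = [set x | max_dom h x /\
      T (dsubmx (S *m value0 (Hx x))) = usubmx (S *m value0 (Hx x))].
Proof.
have P1_sqint := sqint_P1 hdomA hA.
split=> [genH|[T [/(wcontractionP _ _ htheta) Tle domH]]]; last first.
  exact: (operator_generates hP1 hP1u hP0 hS hlam htheta hP1S P1_sqint hH Tle domH).
have dom0H (x : L2H h) U k : Hx_AC x U k -> U 0 = 0 -> dom H x.
  move=> xU U0; apply: hAH; rewrite hdomA /= (Hx_AC_value0 xU); split=> //.
  by apply/max_domP; exists U, k.
have [T [Tle domH]] :=
  boundary_contraction hP1 hP1u hP0 hlam htheta hP1S P1_sqint hH genH dom0H hHmax.
by exists T; split=> //; apply/wcontractionP.
Qed.
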